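(* Let $d\in\{2,3\}$. Let $(\bar{\mathbf y},\bar p,\bar{\mathbf z},\bar r,\bar{\mathbf u})\in \mathbf H_0^1(\Omega)\times L^2(\Omega)/\mathbb R\times \mathbf H_0^1(\rho,\Omega)\times L^2(\rho,\Omega)/\mathbb R\times\mathbb U_{ad}$ be the solution of the continuous optimality system (OS) of the context, and, for $\mathscr T\in\mathbb T$, let $(\bar{\mathbf y}_{\mathscr T},\bar p_{\mathscr T},\bar{\mathbf z}_{\mathscr T},\bar r_{\mathscr T},\bar{\mathbf u}_{\mathscr T})\in \mathbf V(\mathscr T)\times Q(\mathscr T)\times \mathbf V(\mathscr T)\times Q(\mathscr T)\times\mathbb U_{ad}(\mathscr T)$ be its numerical approximation, i.e. the solution of the discrete optimality system (DOS) of the context. Put $\mathbf e_{\mathbf y}=\bar{\mathbf y}-\bar{\mathbf y}_{\mathscr T}$, $e_p=\bar p-\bar p_{\mathscr T}$, $\mathbf e_{\mathbf u}=\bar{\mathbf u}-\bar{\mathbf u}_{\mathscr T}$. Then, for every $T\in\mathscr T$, the local indicator $$E_{st,T}=\left(h_T^2\|\bar{\mathbf u}_{\mathscr T}+\Delta\bar{\mathbf y}_{\mathscr T}-\nabla\bar p_{\mathscr T}\|_{\mathbf L^2(T)}^2+\tfrac{h_T}2\|[\![\nabla\bar{\mathbf y}_{\mathscr T}\cdot\boldsymbol\nu]\!]\|_{\mathbf L^2(\partial T\setminus\partial\Omega)}^2+\|\mathrm{div}\,\bar{\mathbf y}_{\mathscr T}\|_{L^2(T)}^2\right)^{1/2}$$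 satisfies $$E_{st,T}^2\le C\left(h_T^{d-2}\|\mathbf e_{\mathbf y}\|_{\mathbf L^\infty(\mathcal N_T)}^2+\|e_p\|_{L^2(\mathcal N_T)}^2+h_T^2\|\mathbf e_{\mathbf u}\|_{\mathbf L^2(\mathcal N_T)}^2\right),$$ where $\mathcal N_T$ is the union of the elements $T'\in\mathscr T$ such that $T$ and $T'$ have an interior side in common, and the constant $C>0$ is independent of the solution, of its approximation, of the size of the elements of $\mathscr T$ and of $\#\mathscr T$.
   Context: **Continuous problem.** $\Omega\subset\mathbb R^d$ is an open bounded polytopal domain with Lipschitz boundary; $\mathcal D\subset\Omega$ is a finite set with $m=\#\mathcal D\ge 1$; $\mathbf y_t\in\mathbb R^d$ ($t\in\mathcal D$) are given; $\lambda>0$; $\mathbf a,\mathbf b\in\mathbb R^d$ with $\mathbf a<\mathbf b$ (vector inequalities are componentwise). Bold spaces are $d$-fold products. $\mathbb U_{ad}=\{\mathbf v\in\mathbf L^2(\Omega):\mathbf a\le\mathbf v\le\mathbf b\text{ a.e. in }\Omega\}$. Write $a(\mathbf w,\mathbf v)=\int_\Omega\nabla\mathbf w:\nabla\mathbf v$ and $b(\mathbf v,q)=-\int_\Omega q\,\mathrm{div}\,\mathbf v$ (used whenever the integrals make sense). **Weights.** For a weight $\omega$ in the Muckenhoupt class $A_2(\mathbb R^d)$ and $G\subseteq\Omega$ open, $L^2(\omega,G)$ has norm $(\int_G|v|^2\omega)^{1/2}$, $H^1(\omega,G)=\{v\in L^2(\omega,G):|\nabla v|\in L^2(\omega,G)\}$,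 and $H_0^1(\omega,G)$ is the closure of $C_0^\infty(G)$ in $H^1(\omega,G)$. $L^2(\omega,\Omega)/\mathbb R$ is $L^2(\omega,\Omega)$ modulo constants, identified with the functions having zero integral. Fix $\alpha\in(d-2,2)$. Let $d_{\mathcal D}=\mathrm{dist}(\mathcal D,\partial\Omega)$ if $m=1$ and $d_{\mathcal D}=\min\{\mathrm{dist}(\mathcal D,\partial\Omega),\min\{|t-t'|:t\ne t'\in\mathcal D\}\}$ otherwise. The weight is $\rho(x)=|x-t|^\alpha$ if $\mathcal D=\{t\}$; if $m\ge2$, $\rho(x)=|x-t|^\alpha$ when $|x-t|<d_{\mathcal D}/2$ for some $t\in\mathcal D$, and $\rho(x)=1$ otherwise. Then $\rho\in A_2(\mathbb R^d)$ and $\delta_t\in H_0^1(\rho^{-1},\Omega)'$ for $t\in\mathcal D$; $\langle\cdot,\cdot\rangle$ is the duality pairing, and $\langle(\mathbf y-\mathbf y_t)\delta_t,\mathbf w\rangle=(\mathbf y(t)-\mathbf y_t)\cdot\langle\delta_t,\mathbf w\rangle$ (componentwise). **(OS)**: - $a(\bar{\mathbf y},\mathbf v)+b(\mathbf v,\bar p)=(\bar{\mathbf u},\mathbf v)_{\mathbf L^2(\Omega)}$ for all $\mathbf v\in\mathbf H_0^1(\Omega)$, $b(\bar{\mathbf y},q)=0$ for all $q\in L^2(\Omega)/\mathbb R$; - $a(\mathbf w,\bar{\mathbf z})-b(\mathbf w,\bar r)=\sum_{t\in\mathcal D}\langle(\bar{\mathbf y}-\mathbf y_t)\delta_t,\mathbf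 w\rangle$ for all $\mathbf w\in\mathbf H_0^1(\rho^{-1},\Omega)$, $b(\bar{\mathbf z},s)=0$ for all $s\in L^2(\rho^{-1},\Omega)/\mathbb R$; - $(\bar{\mathbf z}+\lambda\bar{\mathbf u},\mathbf u-\bar{\mathbf u})_{\mathbf L^2(\Omega)}\ge0$ for all $\mathbf u\in\mathbb U_{ad}$. **Meshes.** $\mathbb T$ is a family of conforming, shape regular simplicial meshes $\mathscr T=\{T\}$ of $\bar\Omega$ that are refinements of an initial mesh $\mathscr T_0$; $h_T=\mathrm{diam}(T)$. On an interior side $S$ shared by $T^\pm$, $[\![\mathbf V\cdot\boldsymbol\nu]\!]=\mathbf V|_{T^+}\cdot\boldsymbol\nu^++\mathbf V|_{T^-}\cdot\boldsymbol\nu^-$, with $\boldsymbol\nu^\pm$ the unit normals on $S$ pointing towards $T^\pm$. Note $T\subset\mathcal N_T$. $Q(\mathscr T)=\{q\in C(\bar\Omega):q|_T\in\mathbb P_1(T)\ \forall T\}\cap L^2(\Omega)/\mathbb R$, $\mathbf V(\mathscr T)=\{\mathbf v\in\mathbf C(\bar\Omega):\mathbf v|_T\in\mathbb P_2(T)^d\ \forall T\}\cap\mathbf H_0^1(\Omega)$, $\mathbb U_{ad}(\mathscr T)=\{\mathbf u\in\mathbf C(\bar\Omega):\mathbf u|_T\in\mathbb P_2(T)^d\ \forall T\}\cap\mathbb U_{ad}$. **(DOS)**: - $a(\bar{\mathbf y}_{\mathscr T},\mathbf v)+b(\mathbf v,\bar p_{\mathscr T})=(\bar{\mathbf u}_{\mathscr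 T},\mathbf v)_{\mathbf L^2(\Omega)}$ for all $\mathbf v\in\mathbf V(\mathscr T)$, $b(\bar{\mathbf y}_{\mathscr T},q)=0$ for all $q\in Q(\mathscr T)$; - $a(\mathbf w,\bar{\mathbf z}_{\mathscr T})-b(\mathbf w,\bar r_{\mathscr T})=\sum_{t\in\mathcal D}(\bar{\mathbf y}_{\mathscr T}(t)-\mathbf y_t)\cdot\mathbf w(t)$ for all $\mathbf w\in\mathbf V(\mathscr T)$, $b(\bar{\mathbf z}_{\mathscr T},s)=0$ for all $s\in Q(\mathscr T)$; - $(\bar{\mathbf z}_{\mathscr T}+\lambda\bar{\mathbf u}_{\mathscr T},\mathbf u-\bar{\mathbf u}_{\mathscr T})_{\mathbf L^2(\Omega)}\ge0$ for all $\mathbf u\in\mathbb U_{ad}(\mathscr T)$. *)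

(* Defs.v *)
From HB Require Import structures.
From mathcomp Require Import all_boot all_order all_algebra finmap.
From mathcomp Require Import all_classical all_reals all_analysis.

Set Implicit Arguments.
Unset Strict Implicit.
Unset Printing Implicit Defensive.

Import Order.TTheory GRing.Theory Num.Theory.
Import numFieldNormedType.Exports.

Local Open Scope classical_set_scope.
Local Open Scope ring_scope.

(* Borel sigma-algebra of R^n, generated by the coordinate functions. *)
Section measurable_rV.
Variables (R : realType) (n : nat).

Let coord (i : 'I_n) (x : 'rV[R]_n) : measurableTypeR R := x ord0 i.

Let rV_set0 : g_sigma_preimage coord set0.
Proof. exact: sigma_algebra0. Qed.

Let rV_setC A : g_sigma_preimage coord A -> g_sigma_preimage coord (~` A).
Proof. exact: sigma_algebraC. Qed.

Let rV_bigcup (F : (set 'rV[R]_n)^nat) :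
  (forall i, g_sigma_preimage coord (F i)) ->
  g_sigma_preimage coord (\bigcup_i F i).
Proof. exact: sigma_algebra_bigcup. Qed.

HB.instance Definition _ := @isMeasurable.Build default_measure_display
  'rV[R]_n (g_sigma_preimage coord) rV_set0 rV_setC rV_bigcup.

End measurable_rV.

Lemma measurable_coord (R : realType) n (i : 'I_n) :
  measurable_fun [set: 'rV[R]_n] (fun x : 'rV[R]_n => x ord0 i : measurableTypeR R).
Proof.
move=> _ Y mY; rewrite setTI; apply: sub_sigma_algebra => /=.
rewrite -bigcup_seq/=; exists i => /=; first by rewrite mem_index_enum.
by exists Y => //; rewrite setTI.
Qed.

Lemma measurable_fun_rV (R : realType) n d (T : measurableType d)
    (f : T -> 'rV[R]_n) :
  (forall i, measurable_fun [set: T] (fun t => f t ord0 i : measurableTypeR R)) ->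
  measurable_fun [set: T] f.
Proof.
move=> mf; suff H : g_sigma_preimage
    (fun (i : 'I_n) t => f t ord0 i : measurableTypeR R) `<=` measurable.
  move=> _ A mA; apply: H.
  rewrite (@g_sigma_preimage_comp _ (measurableTypeR R) n 'rV[R]_n
    (fun i (x : 'rV[R]_n) => x ord0 i : measurableTypeR R) T f).
  by exists A.
apply: smallest_sub; first exact: sigma_algebra_measurable.
rewrite -bigcup_seq => A [i _] [B mB <-]; exact: mf.
Qed.

Section lebesgue_rV.
Variable R : realType.

Definition cons_rV n (x : measurableTypeR R * 'rV[R]_n) : 'rV[R]_n.+1 :=
  row_mx (x.1%:M : 'M[R]_1) x.2.

Lemma measurable_cons_rV n : measurable_fun [set: _] (@cons_rV n).
Proof.
apply: measurable_fun_rV => i; rewrite /cons_rV.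
case: (@split_ordP 1 n i) => j ->.
- rewrite [X in measurable_fun _ X](_ : _ = fst); first exact: measurable_fst.
  by apply/funext => t; rewrite (@row_mxEl _ 1 1 n) !ord1 mxE eqxx.
- rewrite [X in measurable_fun _ X](_ : _ =
     (fun x : 'rV[R]_n => x ord0 j : measurableTypeR R) \o snd).
    by apply: measurableT_comp; [exact: measurable_coord|exact: measurable_snd].
  by apply/funext => t /=; rewrite (@row_mxEr _ 1 1 n).
Qed.

Definition leb_step n (mu : {sigma_finite_measure set 'rV[R]_n -> \bar R}) :
    set 'rV[R]_n.+1 -> \bar R :=
  pushforward (lebesgue_measure \x mu)%E (@cons_rV n).

Section leb_step_measure.
Variables (n : nat) (mu : {sigma_finite_measure set 'rV[R]_n -> \bar R}).

Let cons_mfun : {mfun _ >-> _} := mfun_Sub (mem_set (@measurable_cons_rV n)).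

Let leb_stepE : leb_step mu = pushforward (lebesgue_measure \x mu)%E cons_mfun.
Proof. by []. Qed.

Let leb_step0 : leb_step mu set0 = 0%E.
Proof. by rewrite leb_stepE measure0. Qed.

Let leb_step_ge0 A : (0 <= leb_step mu A)%E.
Proof. by rewrite leb_stepE measure_ge0. Qed.

Let leb_step_sigma_additive : semi_sigma_additive (leb_step mu).
Proof. by rewrite leb_stepE; exact: measure_semi_sigma_additive. Qed.

HB.instance Definition _ := isMeasure.Build _ _ _ (leb_step mu)
  leb_step0 leb_step_ge0 leb_step_sigma_additive.

Let leb_step_sigma_finite : sigma_finite setT (leb_step mu).
Proof.
pose uncons (v : 'rV[R]_n.+1) : measurableTypeR R * 'rV[R]_n :=
  (v ord0 ord0, @rsubmx _ 1 1 n v).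
have consK : cancel (@cons_rV n) uncons.
  move=> [x v]; rewrite /uncons /cons_rV /=; congr pair; last by rewrite row_mxKr.
  have -> : ord0 = lshift n (ord0 : 'I_1) by apply/val_inj.
  by rewrite (@row_mxEl _ 1 1 n) mxE eqxx.
have muncons : measurable_fun setT uncons.
  apply/measurable_fun_pair => /=; first exact: measurable_coord.
  apply: measurable_fun_rV => i.
  rewrite [X in measurable_fun _ X](_ : _ = fun t : 'rV[R]_n.+1 =>
    t ord0 (@rshift 1 n i)); first exact: measurable_coord.
  by apply/funext => t; rewrite mxE.
have /sigma_finiteP[F [TF ndF Foo]] := sigma_finiteT (@lebesgue_measure R).
have /sigma_finiteP[G [TG ndG Goo]] := sigma_finiteT mu.
exists (fun k => uncons @^-1` (F k `*` G k)).
  apply/esym; rewrite -subTset => v _ /=.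
  have [i _ Fi] : (\bigcup_i F i) (uncons v).1 by rewrite -TF.
  have [j _ Gj] : (\bigcup_i G i) (uncons v).2 by rewrite -TG.
  exists (maxn i j) => //; split.
    by move: Fi; exact/subsetPset/ndF/leq_maxl.
  by move: Gj; exact/subsetPset/ndG/leq_maxr.
move=> k; have [mF Fk] := Foo k; have [mG Gk] := Goo k; split.
  by rewrite -[X in measurable X]setTI; apply: muncons => //; exact: measurableX.
rewrite /leb_step /pushforward -comp_preimage.
rewrite (_ : uncons \o _ = id); last by apply/funext => x /=; rewrite consK.
by rewrite preimage_id product_measure1E// lte_mul_pinfty// ge0_fin_numE.
Qed.

HB.instance Definition _ := Measure_isSigmaFinite.Build _ _ _ (leb_step mu)
  leb_step_sigma_finite.

End leb_step_measure.

(* Lebesgue measure on R^n, as an n-fold product of lebesgue_measure. *)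
Fixpoint leb n : {sigma_finite_measure set 'rV[R]_n -> \bar R} :=
  match n with
  | 0 => dirac (0 : 'rV[R]_0)
  | m.+1 => leb_step (leb m)
  end.

End lebesgue_rV.

Arguments leb {R} n.

Section euclidean_space.
Variable R : realType.
Implicit Types (n k : nat).

(* The library norm on row vectors is the max norm; distances, diameters and
   balls below are Euclidean. *)
Definition enorm n (x : 'rV[R]_n) : R := Num.sqrt (\sum_i x ord0 i ^+ 2).

Definition dot n (x y : 'rV[R]_n) : R := \sum_i x ord0 i * y ord0 i.

Definition diam n (A : set 'rV[R]_n) : R :=
  sup [set r | exists x y, [/\ A x, A y & r = enorm (x - y)]].

Definition inball_diam n (A : set 'rV[R]_n) : R :=
  sup [set s | exists x r,
    [/\ 0 < r, [set y | enorm (y - x) <= r] `<=` A & s = 2 * r]].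

Definition partial n (i : 'I_n) (f : 'rV[R]_n -> R) : 'rV[R]_n -> R :=
  fun x => 'D_(delta_mx ord0 i : 'rV[R]_n) f x.

Definition component n k (v : 'rV[R]_n -> 'rV[R]_k) (i : 'I_k) : 'rV[R]_n -> R :=
  fun x => v x ord0 i.

Definition is_Pk n k (p : 'rV[R]_n -> R) : Prop :=
  exists c : {ffun 'I_n -> 'I_k.+1} -> R, forall x,
    p x = \sum_(m : {ffun 'I_n -> 'I_k.+1} | (\sum_i m i <= k)%N)
            c m * \prod_i x ord0 i ^+ m i.

Definition LpN n (p : \bar R) (G : set 'rV[R]_n) (f : 'rV[R]_n -> R) : \bar R :=
  Lnorm (leb n) p (EFin \o (f \_ G)).

Definition vLpN n k (p : \bar R) (G : set 'rV[R]_n)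
    (v : 'rV[R]_n -> 'rV[R]_k) : \bar R :=
  LpN p G (fun x => enorm (v x)).

End euclidean_space.

Section sobolev.
Variables (R : realType) (d : nat).
Implicit Types (G : set 'rV[R]_d) (w f g v phi : 'rV[R]_d -> R).

Definition smooth f : Prop :=
  forall (s : seq 'I_d) x, differentiable (foldr (@partial R d) f s) x.

Definition Cc_infty G phi : Prop :=
  smooth phi /\
  exists K, [/\ compact K, K `<=` G & forall x, ~ K x -> phi x = 0].

Definition loc_integrable G f : Prop :=
  measurable_fun G f /\ forall K, compact K -> K `<=` G ->
    (\int[leb d]_(x in K) `|f x|%:E < +oo)%E.

Definition is_weak_partial G (i : 'I_d) f g : Prop :=
  [/\ loc_integrable G f, loc_integrable G g &
      forall phi, Cc_infty G phi ->
        \int[leb d]_(x in G) (f x * partial i phi x) =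
        - \int[leb d]_(x in G) (g x * phi x)].

(* Determined almost everywhere in G when it exists, and the zero function
   otherwise (existence is required in H1). *)
Definition weak_partial G (i : 'I_d) f : 'rV[R]_d -> R :=
  xget (fun=> 0) [set g | is_weak_partial G i f g].

Definition L2 w G f : Prop :=
  measurable_fun G f /\ (\int[leb d]_(x in G) (`|f x| ^+ 2 * w x)%:E < +oo)%E.

Definition L2_mean0 w G f : Prop := L2 w G f /\ \int[leb d]_(x in G) f x = 0.

Definition H1 w G f : Prop :=
  L2 w G f /\ forall i, is_weak_partial G i f (weak_partial G i f) /\
                        L2 w G (weak_partial G i f).

Definition H1norm2 w G f : \bar R :=
  (\int[leb d]_(x in G) (`|f x| ^+ 2 * w x)%:E +
   \sum_i \int[leb d]_(x in G) (`|weak_partial G i f x| ^+ 2 * w x)%:E)%E.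

Definition H10 w G f : Prop :=
  H1 w G f /\ forall e : R, 0 < e ->
    exists2 phi, Cc_infty G phi & (H1norm2 w G (f \- phi)%R < e%:E)%E.

Definition vH10 w G (v : 'rV[R]_d -> 'rV[R]_d) : Prop :=
  forall i, H10 w G (component v i).

(* The pairing of delta_t with an element of H10 w G: the extension by
   continuity of phi |-> phi t, defined on test functions. *)
Definition dirac_pairing w G (t : 'rV[R]_d) f : R :=
  xget 0 [set c | forall phi : nat -> 'rV[R]_d -> R,
    (forall k, Cc_infty G (phi k)) ->
    (fun k => H1norm2 w G (f \- phi k)%R) @ \oo --> (0 : \bar R) ->
    (fun k => phi k t) @ \oo --> c].

(* Value at t of the continuous representative of f; elements of H10 need not
   have one, but the optimal velocity does, by elliptic regularity. *)
Definition point_value G f (t : 'rV[R]_d) : R :=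
  xget (fun=> 0) [set g | {in G, continuous g} /\
                          {ae leb d, forall x, G x -> f x = g x}] t.

Definition form_a G (v w : 'rV[R]_d -> 'rV[R]_d) : R :=
  \sum_i \sum_j \int[leb d]_(x in G)
    (weak_partial G j (component v i) x * weak_partial G j (component w i) x).

Definition form_b G (v : 'rV[R]_d -> 'rV[R]_d) (q : 'rV[R]_d -> R) : R :=
  - \int[leb d]_(x in G) (q x * \sum_i weak_partial G i (component v i) x).

Definition L2_inner G (v w : 'rV[R]_d -> 'rV[R]_d) : R :=
  \int[leb d]_(x in G) dot (v x) (w x).

End sobolev.

Section geometry.
Variables (R : realType) (n : nat).
Local Notation pt := 'rV[R]_n.+1.

(* Convex hull of the rows of V. *)
Definition chull k (V : 'M[R]_(k, n.+1)) : set pt :=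
  [set x | exists c : 'rV[R]_k,
    [/\ forall i, 0 <= c ord0 i, \sum_i c ord0 i = 1 & x = c *m V]].

Definition edges k (V : 'M[R]_(k.+1, n.+1)) : 'M[R]_(k, n.+1) :=
  \matrix_(i < k) (row (lift ord0 i) V - row ord0 V).

(* An n.+1-simplex, given by its vertices. *)
Definition simplex := 'M[R]_(n.+2, n.+1).

Definition nondegenerate (T : simplex) : bool := edges T \in unitmx.

Definition subface (T : simplex) (I : {set 'I_n.+2}) : set pt :=
  [set x | exists c : 'rV[R]_n.+2,
    [/\ forall i, 0 <= c ord0 i, \sum_i c ord0 i = 1,
        forall i, i \notin I -> c ord0 i = 0 & x = c *m T]].

(* The side of T opposite to its i-th vertex. *)
Definition side (T : simplex) (i : 'I_n.+2) : 'M[R]_n.+1 := row' i T.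

Definition boundary (A : set pt) : set pt := closure A `&` closure (~` A).

Definition polytopal (A : set pt) : Prop :=
  exists2 s : seq simplex, all nondegenerate s &
    closure A = [set x | exists2 T, T \in s & chull T x].

(* Near each boundary point A is, in suitable orthonormal coordinates, the
   part of space above the graph of a Lipschitz function. *)
Definition lipschitz_boundary (A : set pt) : Prop :=
  forall x, boundary A x ->
  exists (r L : R) (Q : 'M[R]_n.+1) (gamma : 'rV[R]_n -> R),
    [/\ 0 < r, Q *m Q^T = 1%:M,
        forall s t, `|gamma s - gamma t| <= L * enorm (s - t) &
        forall z, enorm (z - x) < r ->
          (A z <-> gamma (col' ord_max (z *m Q)) < (z *m Q) ord0 ord_max)].

Definition mesh := {fset simplex}.

Definition conforming_mesh (A : set pt) (M : mesh) : Prop :=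
  [/\ forall T, T \in M -> nondegenerate T,
      closure A = [set x | exists2 T, T \in M & chull T x] &
      forall T T', T \in M -> T' \in M -> T != T' ->
        chull T <> chull T' /\
        exists I J, chull T `&` chull T' = subface T I /\
                    chull T `&` chull T' = subface T' J].

Definition refines (M M0 : mesh) : Prop :=
  forall T, T \in M -> exists2 T0, T0 \in M0 & chull T `<=` chull T0.

Definition shape_regular (MM : set mesh) : Prop :=
  exists sigma : R, forall M T, MM M -> T \in M ->
    diam (chull T) <= sigma * inball_diam (chull T).

(* The i-th side of T is an interior side, shared by T and T'. *)
Definition shared_side (M : mesh) (T : simplex) (i : 'I_n.+2) (T' : simplex) :
    Prop :=
  [/\ T' \in M, T' != T & exists j, chull (side T i) = chull (side T' j)].

Definition side_patch (M : mesh) (T : simplex) : set pt :=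
  [set x | exists2 T', T' = T \/ (exists i, shared_side M T i T') &
                       chull T' x].

(* The polynomial of degree at most k that agrees with v on T. *)
Definition local_poly k (T : simplex) (v : pt -> R) : pt -> R :=
  xget (fun=> 0) [set p | is_Pk k p /\ forall x, chull T x -> p x = v x].

(* Unit normal to the side S of T, pointing towards T. *)
Definition side_normal (S : 'M[R]_n.+1) (T : simplex) : pt :=
  xget 0 [set nu | [/\ enorm nu = 1,
    forall x y, chull S x -> chull S y -> dot (x - y) nu = 0 &
    forall x y, chull T x -> chull S y -> 0 <= dot (x - y) nu]].

Definition ref_simplex : set 'rV[R]_n :=
  [set s | (forall i, 0 <= s ord0 i) /\ \sum_i s ord0 i <= 1].

(* Integral over the n-dimensional simplex chull S with respect to surface
   measure, through the affine parametrization by the reference simplex. *)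
Definition side_integral (S : 'M[R]_n.+1) (f : pt -> R) : \bar R :=
  ((Num.sqrt (\det (edges S *m (edges S)^T)))%:E *
   \int[leb n]_(s in ref_simplex) (f (row ord0 S + s *m edges S))%:E)%E.

(* (grad v) nu, where v is restricted to T. *)
Definition normal_deriv (T : simplex) (v : pt -> pt) (nu x : pt) : pt :=
  \row_k \sum_j partial j (local_poly 2 T (component v k)) x * nu ord0 j.

Definition jump (S : 'M[R]_n.+1) (T T' : simplex) (v : pt -> pt) (x : pt) : pt :=
  normal_deriv T v (side_normal S T) x + normal_deriv T' v (side_normal S T') x.

(* L2 norm of the jump over the interior sides of T. *)
Definition jump_norm (M : mesh) (T : simplex) (v : pt -> pt) : \bar R :=
  ((\sum_(i < n.+2) \sum_(T' <- M | `[< shared_side M T i T' >])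
     side_integral (side T i)
       (fun x => enorm (jump (side T i) T T' v x) ^+ 2)%R) `^ 2^-1)%E.

End geometry.

Section control_problem.
Variables (R : realType) (n : nat).
Local Notation pt := 'rV[R]_n.+1.
Local Notation one := (fun=> 1 : R).
Variable Omega : set pt.

Definition dist_obs (D : {fset pt}) : R :=
  inf ([set r | exists t x, [/\ t \in D, boundary Omega x & r = enorm (t - x)]]
       `|` [set r | exists t t', [/\ t \in D, t' \in D, t != t' &
                                     r = enorm (t - t')]]).

Definition rho (D : {fset pt}) (alpha : R) (x : pt) : R :=
  if [seq t <- D | (#|` D| == 1)%N || (enorm (x - t) < dist_obs D / 2)]
    is t :: _ then enorm (x - t) `^ alpha else 1.

Definition Uad (a b : pt) (u : pt -> pt) : Prop :=
  (forall i, L2 one Omega (component u i)) /\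
  {ae leb n.+1, forall x, Omega x ->
     forall i, a ord0 i <= u x ord0 i <= b ord0 i}.

Definition OS (D : {fset pt}) (yt : pt -> pt) (lambda : R) (a b : pt)
    (alpha : R) (y : pt -> pt) (p : pt -> R) (z : pt -> pt) (r : pt -> R)
    (u : pt -> pt) : Prop :=
  let w := rho D alpha in
  let w' := fun x => (rho D alpha x)^-1 in
  [/\ [/\ vH10 one Omega y, L2_mean0 one Omega p,
          vH10 w Omega z, L2_mean0 w Omega r & Uad a b u],
      (forall v, vH10 one Omega v ->
         form_a Omega y v + form_b Omega v p = L2_inner Omega u v) /\
      (forall q, L2_mean0 one Omega q -> form_b Omega y q = 0),
      (forall v, vH10 w' Omega v ->
         form_a Omega v z - form_b Omega v r =
         \sum_(t <- D) \sum_i (point_value Omega (component y i) t - yt t ord0 i) *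
                              dirac_pairing w' Omega t (component v i)) /\
      (forall s, L2_mean0 w' Omega s -> form_b Omega z s = 0) &
      forall v, Uad a b v ->
        0 <= L2_inner Omega (fun x => z x + lambda *: u x) (fun x => v x - u x)].

Variable M : mesh R n.

Definition pw_Pk k (v : pt -> R) : Prop :=
  {within closure Omega, continuous v} /\
  forall T, T \in M -> exists2 p, is_Pk k p & forall x, chull T x -> v x = p x.

Definition Qh (q : pt -> R) : Prop := pw_Pk 1 q /\ L2_mean0 one Omega q.

Definition Vh (v : pt -> pt) : Prop :=
  (forall i, pw_Pk 2 (component v i)) /\ vH10 one Omega v.

Definition Uadh (a b : pt) (u : pt -> pt) : Prop :=
  (forall i, pw_Pk 2 (component u i)) /\ Uad a b u.

Definition DOS (D : {fset pt}) (yt : pt -> pt) (lambda : R) (a b : pt)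
    (y : pt -> pt) (p : pt -> R) (z : pt -> pt) (r : pt -> R)
    (u : pt -> pt) : Prop :=
  [/\ [/\ Vh y, Qh p, Vh z, Qh r & Uadh a b u],
      (forall v, Vh v ->
         form_a Omega y v + form_b Omega v p = L2_inner Omega u v) /\
      (forall q, Qh q -> form_b Omega y q = 0),
      (forall v, Vh v ->
         form_a Omega v z - form_b Omega v r =
         \sum_(t <- D) dot (y t - yt t) (v t)) /\
      (forall s, Qh s -> form_b Omega z s = 0) &
      forall v, Uadh a b v ->
        0 <= L2_inner Omega (fun x => z x + lambda *: u x) (fun x => v x - u x)].

Definition residual (T : simplex R n) (y : pt -> pt) (p : pt -> R)
    (u : pt -> pt) (x : pt) : pt :=
  \row_k (u x ord0 k
          + \sum_j partial j (partial j (local_poly 2 T (component y k))) x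
          - partial k (local_poly 1 T p) x).

Definition local_div (T : simplex R n) (y : pt -> pt) (x : pt) : R :=
  \sum_j partial j (local_poly 2 T (component y j)) x.

Definition E_st (T : simplex R n) (y : pt -> pt) (p : pt -> R)
    (u : pt -> pt) : \bar R :=
  let h := diam (chull T) in
  (((h ^+ 2)%:E * vLpN 2%:E (chull T) (residual T y p u) ^+ 2
    + (h / 2)%:E * jump_norm M T y ^+ 2
    + LpN 2%:E (chull T) (local_div T y) ^+ 2) `^ 2^-1)%E.

End control_problem.

(* Main.v *)
Require Import Defs.
From HB Require Import structures.
From mathcomp Require Import all_boot all_order all_algebra finmap.
From mathcomp Require Import all_classical all_reals all_analysis.
From mathcomp Require Import perm measurable_realfun ess_sup_inf ring lra.

Set Implicit Arguments.
Unset Strict Implicit.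
Unset Printing Implicit Defensive.

Import Order.TTheory GRing.Theory Num.Theory.
Import numFieldNormedType.Exports.

Local Open Scope classical_set_scope.
Local Open Scope ring_scope.

(* The sesquilinear forms of mathcomp export another [nondegenerate]. *)
Local Notation nondegenerate := Defs.nondegenerate.

(* Only the state equation of (OS) matters. Testing it with a smooth bump phi
   supported in a ball of radius comparable to h = h_T, and moving all the
   derivatives onto phi, one sees that the functional
     phi |-> int uh_k phi + int yh_k lap phi + int ph d_k phi
   is controlled by the norms of e_u, e_y and e_p, without derivatives of e_y.
   In a ball inside T it equals int (residual_k * phi), and the residual is a
   polynomial of degree 2: two radii determine its value at the center, since
   they eliminate the second moment of phi, and its values near the incenter
   determine it on T.  The divergence is treated in the same way.
   In a ball centered at a point c of a shared side, with signed distance l to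
   that side, the functional is a volume residual plus J(c)/2 int |l| lap phi,
   where J is the jump of the normal derivative; all other terms vanish by
   Green's formula or by parity, as phi is radial about c.  This bounds J away
   from the edges of the side, hence on the side, where it is affine. *)

(** * Lebesgue measure under homotheties *)

(** The velocity error enters through its maximum norm alone, so both derivatives of the Laplacian
    have to rest on the test function. A smooth bump can carry them and lies in [H10] by
    construction of that space; its support is a ball, so every integration by parts takes place on
    the whole space and leaves no boundary term. The bumps must be supported in the open set
    [Omega], whereas the mesh covers its closure: the Lipschitz boundary closes this gap. As
    [weak_partial] is a choice among functions that agree almost everywhere, computing with it rests
    on the fundamental lemma of the calculus of variations. The constants depend only on the
    dimension [d] and on [t = 1 / (8 s ^ 2)], where [s] bounds the shape regularity: a ball of
    radius [t h] fits into [T] and into each neighbour. Relative to the integral of the bump at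
    scale [h], the errors in velocity, pressure and control count with the factors [h^-2],
    [h^(-d/2-1)] and [h^(-d/2)]. Squared and multiplied by the weight [h^2] and the volume [h^d],
    these become the powers [h^(d-2)], [1] and [h^2] of the estimate. *)

Section lebesgue_affine_line.
Variable R : realType.
Variables (a c : R).
Hypothesis a0 : a != 0.

Let aff (x : measurableTypeR R) : measurableTypeR R := a * x + c.

Let maff : measurable_fun setT aff.
Proof.
apply: measurable_funD => //; apply: measurable_funM => //.
Qed.

(** Lebesgue measure is characterised by its values on the intervals []u, v]], and the image measure
    scaled by [|a|] takes these values. *)
Lemma lebesgue_affine (A : set (measurableTypeR R)) : measurable A ->
  lebesgue_measure ((fun x : R => a * x + c) @^-1` A) =
  ((`|a|^-1)%R%:E * lebesgue_measure A)%E.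
Proof.
have na0 : 0 < `|a| by rewrite normr_gt0.
pose p : {measure set (measurableTypeR R) -> \bar R} :=
  measure_function_pushforward__canonical__measure_function_Measure
    lebesgue_measure maff.
pose m : {measure set (measurableTypeR R) -> \bar R} :=
  mscale (NngNum (ltW na0)) p.
move=> mA.
have -> : lebesgue_measure A = m A.
  apply: lebesgue_measure_unique => // _ [[u v]] _ <- /=.
  rewrite /m /mscale /p /= /pushforward /=.
  rewrite /aff lebesgue_measure_itv/= lte_fin.
  have [a_gt0|a_lt0|] := ltgtP 0 a; last by move=> h; move: (a0); rewrite -h eqxx.
    rewrite [X in lebesgue_measure X](_ : _ = `](u - c) / a, (v - c) / a]%classic); last first.
      apply/seteqP; split => x /=; rewrite !in_itv/= => /andP[h1 h2]; apply/andP; split.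
      - by rewrite ltr_pdivrMr// ltrBlDr mulrC.
      - by rewrite ler_pdivlMr// lerBrDr mulrC.
      - by move: h1; rewrite ltr_pdivrMr// ltrBlDr mulrC.
      - by move: h2; rewrite ler_pdivlMr// lerBrDr mulrC.
    rewrite lebesgue_measure_itv/= lte_fin ltr_pM2r ?invr_gt0// ltrD2r.
    case: ifPn => // _; last by rewrite mule0.
    rewrite gtr0_norm// -EFinB -EFinM; congr (_%:E).
    by field; rewrite gt_eqF.
  (* For [a < 0] the preimage is reversed and its closed end changes side; the length is the
     same. *)
  rewrite [X in lebesgue_measure X](_ : _ = `[(v - c) / a, (u - c) / a[%classic); last first.
    apply/seteqP; split => x /=; rewrite !in_itv/= => /andP[h1 h2]; apply/andP; split.
    - by rewrite ler_ndivrMr// lerBrDr mulrC.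
    - by rewrite ltr_ndivlMr// ltrBlDr mulrC.
    - by move: h2; rewrite ltr_ndivlMr// ltrBlDr mulrC.
    - by move: h1; rewrite ler_ndivrMr// lerBrDr mulrC.
  rewrite lebesgue_measure_itv/= lte_fin ltr_nM2r ?invr_lt0// ltrD2r.
  case: ifPn => // _; last by rewrite mule0.
  rewrite ltr0_norm// -EFinB -EFinM; congr (_%:E).
  by field; rewrite lt_eqF.
rewrite /m /mscale /p /= muleA -EFinM mulVf ?mul1e//.
by rewrite gt_eqF.
Qed.

Lemma ge0_integral_affine (f : R -> \bar R) :
  measurable_fun [set: measurableTypeR R] f -> (forall x, 0 <= f x)%E ->
  (\int[lebesgue_measure]_t f (a * t + c)%R =
   (`|a|^-1)%R%:E * \int[lebesgue_measure]_t f t)%E.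
Proof.
move=> mf f0.
have na0 : 0 <= `|a|^-1 by rewrite invr_ge0.
transitivity (\int[pushforward lebesgue_measure aff]_t f t)%E.
  rewrite ge0_integral_pushforward//=.
transitivity (\int[mscale (NngNum na0) lebesgue_measure]_t f t)%E.
  by apply: eq_measure_integral => A mA _; exact: lebesgue_affine.
by rewrite ge0_integral_mscale.
Qed.

End lebesgue_affine_line.

Section leb_affine.
Variable R : realType.

Lemma lebS n (A : set 'rV[R]_n.+1) : leb n.+1 A =
  (\int[lebesgue_measure]_t leb n [set v : 'rV[R]_n | A (cons_rV (t, v))])%E.
Proof.
rewrite [LHS]/=/leb_step/pushforward/= /product_measure1/=.
apply: eq_integral => t _ /=; congr (leb n _).
apply/seteqP; split => v /=; rewrite /xsection/= ?inE//.
Qed.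

Lemma measurable_leb_section n (A : set 'rV[R]_n.+1) : measurable A ->
  measurable_fun [set: measurableTypeR R]
    (fun t : measurableTypeR R => leb n [set v : 'rV[R]_n | A (cons_rV (t, v))]).
Proof.
move=> mA.
have mA' : measurable ((@cons_rV R n) @^-1` A).
  by rewrite -[X in measurable X]setTI; exact: measurable_cons_rV.
have := measurable_fun_xsection (leb n) mA'.
apply: eq_measurable_fun => t _ /=; congr (leb n _).
apply/seteqP; split => v /=; rewrite /xsection/= ?inE//.
Qed.

Definition affrV n (a : R) (c x : 'rV[R]_n) := a *: x + c.

Lemma measurable_affrV n a c : measurable_fun [set: 'rV[R]_n] (@affrV n a c).
Proof.
apply: measurable_fun_rV => i.
rewrite [X in measurable_fun _ X](_ : _ =
  (fun x : 'rV[R]_n => a * x ord0 i + c ord0 i : measurableTypeR R)); last first.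
  by apply/funext => x; rewrite !mxE.
apply: measurable_funD => //; apply: measurable_funM => //.
exact: measurable_coord.
Qed.

Lemma affrV_cons n a (c : 'rV[R]_n.+1) (t : R) v :
  affrV a c (cons_rV (t, v)) =
  cons_rV (a * t + c ord0 ord0, affrV a (@rsubmx _ 1 1 n c) v).
Proof.
apply/rowP => i; rewrite /affrV /cons_rV !mxE; case: split_ordP => j ->.
  rewrite !mxE !ord1 eqxx !mulr1n; congr (_ + c _ _).
  exact/val_inj.
by rewrite !mxE.
Qed.

(** Induction on the dimension: [leb] is an iterated product, and each coordinate contributes one
    factor [|a|^-1]. *)
Lemma leb_affine n (a : R) (c : 'rV[R]_n) A : a != 0 -> measurable A ->
  leb n (affrV a c @^-1` A) = (((`|a|^-1) ^+ n)%R%:E * leb n A)%E.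
Proof.
move=> a0; elim: n c A => [|n IH] c A mA.
  rewrite expr0 mul1e (_ : _ @^-1` _ = A)//.
  by apply/seteqP; split => x /=; rewrite [affrV a c x]thinmx0 [x]thinmx0.
rewrite !lebS.
have mS t : measurable [set v : 'rV[R]_n | A (cons_rV (t, v))].
  have mA' : measurable ((@cons_rV R n) @^-1` A).
    by rewrite -[X in measurable X]setTI; exact: measurable_cons_rV.
  have := measurable_xsection t mA'.
  rewrite [X in measurable X](_ : _ = [set v : 'rV[R]_n | A (cons_rV (t, v))])//.
  by apply/seteqP; split => v /=; rewrite /xsection/= ?inE.
transitivity (\int[lebesgue_measure]_t (((`|a|^-1) ^+ n)%R%:E *
    leb n [set v : 'rV[R]_n | A (cons_rV ((a * t + c ord0 ord0)%R, v))]))%E.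
  apply: eq_integral => t _.
  rewrite -(IH (@rsubmx _ 1 1 n c))//; congr (leb n _).
  by apply/seteqP; split => v /=; rewrite affrV_cons.
rewrite ge0_integralZl//; last first.
  have maff : measurable_fun [set: measurableTypeR R]
      (fun t : measurableTypeR R => a * t + c ord0 ord0 : measurableTypeR R).
    by apply: measurable_funD => //; apply: measurable_funM.
  exact: (measurableT_comp (measurable_leb_section mA) maff).
rewrite (ge0_integral_affine (f := fun t => leb n [set v : 'rV[R]_n | A (cons_rV (t, v))]) _ a0)//.
  by rewrite exprSr EFinM muleA.
exact: measurable_leb_section.
Qed.

End leb_affine.

(** * Measurability of open and compact sets and of continuous functions *)

Section open_measurable_rV.
Variables (R : realType) (n : nat).
Implicit Types (A : set 'rV[R]_n).

Lemma measurable_rV_box (I : 'I_n -> set (measurableTypeR R)) :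
  (forall i, measurable (I i)) ->
  measurable [set v : 'rV[R]_n | forall i, I i (v ord0 i)].
Proof.
move=> mI.
rewrite (_ : [set v | _] = \bigcap_(i in [set: 'I_n])
    [set v : 'rV[R]_n | I i (v ord0 i)]).
  apply: fin_bigcap_measurable => // i _.
  rewrite -[X in measurable X]setTI; exact: measurable_coord.
by apply/seteqP; split => v /=; [move=> h i _; exact: h|move=> h i; exact: h].
Qed.

(** The sigma-algebra is generated by the coordinates, not by the open sets. An open set is the
    union of the boxes with rational centre and radius that it contains, and these are countably
    many. *)
Lemma open_measurable_rV A : open A -> measurable A.
Proof.
move=> oA.
pose box (p : 'rV[rat]_n * rat) := [set v : 'rV[R]_n |
  forall i, ball (ratr (p.1 ord0 i) : R) (ratr p.2 : R) (v ord0 i)].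
have mbox p : measurable (box p).
  apply: (@measurable_rV_box
    (fun i => ball (ratr (p.1 ord0 i) : R) (ratr p.2 : R))) => i.
  exact: measurable_ball.
rewrite (_ : A = \bigcup_(p in [set p | box p `<=` A]) box p).
  rewrite bigcup_mkcond; apply: countable_bigcupT_measurable; first exact: countableP.
  move=> p.
  by case: ifP.
apply/seteqP; split => [x Ax|x [p /= pA px]]; last exact: pA.
have /nbhs_ballP[e /= e0 eA] : nbhs x A by apply: open_nbhs_nbhs.
have [q] := rat_in_itvoo (divr_gt0 e0 (ltr0n R 2)).
rewrite in_itv/= => /andP[q0 q1].
have /choice[c hc] (i : 'I_n) : exists c : rat, `|x ord0 i - ratr c| < ratr q.
  have [c] := @rat_in_itvoo R (x ord0 i - ratr q) (x ord0 i + ratr q) ltac:(lra).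
  rewrite in_itv/= => /andP[c0 c1]; exists c.
  by rewrite ltr_distl; apply/andP; split; lra.
exists (\row_i c i, q) => /=; last first.
  move=> i; rewrite /= mxE; rewrite /ball/= distrC; exact: hc.
move=> v /= hv; apply: eA; split => // i j; rewrite (ord1 i).
move: (hv j) (hc j); rewrite /ball/= mxE => h1 h2.
have -> : x ord0 j - v ord0 j = (x ord0 j - ratr (c j)) + (ratr (c j) - v ord0 j) by ring.
apply: (le_lt_trans (ler_normD _ _)).
rewrite (splitr e); apply: ltrD; first exact: (lt_trans h2).
exact: (lt_trans h1).
Qed.

Lemma closed_measurable_rV A : closed A -> measurable A.
Proof.
by move=> /closed_openC /open_measurable_rV /measurableC; rewrite setCK.
Qed.

Lemma compact_measurable_rV A : compact A -> measurable A.
Proof.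
move=> cA; apply: closed_measurable_rV.
exact: (compact_closed (@norm_hausdorff R 'rV[R]_n) cA).
Qed.

Lemma continuous_measurable_rV (f : 'rV[R]_n -> R) : continuous f ->
  measurable_fun setT (f : 'rV[R]_n -> measurableTypeR R).
Proof.
move=> cf; apply: (measurability _ (RGenOpens.measurableE R)).
move=> _ [_ [a [b ->] <-]]; rewrite setTI.
by apply: open_measurable_rV; apply: open_comp => //; exact: interval_open.
Qed.

End open_measurable_rV.

(** * Change of variables in integrals, finiteness of boxes *)

Section leb_integrals.
Variables (R : realType) (n : nat).
Implicit Types (a r : R) (c : 'rV[R]_n).

Lemma ge0_integral_leb_affine (f : 'rV[R]_n -> \bar R) a c : a != 0 ->
  measurable_fun setT f -> (forall x, 0 <= f x)%E ->
  (\int[leb n]_x f (a *: x + c)%R =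
   ((`|a|^-1) ^+ n)%R%:E * \int[leb n]_x f x)%E.
Proof.
move=> a0 mf f0.
have na0 : 0 <= `|a|^-1 ^+ n by rewrite exprn_ge0 // invr_ge0.
pose p : {measure set 'rV[R]_n -> \bar R} :=
  measure_function_pushforward__canonical__measure_function_Measure
    (leb n) (measurable_affrV a c).
transitivity (\int[p]_t f t)%E.
  by rewrite ge0_integral_pushforward//=; exact: measurable_affrV.
transitivity (\int[mscale (NngNum na0) (leb n)]_t f t)%E.
  by apply: eq_measure_integral => A mA _; exact: leb_affine.
by rewrite ge0_integral_mscale.
Qed.

(** Measurability of [f] is enough: if its positive or negative part has infinite integral, both
    sides are 0, the value of [fine] at infinity. *)
Lemma Rintegral_leb_affine (f : 'rV[R]_n -> R) a c : a != 0 ->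
  measurable_fun setT (f : 'rV[R]_n -> measurableTypeR R) ->
  \int[leb n]_x f (a *: x + c) = (`|a|^-1) ^+ n * \int[leb n]_x f x.
Proof.
move=> a0 mf; rewrite /Rintegral.
have mEf : measurable_fun setT (fun x => (f x)%:E) by exact/measurable_EFinP.
have na0 : 0 < `|a|^-1 ^+ n by rewrite exprn_gt0 // invr_gt0 normr_gt0.
rewrite [in LHS]integralE [in RHS]integralE.
set k := `|a|^-1 ^+ n in na0 *.
pose g x := (f x)%:E.
rewrite (eq_integral (fun x : 'rV[R]_n => g^\+%E (a *: x + c)));
  last by move=> x _; rewrite !funeposE.
rewrite [X in (_ - X)%E](eq_integral (fun x : 'rV[R]_n => g^\-%E (a *: x + c)));
  last by move=> x _; rewrite !funenegE.
rewrite !ge0_integral_leb_affine//; [|exact: measurable_funeneg|exact: measurable_funepos].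
rewrite -/k -/g.
have : (0 <= \int[leb n]_x g^\+%E x)%E by exact: integral_ge0.
have : (0 <= \int[leb n]_x g^\-%E x)%E by exact: integral_ge0.
case: (\int[leb n]_x g^\-%E x)%E => [s| |//] _.
  case: (\int[leb n]_x g^\+%E x)%E => [t| |//] _ /=; first by rewrite mulrBr.
  by rewrite gt0_muley ?lte_fin//= mulr0.
case: (\int[leb n]_x g^\+%E x)%E => [t| |//] _ /=; rewrite gt0_muley ?lte_fin//= mulr0//.
Qed.

Lemma leb_setT_gt0 : (0 < leb n [set: 'rV[R]_n])%E.
Proof.
elim: n => [|m IH]; first by rewrite /= diracT lte01.
rewrite lebS.
rewrite (eq_integral (fun=> leb m [set: 'rV[R]_m])); last first.
  by move=> t _; congr (leb m _); apply/seteqP; split.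
rewrite integral_cst//= mule_gt0//.
have := @lebesgue_measure_itv R `[0, 1]; rewrite /= lte_fin ltr01 oppr0 adde0 => E.
apply: (@lt_le_trans _ _ (lebesgue_measure `[(0:R), 1]%classic)).
  by rewrite E lte_fin ltr01.
by apply: le_measure => //; rewrite inE.
Qed.

Lemma leb_box_lty r : (leb n [set x : 'rV[R]_n | forall i, - r <= x ord0 i <= r]%R < +oo)%E.
Proof.
elim: n => [|m IH].
  apply: (@le_lt_trans _ _ (leb 0 [set: 'rV[R]_0])); last by rewrite /= diracT ltry.
  apply: le_measure; rewrite ?inE//.
  rewrite (_ : [set x | _] = setT)//; apply/seteqP; split => // x _ [].
  by case.
rewrite lebS.
set B := [set x : 'rV[R]_m | forall i, - r <= x ord0 i <= r] in IH.
rewrite [X in (X < _)%E](_ : _ =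
    \int[lebesgue_measure]_(t in `[(- r)%R, r]%classic) leb m B)%E.
  rewrite integral_cst; last exact: measurable_itv.
  rewrite lte_mul_pinfty// ?ge0_fin_numE//.
  have E := @lebesgue_measure_itv R `[-r, r].
  by apply: (@eq_ind_r _ _ (fun z => (z < +oo)%E) _ _ E) => /=; case: ifP => _; rewrite ?ltry.
rewrite [RHS]integral_mkcond; apply: eq_integral => t _.
rewrite patchE; case: ifPn => [|tr].
  rewrite inE/= in_itv/= => tr; congr (leb m _).
  apply/seteqP; split => v /= hv i.
    have := hv (rshift 1 i).
    by rewrite /cons_rV (@row_mxEr _ 1 1 m).
  rewrite /cons_rV; case: (@split_ordP 1 m i) => j ->.
    by rewrite (@row_mxEl _ 1 1 m) !ord1 mxE eqxx.
  by rewrite (@row_mxEr _ 1 1 m).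
rewrite (_ : [set v | _] = set0) ?measure0//; apply/seteqP; split => // v /= hv.
have := hv ord0; rewrite /cons_rV (_ : ord0 = lshift m (ord0 : 'I_1)); last exact/val_inj.
rewrite (@row_mxEl _ 1 1 m) mxE eqxx => tr'; move: tr; rewrite notin_setE/=; apply.
by rewrite in_itv.
Qed.

End leb_integrals.

(** * Smooth functions with compact support *)

Section smooth_step.
Variable R : realType.
Implicit Types (t : R) (k : nat).

(** The flat function [exp(-1/t)], extended by 0, times powers of [1/t]. The derivative of a member
    is a linear combination of members, so a single derivative computation yields smoothness. *)
Definition gexp k t : R := if 0 < t then t^-1 ^+ k * expR (- t^-1) else 0.

Lemma gexp_le0 k t : t <= 0 -> gexp k t = 0.
Proof. by rewrite /gexp leNgt => /negPf ->. Qed.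

Lemma gexp_gt0 k t : 0 < t -> 0 < gexp k t.
Proof. by move=> t0; rewrite /gexp t0 mulr_gt0 ?expR_gt0 ?exprn_gt0 ?invr_gt0. Qed.

Lemma gexp_ge0 k t : 0 <= gexp k t.
Proof. by have [/gexp_le0->|/(gexp_gt0 k)/ltW] := leP t 0. Qed.

Lemma expR_ge_pow k t : 0 <= t -> (t / k.+1%:R) ^+ k.+1 <= expR t.
Proof.
move=> t0; have -> : expR t = expR (t / k.+1%:R) ^+ k.+1.
  by rewrite -expRM_natr divfK// pnatr_eq0.
apply: lerXn2r; rewrite ?nnegrE ?expR_ge0 ?divr_ge0//.
by apply: le_trans (expR_ge1Dx _); rewrite lerDr.
Qed.

(** Flatness at 0 in the form used for the derivative there. The lower bound of the exponential by a
    power of degree [k + 2], taken at [1/t], beats [t^-k] with two powers of [t] to spare. *)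
Lemma gexp_le_sqr k t : `|gexp k t| <= k.+2%:R ^+ k.+2 * t ^+ 2.
Proof.
rewrite ger0_norm ?gexp_ge0//.
have [t0|t0] := leP t 0.
  by rewrite gexp_le0// mulr_ge0 ?sqr_ge0 ?exprn_ge0.
rewrite /gexp t0 expRN.
have := @expR_ge_pow k.+1 t^-1; rewrite invr_ge0 (ltW t0) => /(_ isT) h.
have h2 : (expR t^-1)^-1 <= (t * k.+2%:R) ^+ k.+2.
  rewrite -[leRHS]invrK lef_pV2 ?posrE ?expR_gt0 ?invr_gt0 ?exprn_gt0 ?mulr_gt0//.
  by rewrite -exprVn invfM.
apply: (@le_trans _ _ (t^-1 ^+ k * (t * k.+2%:R) ^+ k.+2)).
  by rewrite ler_wpM2l// exprn_ge0 // invr_ge0 ltW.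
have tE : t ^+ k.+2 = t ^+ k * t ^+ 2 by rewrite -exprD addn2.
rewrite exprMn tE; move: (_ ^+ k.+2) (t ^+ 2) => c s.
by rewrite !mulrA -exprMn mulVf ?gt_eqF// expr1n mul1r mulrC.
Qed.

Lemma is_derive_gexp k t :
  is_derive t 1 (gexp k) (- (k%:R * gexp k.+1 t) + gexp k.+2 t).
Proof.
have [t0|t0|t0] := ltgtP t 0.
- rewrite !gexp_le0 ?ltW// mulr0 oppr0 addr0.
  apply: (@near_eq_is_derive _ _ _ (cst 0)).
  near=> z; rewrite gexp_le0//; apply/ltW.
  by near: z; exact: lt_nbhsl.
- have tN0 : t != 0 by rewrite gt_eqF.
  apply: (@near_eq_is_derive _ _ _ (fun t => t^-1 ^+ k * expR (- t^-1))).
    near=> z; rewrite /gexp ifT//.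
    by near: z; exact: lt_nbhsr.
  have dV : is_derive t 1 (fun t : R => t^-1) (- t ^- 2).
    apply: is_derive_eq (is_deriveV (f := id) tN0 (is_derive_id t 1)) _.
    by rewrite /GRing.scale/= mulr1.
  have dX := @is_deriveX _ _ _ k t 1 _ dV.
  have dN := is_deriveN dV.
  have dE := is_derive1_comp (f := expR) (g := fun t => - t^-1)
    (is_derive_expR (- t^-1)) dN.
  have fE : (fun t : R => t^-1 ^+ k * expR (- t^-1)) =
      (fun t => t^-1) ^+ k * (expR \o (fun t => - t^-1)).
    by apply/funext => z; rewrite /= exprfctE.
  rewrite fE; apply: is_derive_eq (is_deriveM dX dE) _.
  rewrite /gexp t0 /GRing.scale /= exprfctE.
  case: k {fE} dX => [|k] _ /=; [by field|].
  by rewrite -!exprVn !exprS; ring.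
- rewrite t0 !gexp_le0// mulr0 oppr0 addr0.
  (* By the quadratic bound, the difference quotient at 0 is at most a constant times [|h|]. *)
  suff H : h^-1 *: (gexp k (h *: (1 : R) + 0) - gexp k 0) @[h --> 0^'] --> (0 : R).
    by constructor; [apply/cvg_ex; exists 0; exact: H|apply: cvg_lim].
  apply/cvgr0Pnorm_lt => e e0.
  set C := (k.+2%:R : R) ^+ k.+2.
  have C0 : 0 < C by rewrite exprn_gt0.
  near=> h.
  have hN0 : h != 0 by near: h; exists 1 => //=.
  have hn0 : 0 < `|h| by rewrite normr_gt0.
  rewrite (gexp_le0 k (lexx 0)) subr0 addr0 /GRing.scale /= mulr1 normrM normfV.
  rewrite mulrC ltr_pdivrMr//.
  apply: (le_lt_trans (gexp_le_sqr k h)); rewrite -/C.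
  rewrite -real_normK ?num_real// expr2 mulrA ltr_pM2r//.
  rewrite -ltr_pdivlMl//.
  near: h; apply: dnbhs0_lt; rewrite mulr_gt0 ?invr_gt0//.
Unshelve. all: by end_near.
Qed.

Lemma derivable_gexp k t : derivable (gexp k) t 1.
Proof. by have [] := is_derive_gexp k t. Qed.

Lemma derive_gexp k t :
  'D_1 (gexp k) t = - (k%:R * gexp k.+1 t) + gexp k.+2 t.
Proof. by have [] := is_derive_gexp k t. Qed.

End smooth_step.

Section smooth_class.
Variables (R : realType) (n : nat).
Implicit Types (f g : 'rV[R]_n -> R) (i : 'I_n) (x v : 'rV[R]_n).

(* A class stable under partial derivatives, so that differentiability of its
   members already gives smoothness. *)
Inductive elementary : ('rV[R]_n -> R) -> Prop :=
| elementary_cst c : elementary (fun=> c)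
| elementary_coord i : elementary (fun x => x ord0 i)
| elementaryD f g : elementary f -> elementary g -> elementary (fun x => f x + g x)
| elementaryM f g : elementary f -> elementary g -> elementary (fun x => f x * g x)
| elementary_gexp k f : elementary f -> elementary (fun x => gexp k (f x)).

Lemma differentiable_comp_real (h : R -> R) f x :
  differentiable f x -> derivable h (f x) 1 -> differentiable (fun x => h (f x)) x.
Proof. by move=> df /derivable1_diffP dh; exact: (differentiable_comp df dh). Qed.

Lemma derive_comp_real (h : R -> R) f x v :
  differentiable f x -> derivable h (f x) 1 ->
  'D_v (fun x => h (f x)) x = 'D_1 h (f x) * 'D_v f x.
Proof.
move=> df /derivable1_diffP dh.
have dhf : differentiable (h \o f) x by exact: differentiable_comp.
rewrite -[LHS]/('D_v (h \o f) x) (deriveE v dhf) diff_comp//= (deriveE v df).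
rewrite (@deriveE _ _ _ h (f x) 1 dh).
by rewrite -[X in 'd h (f x) X = _]mulr1 -/(_ *: _) linearZ mulrC.
Qed.

Lemma differentiable_rV_coord i x : differentiable (fun x : 'rV[R]_n => x ord0 i) x.
Proof. exact: differentiable_coord. Qed.

Lemma derive_rV_coord i x v : 'D_v (fun x : 'rV[R]_n => x ord0 i) x = v ord0 i.
Proof.
apply: cvg_lim => //; apply: cvg_trans (cvg_cst (v ord0 i)).
apply: near_eq_cvg; near=> h.
have h0 : h != 0 by near: h; exists 1 => //=.
by rewrite /= !mxE addrK /GRing.scale/= mulKf.
Unshelve. all: by end_near || exact: dnbhs_filter.
Qed.

Lemma partial_coord i j : partial i (fun x : 'rV[R]_n => x ord0 j) = fun=> (i == j)%:R.
Proof.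
by apply/funext => x; rewrite /partial derive_rV_coord mxE eqxx eq_sym.
Qed.

Lemma partial_cst i (c : R) : partial i (fun=> c) = fun=> 0.
Proof. by apply/funext => x; rewrite /partial derive_cst. Qed.

Lemma partialD i f g : (forall x, differentiable f x) -> (forall x, differentiable g x) ->
  partial i (fun x => f x + g x) = fun x => partial i f x + partial i g x.
Proof.
move=> df dg; apply/funext => x; rewrite /partial.
by rewrite (@deriveD _ _ _ f g)//; exact: diff_derivable.
Qed.

Lemma partialM i f g : (forall x, differentiable f x) -> (forall x, differentiable g x) ->
  partial i (fun x => f x * g x) =
  fun x => f x * partial i g x + partial i f x * g x.
Proof.
move=> df dg; apply/funext => x; rewrite /partial.
rewrite (@deriveM _ _ f g); [|exact: diff_derivable|exact: diff_derivable].
by congr (_ + _); rewrite mulrC.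
Qed.

Lemma partial_gexp i k f : (forall x, differentiable f x) ->
  partial i (fun x => gexp k (f x)) =
  fun x => ((- k%:R) * gexp k.+1 (f x) + gexp k.+2 (f x)) * partial i f x.
Proof.
move=> df; apply/funext => x; rewrite /partial.
by rewrite derive_comp_real// ?derive_gexp ?mulNr//; exact: derivable_gexp.
Qed.

Lemma elementary_differentiable f : elementary f -> forall x, differentiable f x.
Proof.
elim=> [c|i|{}f g _ IHf _ IHg|{}f g _ IHf _ IHg|k {}f _ IHf] x.
- exact: differentiable_cst.
- exact: differentiable_rV_coord.
- exact: (differentiableD (IHf x) (IHg x)).
- exact: (differentiableM (IHf x) (IHg x)).
- apply: differentiable_comp_real => //; exact: derivable_gexp.
Qed.

Lemma elementary_partial i f : elementary f -> elementary (partial i f).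
Proof.
elim=> [c|j|{}f g ef IHf eg IHg|{}f g ef IHf eg IHg|k {}f ef IHf].
- by rewrite partial_cst; exact: elementary_cst.
- by rewrite partial_coord; exact: elementary_cst.
- by rewrite partialD; [exact: elementaryD|exact: elementary_differentiable..].
- rewrite partialM; [|exact: elementary_differentiable..].
  by apply: elementaryD; exact: elementaryM.
- rewrite partial_gexp; last exact: elementary_differentiable.
  apply: elementaryM => //; apply: elementaryD; last exact: elementary_gexp.
  by apply: elementaryM; [exact: elementary_cst|exact: elementary_gexp].
Qed.

Lemma elementary_smooth f : elementary f -> smooth f.
Proof.
move=> ef s x; apply: elementary_differentiable.
by elim: s => //= i s; exact: elementary_partial.
Qed.

End smooth_class.

(** * Integrals of compactly supported functions *)

Section compact_support.
Variables (R : realType) (n : nat).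
Implicit Types (f g : 'rV[R]_n -> R) (K : set 'rV[R]_n) (i : 'I_n) (x v : 'rV[R]_n).

Definition supported K f := forall x, ~ K x -> f x = 0.

Definition C1 f := (forall x, differentiable f x) /\ forall i, continuous (partial i f).

Lemma C1_continuous f : C1 f -> continuous f.
Proof. by move=> [df _] x; exact: differentiable_continuous. Qed.

Lemma bounded_box (A : set 'rV[R]_n) : bounded_set A -> exists r,
  A `<=` [set x : 'rV[R]_n | forall i, - r <= x ord0 i <= r].
Proof.
move=> [M [Mr hM]]; exists (`|M| + 1) => x Ax i /=; rewrite -ler_norml.
apply: (@le_trans _ _ `|x|).
  by rewrite [leRHS]mx_normrE; exact: (le_bigmax _ (fun p => `|x p.1 p.2|) (ord0, i)).
by apply: hM => //; rewrite (le_lt_trans (ler_norm M))// ltrDl.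
Qed.

Lemma leb_bounded_lty (A : set 'rV[R]_n) : measurable A -> bounded_set A -> (leb n A < +oo)%E.
Proof.
move=> mA /bounded_box[r Ar].
apply: le_lt_trans (leb_box_lty n r); apply: le_measure => //; rewrite inE//.
apply: (@measurable_rV_box _ _ (fun=> `[-r, r]%classic)) => i.
exact: measurable_itv.
Qed.

Lemma leb_compact_lty K : compact K -> (leb n K < +oo)%E.
Proof.
by move=> cK; apply: leb_bounded_lty; [exact: compact_measurable_rV|exact: compact_bounded].
Qed.

Lemma compact_continuous_bound K f : compact K -> {within K, continuous f} ->
  exists2 M, 0 <= M & forall x, K x -> `|f x| <= M.
Proof.
move=> cK cf; have /compact_bounded[M [Mr hM]] := continuous_compact cf cK.
exists (`|M| + 1); first by rewrite addr_ge0.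
move=> x Kx; apply: hM; last by exists x.
by rewrite (le_lt_trans (ler_norm M))// ltrDl.
Qed.

Lemma supported_bound K f : compact K -> continuous f -> supported K f ->
  exists2 M, 0 <= M & forall x, `|f x| <= M.
Proof.
move=> cK cf sf.
have [M M0 hM] := compact_continuous_bound cK (continuous_subspaceT cf).
exists M => // x; have [/hM//|/sf->] := pselect (K x).
by rewrite normr0.
Qed.

Lemma integrable_bounded_on K f M : measurable K -> (leb n K < +oo)%E ->
  measurable_fun K (f : _ -> measurableTypeR R) ->
  (forall x, K x -> `|f x| <= M) -> (leb n).-integrable K (EFin \o f).
Proof.
move=> mK Koo mf hM; apply: measurable_bounded_integrable => //.
exists M; split; first exact: num_real.
by move=> y My x Kx /=; apply: le_trans (ltW My); exact: hM.
Qed.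

Lemma integrable_bounded_supported K f M : measurable K -> (leb n K < +oo)%E ->
  measurable_fun setT (f : _ -> measurableTypeR R) ->
  (forall x, `|f x| <= M) -> supported K f -> (leb n).-integrable setT (EFin \o f).
Proof.
move=> mK Koo mf hM sf.
have : (leb n).-integrable K (EFin \o f).
  apply: (@integrable_bounded_on _ _ M) => //; exact: measurable_funTS.
move/(integrable_mkcond _ mK); apply: eq_integrable => // x _.
rewrite patchE; case: ifPn => // xK /=; rewrite sf//.
by move: xK; rewrite notin_setE.
Qed.

Lemma integrable_supported K f : compact K -> continuous f -> supported K f ->
  (leb n).-integrable setT (EFin \o f).
Proof.
move=> cK cf sf; have [M M0 hM] := supported_bound cK cf sf.
apply: (@integrable_bounded_supported K _ M) => //.
- exact: compact_measurable_rV.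
- exact: leb_compact_lty.
- exact: continuous_measurable_rV.
Qed.

Lemma supported_partial i K f : compact K -> supported K f ->
  supported K (partial i f).
Proof.
move=> cK sf x Kx.
rewrite /partial (@near_eq_derive _ _ _ _ (cst 0)) ?derive_cst//.
have oK : open (~` K).
  by apply: closed_openC; exact: (compact_closed (@norm_hausdorff R 'rV[R]_n) cK).
have : nbhs x (~` K) by apply: open_nbhs_nbhs.
by apply: filterS => y /= /sf ->.
Qed.

Lemma is_derive_line f x v (s : R) : differentiable f (x + s *: v) ->
  is_derive s 1 (fun s => f (x + s *: v)) ('D_v f (x + s *: v)).
Proof.
move=> /(diff_derivable (v := v)) df.
have E : (fun h : R => h^-1 *: (((fun s => f (x + s *: v)) \o shift s) (h *: (1:R)) - f (x + s *: v))) =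
   (fun h : R => h^-1 *: ((f \o shift (x + s *: v)) (h *: v) - f (x + s *: v))).
  apply/funext => h /=; congr (_ *: (f _ - _)).
  have -> : h *: (1 : R) = h by rewrite /GRing.scale/= mulr1.
  by rewrite scalerDl addrCA.
by constructor; [rewrite /derivable E|rewrite /derive E].
Qed.

(** Mean value theorem along a coordinate line; it supplies the dominating constant for the
    difference quotients in [Rintegral_partial0]. *)
Lemma partial_line_bound f i x (t M : R) : (forall x, differentiable f x) ->
  (forall x, `|partial i f x| <= M) -> 0 < t ->
  `|f (x + t *: delta_mx ord0 i) - f x| <= M * t.
Proof.
move=> df hM t0; set e := delta_mx ord0 i.
have [||s _] := @MVT R (fun s => f (x + s *: e)) (fun s => 'D_e f (x + s *: e)) 0 t t0.
- by move=> s _; exact: is_derive_line.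
- apply: continuous_subspaceT => s; apply: differentiable_continuous.
  by apply/derivable1_diffP; have [] := is_derive_line (df (x + s *: e)).
- rewrite scale0r addr0 subr0 => ->.
  by rewrite normrM (gtr0_norm t0) ler_wpM2r ?(ltW t0)//; exact: hM.
Qed.

(** Every difference quotient of [f] integrates to 0 by translation invariance, and dominated
    convergence passes to the limit. *)
Lemma Rintegral_partial0 i K f : compact K -> C1 f -> supported K f ->
  \int[leb n]_x partial i f x = 0.
Proof.
move=> cK [df cf] sf; set e : 'rV[R]_n := delta_mx ord0 i.
have cff : continuous f by exact: C1_continuous.
have mf := continuous_measurable_rV cff.
have [M M0 hM] := supported_bound cK (cf i) (supported_partial i cK sf).
have [r Kr] := bounded_box (compact_bounded cK).
(* The margin 1 lets one box contain the supports of all translates, since the shifts [t k] are at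
   most 1. *)
pose B : set 'rV[R]_n := [set x | forall i, - (r + 1) <= x ord0 i <= r + 1].
have mB : measurable B.
  apply: (@measurable_rV_box _ _ (fun=> `[-(r+1), (r+1)]%classic)) => j.
  exact: measurable_itv.
pose t (k : nat) : R := k.+1%:R^-1.
have t0 k : 0 < t k by rewrite invr_gt0.
have t1 k : t k <= 1 by rewrite invf_le1// ler1n.
pose F (k : nat) x := (t k)^-1 * (f (x + t k *: e) - f x).
have mshift k : measurable_fun setT (fun x => f (x + t k *: e) : measurableTypeR R).
  apply: continuous_measurable_rV => x.
  apply: (@continuous_comp _ _ _ (fun x => x + t k *: e) f); last exact: cff.
  apply: (@continuousD R 'rV[R]_n _ id (cst (t k *: e))); [exact: cvg_id|exact: cst_continuous].
have mF k : measurable_fun setT (F k : _ -> measurableTypeR R).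
  apply: measurable_funM => //; apply: measurable_funB => //; exact: mshift.
have FM k x : `|F k x| <= M.
  rewrite normrM normfV (gtr0_norm (t0 k)) mulrC ler_pdivrMr//.
  exact: partial_line_bound.
have FB k : supported B (F k).
  move=> x nB; rewrite /F !sf ?subrr ?mulr0// => Kx.
  - apply: nB => j; have /= := Kr _ Kx j; lra.
  - apply: nB => j; have /= := Kr _ Kx j; rewrite !mxE eqxx /=.
    have := t0 k; have := t1 k; case: (j == i); rewrite ?mulr0 ?mulr1; lra.
have F0 k : (\int[leb n]_x (F k x)%:E = 0)%E.
  have iF : (leb n).-integrable setT (EFin \o f) by exact: integrable_supported sf.
  have iT : (leb n).-integrable setT (EFin \o (fun x => f (x + t k *: e))).
    have [Mf Mf0 hMf] := supported_bound cK cff sf.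
    apply: (@integrable_bounded_supported B _ Mf) => //; first exact: leb_box_lty.
    move=> x nB; rewrite sf// => Kx; apply: nB => j; have /= := Kr _ Kx j.
    rewrite !mxE eqxx /=.
    have := t0 k; have := t1 k; case: (j == i); rewrite ?mulr0 ?mulr1; lra.
  have : \int[leb n]_x F k x = 0.
    have E1 : \int[leb n]_x f (x + t k *: e) = \int[leb n]_x f x.
      have := @Rintegral_leb_affine _ _ f 1 (t k *: e) (oner_neq0 _) mf.
      rewrite normr1 invr1 expr1n mul1r => <-.
      by apply: eq_Rintegral => x _; rewrite scale1r.
    rewrite /F RintegralZl//; last by exact: (integrableB _ iT iF).
    by rewrite RintegralB// E1 subrr mulr0.
  move=> h; rewrite -[LHS]fineK; first by rewrite -[fine _]/(Rintegral _ _ _) h.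
  apply: integrable_fin_num => //.
  by apply: (@integrable_bounded_supported B _ M) => //; exact: leb_box_lty.
have tcvg x : F ^~ x @ \oo --> partial i f x.
  have dfx : derivable f x e by exact: diff_derivable.
  have tto : t k @[k --> \oo] --> (0 : R)^'.
    move=> A hA; apply: (@filterS _ \oo _ (fun k => t k != 0 -> A (t k))).
      by move=> k; apply; exact: lt0r_neq0.
    exact: (@cvg_harmonic R _ hA).
  pose G h := h^-1 *: ((f \o shift x) (h *: e) - f x).
  have dG : G h @[h --> 0^'] --> partial i f x by exact: dfx.
  apply: cvg_trans (cvg_comp t G tto dG).
  apply: near_eq_cvg; near=> k.
  by rewrite /F /G /= [t k *: e + x]addrC.
have [|||||_ _ ] := @dominated_convergence _ _ _ (leb n) setT measurableT
   (fun k x => (F k x)%:E) (fun x => (partial i f x)%:E) (fun x => (M * \1_B x)%:E).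
- by move=> k; apply/measurable_EFinP; exact: mF.
- by apply/measurable_EFinP; exact: continuous_measurable_rV.
- apply: aeW => x _; apply: cvg_EFin; [exact: nearW|exact: tcvg].
- apply: (@integrable_bounded_supported B _ `|M|).
  + by [].
  + exact: leb_box_lty.
  + by apply: measurable_funM => //; exact: measurable_indic.
  + by move=> x; rewrite normrM ler_piMr// indicE normr_nat; case: (_ \in _).
  + by move=> x nB; rewrite indicE memNset// mulr0.
- apply: aeW => x k _ /=; rewrite lee_fin indicE; have [xB|xB] := boolP (x \in B).
    by rewrite mulr1.
  by rewrite FB ?normr0 ?mulr0// => /mem_set; rewrite (negPf xB).
rewrite (_ : [sequence _]_n = cst 0); last by apply/funext => k; exact: F0.
move=> /cvg_lim /= => h; rewrite /Rintegral -h//.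
by rewrite lim_cst.
Unshelve. all: by end_near.
Qed.

End compact_support.

(** * Integration by parts against test functions *)

Section integration_by_parts.
Variables (R : realType) (n : nat).
Implicit Types (f g : 'rV[R]_n -> R) (K G : set 'rV[R]_n) (i : 'I_n) (x v : 'rV[R]_n).

Lemma continuous_add f g : continuous f -> continuous g ->
  continuous (fun x => f x + g x).
Proof. by move=> cf cg x; exact: (continuousD (cf x) (cg x)). Qed.

Lemma continuous_mul f g : continuous f -> continuous g ->
  continuous (fun x => f x * g x).
Proof. by move=> cf cg x; exact: (continuousM (cf x) (cg x)). Qed.

Lemma C1M f g : C1 f -> C1 g -> C1 (fun x => f x * g x).
Proof.
move=> c1f c1g; have [df cf] := c1f; have [dg cg] := c1g.
split=> [x|i]; first exact: (differentiableM (df x) (dg x)).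
rewrite partialM//; apply: continuous_add; apply: continuous_mul => //;
  exact: C1_continuous.
Qed.

Lemma smooth_partial i f : smooth f -> smooth (partial i f).
Proof. by move=> sf s x; have := sf (rcons s i) x; rewrite foldr_rcons. Qed.

Lemma smooth_C1 f : smooth f -> C1 f.
Proof.
move=> sf; split=> [x|i x]; first exact: (sf [::]).
exact: (differentiable_continuous (sf [:: i] x)).
Qed.

Lemma elementary_C1 f : elementary f -> C1 f.
Proof. by move=> /elementary_smooth /smooth_C1. Qed.

Lemma Cc_infty_partial G i f : Cc_infty G f -> Cc_infty G (partial i f).
Proof.
move=> [sf [K [cK KG fK]]]; split; first exact: smooth_partial.
by exists K; split => //; exact: supported_partial.
Qed.

Lemma Rintegral_supported G f : supported G f ->
  \int[leb n]_(x in G) f x = \int[leb n]_x f x.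
Proof.
move=> sf; rewrite Rintegral_mkcond; apply: eq_Rintegral => x _.
by rewrite patchE; case: ifPn => //; rewrite notin_setE => /sf.
Qed.

(** The product [f g] inherits the compact support of [g], so the product rule and
    [Rintegral_partial0] apply to it; [f] may be a polynomial. *)
Lemma Rintegral_parts K i f g : C1 f -> C1 g -> compact K -> supported K g ->
  \int[leb n]_x (f x * partial i g x) = - \int[leb n]_x (partial i f x * g x).
Proof.
move=> cf cg cK sg.
have [df cdf] := cf; have [dg cdg] := cg.
have sM : supported K (fun x => f x * g x) by move=> x /sg ->; rewrite mulr0.
have := Rintegral_partial0 i cK (C1M cf cg) sM.
rewrite partialM// RintegralD//.
- by move/eqP; rewrite addr_eq0 => /eqP.
- apply: (integrable_supported cK) => [|x /(supported_partial i cK sg) ->]; last by rewrite mulr0.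
  by apply: continuous_mul => //; exact: C1_continuous.
- apply: (integrable_supported cK) => [|x /sg ->]; last by rewrite mulr0.
  by apply: continuous_mul => //; exact: C1_continuous.
Qed.

Lemma loc_integrable_continuous G f : measurable G -> continuous f -> loc_integrable G f.
Proof.
move=> mG cf; split; first by apply: measurable_funTS; exact: continuous_measurable_rV.
move=> K cK _; have [M M0 hM] := compact_continuous_bound cK (continuous_subspaceT cf).
have mK := compact_measurable_rV cK.
have := integrable_bounded_on mK (leb_compact_lty cK)
  (measurable_funTS (continuous_measurable_rV cf)) hM.
by case/integrableP.
Qed.

Lemma Cc_infty_weak_partial G i f : open G -> Cc_infty G f ->
  is_weak_partial G i f (partial i f).
Proof.
move=> oG [sf [K [cK KG fK]]].
have [df cdf] := smooth_C1 sf.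
have mG := open_measurable_rV oG.
split.
- by apply: loc_integrable_continuous => // x; exact: (differentiable_continuous (df x)).
- exact: loc_integrable_continuous.
move=> phi [sphi [K' [cK' K'G phiK']]].
rewrite !(@Rintegral_supported G).
- by apply: (@Rintegral_parts K') => //; exact: smooth_C1.
- by move=> x nG; rewrite phiK' ?mulr0// => /K'G.
- move=> x nG; rewrite (supported_partial i cK' phiK') ?mulr0// => /K'G//.
Qed.

End integration_by_parts.

(** * The fundamental lemma of the calculus of variations *)

Section open_boxes.
Variables (R : realType) (n : nat).
Implicit Types (a b x : 'rV[R]_n) (G : set 'rV[R]_n).

Definition obox a b := [set x : 'rV[R]_n | forall i, a ord0 i < x ord0 i < b ord0 i].
Definition cbox a b := [set x : 'rV[R]_n | forall i, a ord0 i <= x ord0 i <= b ord0 i].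

Lemma compact_cbox a b : compact (cbox a b).
Proof.
have := @rV_compact R n (fun i => `[a ord0 i, b ord0 i]%classic).
rewrite (_ : [set v | _] = cbox a b); first by apply => i; exact: segment_compact.
by apply/seteqP; split => v /= h i; have := h i; rewrite ?in_itv.
Qed.

Lemma measurable_obox a b : measurable (obox a b).
Proof.
apply: (@measurable_rV_box _ _ (fun i => `]a ord0 i, b ord0 i[%classic)) => i.
exact: measurable_itv.
Qed.

(** Test functions with values in [0, 1] that tend pointwise to the indicator of the open box as [k]
    grows: a factor is [exp(-1 / ((k + 1) s))], where [s] is the distance to a face. *)
Definition box_bump a b (k : nat) x : R :=
  \prod_i (gexp 0 (k.+1%:R * (x ord0 i - a ord0 i)) *
           gexp 0 (k.+1%:R * (b ord0 i - x ord0 i))).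

Lemma elementary_prod (I : Type) (r : seq I) (F : I -> 'rV[R]_n -> R) :
  (forall i, elementary (F i)) -> elementary (fun x => \prod_(i <- r) F i x).
Proof.
move=> eF; elim: r => [|i r IH].
  rewrite (_ : (fun x => _) = fun=> 1); first exact: elementary_cst.
  by apply/funext => x; rewrite big_nil.
rewrite (_ : (fun x => _) = fun x => F i x * \prod_(i <- r) F i x).
  exact: elementaryM.
by apply/funext => x; rewrite big_cons.
Qed.

Lemma elementary_box_bump a b k : elementary (box_bump a b k).
Proof.
apply: elementary_prod => i.
apply: elementaryM; apply: elementary_gexp; apply: elementaryM; try exact: elementary_cst.
- by apply: elementaryD; [exact: elementary_coord|exact: elementary_cst].
- apply: elementaryD; first exact: elementary_cst.
  rewrite (_ : (fun x => _) = fun x => -1 * x ord0 i).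
    by apply: elementaryM; [exact: elementary_cst|exact: elementary_coord].
  by apply/funext => x; rewrite mulN1r.
Qed.

Lemma box_bump_out a b k x : ~ obox a b x -> box_bump a b k x = 0.
Proof.
move=> /existsNP[i /negP]; rewrite negb_and -!leNgt => h.
apply/eqP; rewrite prodf_seq_eq0; apply/hasP; exists i; first exact: mem_index_enum.
have k0 : 0 < k.+1%:R :> R by [].
case/orP: h => h; rewrite mulf_eq0; apply/orP; [left|right];
  by rewrite gexp_le0// pmulr_rle0// subr_le0.
Qed.

Lemma gexp0_le1 (t : R) : gexp 0 t <= 1.
Proof.
have [t0|t0] := leP t 0; first by rewrite gexp_le0.
by rewrite /gexp t0 mul1r -expR0 ler_expR oppr_le0 invr_ge0 ltW.
Qed.

Lemma box_bump_bound a b k x : 0 <= box_bump a b k x <= 1.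
Proof.
rewrite prodr_ge0 ?prodr_ile1// => i _; last by rewrite mulr_ge0 ?gexp_ge0.
by rewrite mulr_ge0 ?gexp_ge0// mulr_ile1 ?gexp_ge0 ?gexp0_le1.
Qed.

Lemma cvg_gexp0 (t : R) : 0 < t -> gexp 0 (k.+1%:R * t) @[k --> \oo] --> (1 : R).
Proof.
move=> t0; rewrite (_ : (fun k => _) = fun k => expR (- (k.+1%:R^-1 * t^-1))).
  have c0 : (fun k => - (k.+1%:R^-1 * t^-1) : R) @ \oo --> - (0 * t^-1).
    by apply: cvgN; apply: (@cvgM _ _ _ _ (fun k => k.+1%:R^-1) (fun=> t^-1));
      [exact: cvg_harmonic|exact: cvg_cst].
  have := cvg_comp _ expR c0 (@continuous_expR R _).
  by rewrite mul0r oppr0 expR0.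
by apply/funext => k; rewrite /gexp mulr_gt0//= mul1r invfM.
Qed.

Lemma cvg_prod (I : Type) (r : seq I) (F : I -> nat -> R) (l : I -> R) :
  (forall i, F i k @[k --> \oo] --> l i) ->
  \prod_(i <- r) F i k @[k --> \oo] --> \prod_(i <- r) l i.
Proof.
move=> cF; elim: r => [|i r IH].
  rewrite big_nil (_ : (fun k => _) = fun=> 1); first exact: cvg_cst.
  by apply/funext => x; rewrite big_nil.
rewrite big_cons (_ : (fun k => _) = fun k => F i k * \prod_(i <- r) F i k).
  by apply: cvgM; [exact: cF|exact: IH].
by apply/funext => x; rewrite big_cons.
Qed.

Lemma cvg_box_bump a b x :
  box_bump a b k x @[k --> \oo] --> (\1_(obox a b) x : R).
Proof.
rewrite indicE; have [xab|xab] := boolP (x \in obox a b); last first.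
  rewrite (_ : (fun k => _) = fun=> 0); first exact: cvg_cst.
  apply/funext => k; apply: box_bump_out => /mem_set; exact/negP.
rewrite inE in xab.
rewrite -[X in _ --> X](_ : \prod_(i < n) (1 * 1) = _ :> R); last first.
  by rewrite big1// => i _; rewrite mulr1.
apply: cvg_prod => i; have /andP[h1 h2] := xab i.
by apply: cvgM; apply: cvg_gexp0; rewrite subr_gt0.
Qed.

Lemma Cc_infty_box_bump G a b k : cbox a b `<=` G -> Cc_infty G (box_bump a b k).
Proof.
move=> abG; split; first exact/elementary_smooth/elementary_box_bump.
exists (cbox a b); split => //; first exact: compact_cbox.
move=> x nx; apply: box_bump_out => xo; apply: nx => i.
by have /andP[/ltW -> /ltW ->] := xo i.
Qed.

End open_boxes.

Section fundamental_lemma.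
Variables (R : realType) (n : nat).
Implicit Types (a b x : 'rV[R]_n) (G : set 'rV[R]_n) (h : 'rV[R]_n -> R).

Definition itvs : set (set R) := [set A | A = setT \/ exists s t : R, A = `]s, t[%classic].

Definition cylinders : set (set 'rV[R]_n) :=
  [set A | exists2 I : 'I_n -> set R, (forall i, itvs (I i)) &
     A = [set v : 'rV[R]_n | forall i, I i (v ord0 i)]].

Lemma itvs_measurable (A : set R) : itvs A -> measurable (A : set (measurableTypeR R)).
Proof.
case=> [->|[s [t ->]]]; first exact: measurableT.
exact: measurable_itv.
Qed.

Lemma measurable_rV_cylinders : @measurable _ 'rV[R]_n = <<s cylinders >>.
Proof.
apply/seteqP; split; last first.
  apply: smallest_sub; first exact: sigma_algebra_measurable.
  move=> _ [I hI ->]; apply: measurable_rV_box => i; exact: itvs_measurable.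
apply: smallest_sub; first exact: smallest_sigma_algebra.
rewrite -bigcup_seq => _ [i _] [B mB <-].
have mc : measurable_fun (setT : set (g_sigma_algebraType cylinders))
    (fun x : 'rV[R]_n => x ord0 i : measurableTypeR R).
  apply: (measurability _ (RGenOpens.measurableE R)).
  move=> _ [_ [s [t ->]] <-]; rewrite setTI; apply: sub_sigma_algebra.
  exists (fun j => if j == i then `]s, t[%classic else setT).
    by move=> j; case: ifP => _; [right; exists s, t|left].
  apply/seteqP; split => v /=; last by move=> /(_ i); rewrite eqxx.
  by move=> h j; case: eqP => // ->.
exact: (mc measurableT B mB).
Qed.

Lemma setI_closed_cylinders : setI_closed cylinders.
Proof.
move=> _ _ [I hI ->] [J hJ ->]; exists (fun i => I i `&` J i); last first.
  apply/seteqP; split => v /=.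
    by move=> [hv1 hv2] i; split; [exact: hv1|exact: hv2].
  by move=> hv; split => i; have [] := hv i.
move=> i; case: (hI i) => [->|[s [t ->]]]; first by rewrite setTI.
case: (hJ i) => [->|[s' [t' ->]]]; first by rewrite setIT; right; exists s, t.
right; exists (Num.max s s'), (Num.min t t').
apply/seteqP; split => v /=; rewrite !in_itv/= gt_max lt_min.
  by move=> [/andP[-> ->] /andP[-> ->]].
by move=> /andP[/andP[-> ->] /andP[-> ->]].
Qed.

(** Keeps the generators of the Dynkin argument within the boxes that [Rintegral_obox0] can
    treat. *)
Lemma cylinder_obox a b (A : set 'rV[R]_n) : cylinders A ->
  exists a' b', A `&` obox a b = obox a' b' /\ cbox a' b' `<=` cbox a b.
Proof.
move=> [I hI ->].
have H i : exists p : R * R, I i `&` `]a ord0 i, b ord0 i[%classic = `]p.1, p.2[%classic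
   /\ a ord0 i <= p.1 /\ p.2 <= b ord0 i.
  case: (hI i) => [->|[s [t ->]]].
    by exists (a ord0 i, b ord0 i); rewrite setTI.
  exists (Num.max s (a ord0 i), Num.min t (b ord0 i)); split; last first.
    by rewrite /= le_max ge_min !lexx !orbT.
  apply/seteqP; split => v /=; rewrite !in_itv/= gt_max lt_min.
    by move=> [/andP[-> ->] /andP[-> ->]].
  by move=> /andP[/andP[-> ->] /andP[-> ->]].
have {H}[p hp] := choice H.
exists (\row_i (p i).1), (\row_i (p i).2); split.
  apply/seteqP; split => v /=.
    move=> [hv1 hv2] i; rewrite !mxE.
    have [E _] := hp i.
    have : `](p i).1, (p i).2[%classic (v ord0 i).
      by rewrite -E; split; [exact: hv1|rewrite /= in_itv/=; exact: hv2].
    by rewrite /= in_itv.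
  move=> hv; have H i : (I i `&` `]a ord0 i, b ord0 i[%classic) (v ord0 i).
    by rewrite (hp i).1 /= in_itv/=; have := hv i; rewrite !mxE.
  by split => i; have [h1 h2] := H i => //; move: h2; rewrite /= in_itv.
move=> v hv i; have := hv i; rewrite !mxE; have [_ [h1 h2]] := hp i.
by move=> /andP[h3 h4]; rewrite (le_trans h1 h3) (le_trans h4 h2).
Qed.

Lemma loc_integrable_compact G K h : loc_integrable G h -> compact K -> K `<=` G ->
  measurable G -> (leb n).-integrable K (EFin \o h).
Proof.
move=> [mh ih] cK KG mG; apply/integrableP; split; last exact: ih.
by apply/measurable_EFinP; apply: measurable_funS mh.
Qed.

(** The functions [box_bump a b k] are admissible tests and converge to the indicator of the box;
    [|h|] dominates the products. *)
Lemma Rintegral_obox0 G h a b : open G -> loc_integrable G h ->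
  (forall phi, Cc_infty G phi -> \int[leb n]_(x in G) (h x * phi x) = 0) ->
  cbox a b `<=` G -> (\int[leb n]_(x in obox a b) (h x)%:E = 0)%E.
Proof.
move=> oG lh hphi abG.
have mG := open_measurable_rV oG.
have [mh _] := lh.
have mC : measurable (cbox a b) by apply: compact_measurable_rV; exact: compact_cbox.
have oc : obox a b `<=` cbox a b by move=> x hx i; have /andP[/ltW-> /ltW->] := hx i.
have iC : (leb n).-integrable (cbox a b) (EFin \o h).
  by apply: (loc_integrable_compact lh) => //; exact: compact_cbox.
have mhC : measurable_fun (cbox a b) (h : _ -> measurableTypeR R).
  exact: measurable_funS mh.
have E0 k : (\int[leb n]_(x in cbox a b) (h x * box_bump a b k x)%:E = 0)%E.
  have mb : measurable_fun (cbox a b) (box_bump a b k : _ -> measurableTypeR R).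
    apply: measurable_funTS; apply: continuous_measurable_rV.
    by apply: C1_continuous; apply: elementary_C1; exact: elementary_box_bump.
  have ik : (leb n).-integrable (cbox a b) (fun x => (h x * box_bump a b k x)%:E).
    apply: (le_integrable mC _ _ iC).
      by apply/measurable_EFinP; exact: measurable_funM.
    move=> x _; rewrite lee_fin normrM ler_piMr//.
    by have /andP[b0 b1] := box_bump_bound a b k x; rewrite ger0_norm.
  have := hphi _ (Cc_infty_box_bump k abG).
  rewrite Rintegral_supported; last first.
    move=> x nG; rewrite box_bump_out ?mulr0// => /oc /abG //.
  rewrite -(@Rintegral_supported _ _ (cbox a b)); last first.
    by move=> x nC; rewrite box_bump_out ?mulr0// => /oc.
  rewrite /Rintegral => h0; rewrite -[LHS]fineK ?h0//.
  exact: integrable_fin_num.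
have [|||||_ _] := @dominated_convergence _ _ _ (leb n) (cbox a b) mC
  (fun k x => (h x * box_bump a b k x)%:E) (fun x => (h x * \1_(obox a b) x)%:E)
  (fun x => `|h x|%:E).
- move=> k; apply/measurable_EFinP; apply: measurable_funM => //.
  apply: measurable_funTS; apply: continuous_measurable_rV.
  by apply: C1_continuous; apply: elementary_C1; exact: elementary_box_bump.
- apply/measurable_EFinP; apply: measurable_funM => //.
  by apply: measurable_funTS; apply: measurable_indic; exact: measurable_obox.
- apply: aeW => x _; apply: cvg_EFin; first exact: nearW.
  by apply: cvgM; [exact: cvg_cst|exact: cvg_box_bump].
- exact: integrable_norm.
- apply: aeW => x k _; rewrite lee_fin normrM ler_piMr//.
  by have /andP[b0 b1] := box_bump_bound a b k x; rewrite ger0_norm.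
rewrite (_ : [sequence _]_k = cst 0%E); last by apply/funext => k; exact: E0.
move=> /cvg_lim => /(_ (@ereal_hausdorff R)); rewrite lim_cst// => E1.
transitivity (\int[leb n]_(x in cbox a b) (h x * \1_(obox a b) x)%:E)%E; last by rewrite -E1.
rewrite [RHS]integral_mkcond [LHS]integral_mkcond; apply: eq_integral => x _.
rewrite !patchE indicE; case: ifPn => xo.
  by rewrite mem_set ?xo ?mulr1//; apply: oc; exact: set_mem.
by rewrite mulr0; case: ifP.
Qed.

(** The integrals of [h] vanish over sub-boxes, which form a generating family stable under
    intersection. Dynkin's theorem extends this to all measurable subsets of the box. *)
Lemma ae_eq0_obox G h a b : open G -> loc_integrable G h ->
  (forall phi, Cc_infty G phi -> \int[leb n]_(x in G) (h x * phi x) = 0) ->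
  cbox a b `<=` G -> {ae leb n, forall x, obox a b x -> h x = 0}.
Proof.
move=> oG lh hphi abG.
have mG := open_measurable_rV oG.
have oc : obox a b `<=` cbox a b by move=> x hx i; have /andP[/ltW-> /ltW->] := hx i.
have mB := measurable_obox a b.
have mC : measurable (cbox a b) by apply: compact_measurable_rV; exact: compact_cbox.
have iB : (leb n).-integrable (obox a b) (EFin \o h).
  apply: (integrableS mC) => //.
  by apply: (loc_integrable_compact lh) => //; exact: compact_cbox.
have H0 E : measurable E -> (\int[leb n]_(x in E `&` obox a b) (h x)%:E = 0)%E.
  rewrite measurable_rV_cylinders => mE.
  have iE S : measurable S -> (leb n).-integrable (S `&` obox a b) (EFin \o h).
    by move=> mS; apply: (integrableS mB) => //; exact: measurableI.
  apply: (dynkin_induction measurable_rV_cylinders setI_closed_cylinders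
    (P := fun E => (\int[leb n]_(x in E `&` obox a b) (h x)%:E = 0)%E)) => //.
  - by rewrite setTI; exact: (Rintegral_obox0 oG lh hphi abG).
  - move=> A cA /=; have [a' [b' [-> ab']]] := cylinder_obox a b cA.
    by apply: (@Rintegral_obox0 G) => //; exact: subset_trans ab' abG.
  - move=> S mS S0.
    have : (\int[leb n]_(x in (S `&` obox a b) `|` (~` S `&` obox a b)) (h x)%:E = 0)%E.
      by rewrite -setIUl setUv setTI; exact: (Rintegral_obox0 oG lh hphi abG).
    rewrite integral_setU_EFin//.
    + by rewrite S0 add0e.
    + exact: measurableI.
    + by apply: measurableI => //; exact: measurableC.
    + rewrite -setIUl setUv setTI; apply/measurable_EFinP; exact: measurable_int iB.
    + apply/disj_setPS => x [[Sx _] [nSx _]]; exact: (nSx Sx).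
  - move=> F mF tF F0; rewrite setI_bigcupl integral_bigcup//.
    + by apply: eseries0 => i _ _; exact: F0.
    + by apply: trivIset_setIr.
    + by move=> i; exact: measurableI.
    + by rewrite -setI_bigcupl; apply: iE; exact: bigcup_measurable.
have := @integral_ae_eq _ _ _ (leb n) (obox a b) mB (cst 0%E) (EFin \o h) iB
  (measurable_cst _).
move=> ae; have {ae} : ae_eq (leb n) (obox a b) (EFin \o h) (cst 0%E).
  apply: ae => E Eo mE; rewrite integral0 -(H0 E mE).
  by congr integral; apply/esym/setIidPl.
apply: filterS => x /= hx /hx [] //.
Qed.

(** The open set is covered by countably many rational boxes whose closures it contains, and [h]
    vanishes almost everywhere on each of them. *)
Lemma ae_eq0_test G h : open G -> loc_integrable G h ->
  (forall phi, Cc_infty G phi -> \int[leb n]_(x in G) (h x * phi x) = 0) ->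
  {ae leb n, forall x, G x -> h x = 0}.
Proof.
move=> oG lh hphi.
pose A (p : 'rV[rat]_n * 'rV[rat]_n) : 'rV[R]_n := map_mx ratr p.1.
pose B (p : 'rV[rat]_n * 'rV[rat]_n) : 'rV[R]_n := map_mx ratr p.2.
pose N (p : 'rV[rat]_n * 'rV[rat]_n) := [set x | cbox (A p) (B p) `<=` G /\ obox (A p) (B p) x /\ h x != 0].
have negN p : (leb n).-negligible (N p).
  have [pG|pG] := pselect (cbox (A p) (B p) `<=` G).
    apply: negligibleS (ae_eq0_obox oG lh hphi pG) => x [_ [hx h0]] /= H.
    by move: h0; rewrite H// eqxx.
  rewrite (_ : N p = set0); first exact: negligible_set0.
  by apply/seteqP; split => // x [].
have : (leb n).-negligible (\bigcup_p N p).
  (* Pairs of rational vectors are enumerated by the natural numbers, as countable unions of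
     negligible sets are indexed by them. *)
  pose f k := if @choice.unpickle ('rV[rat]_n * 'rV[rat]_n)%type k is Some p then N p else set0.
  apply: (@negligibleS _ _ _ _ (\bigcup_k f k)).
    by move=> x [p _ Nx]; exists (choice.pickle p) => //; rewrite /f choice.pickleK.
  apply: negligible_bigcup => k; rewrite /f; case: choice.unpickle => //.
  exact: negligible_set0.
apply: negligibleS => x /= /not_implyP[Gx /eqP hx].
have /nbhs_ballP[e /= e0 eG] : nbhs x G by apply: open_nbhs_nbhs.
have /choice[p hp] (i : 'I_n) : exists p : rat * rat,
    [/\ x ord0 i - e < ratr p.1, ratr p.1 < x ord0 i, x ord0 i < ratr p.2 & ratr p.2 < x ord0 i + e].
  have [p1] := @rat_in_itvoo R (x ord0 i - e) (x ord0 i) ltac:(lra).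
  have [p2] := @rat_in_itvoo R (x ord0 i) (x ord0 i + e) ltac:(lra).
  by rewrite !in_itv/= => /andP[h1 h2] /andP[h3 h4]; exists (p1, p2).
exists (\row_i (p i).1, \row_i (p i).2) => //; split; [|split] => //.
- move=> v /= hv; apply: eG; split => // i j; rewrite (ord1 i).
  have := hv j; have [] := hp j; rewrite !mxE /ball/= ltr_distl.
  by move=> ? ? ? ? /andP[? ?]; apply/andP; split; lra.
- by move=> i; have [_ h1 h2 _] := hp i; rewrite !mxE h1 h2.
Qed.

End fundamental_lemma.

(** * The weak form of the state equation *)

Section weak_partials.
Variables (R : realType) (n : nat).
Implicit Types (x : 'rV[R]_n) (G : set 'rV[R]_n) (f g h phi : 'rV[R]_n -> R) (i : 'I_n).

Lemma Cc_infty_continuous G phi : Cc_infty G phi -> continuous phi.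
Proof. by move=> [/smooth_C1 /C1_continuous]. Qed.

Lemma Cc_infty_supported G phi : Cc_infty G phi -> supported G phi.
Proof. by move=> [_ [K [_ KG phiK]]] x nG; apply: phiK => /KG. Qed.

Lemma Cc_infty0 G : Cc_infty G (fun=> 0).
Proof.
split; first by apply: elementary_smooth; exact: elementary_cst.
by exists set0; split => //; exact: compact0.
Qed.

Lemma measurable_test phi G : continuous phi ->
  measurable_fun G (phi : _ -> measurableTypeR R).
Proof. by move=> c; apply: measurable_funTS; exact: continuous_measurable_rV. Qed.

Lemma integrable_loc_test G g phi : open G -> loc_integrable G g -> Cc_infty G phi ->
  (leb n).-integrable G (EFin \o (fun x => g x * phi x)).
Proof.
move=> oG lg cphi; have mG := open_measurable_rV oG.
have [_ [K [cK KG phiK]]] := cphi.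
have mK := compact_measurable_rV cK.
have [mg _] := lg.
have [M M0 hM] := supported_bound cK (Cc_infty_continuous cphi) phiK.
have mp := measurable_test (phi := phi).
have iK : (leb n).-integrable K (EFin \o (fun x => g x * phi x)).
  have := integrableZl mK M (loc_integrable_compact lg cK KG mG).
  apply: le_integrable => //.
    apply/measurable_EFinP; apply: measurable_funM.
      exact: measurable_funS mg.
    by apply: measurable_test; exact: Cc_infty_continuous cphi.
  move=> x _ /=; rewrite lee_fin !normrM mulrC ler_wpM2r// (ger0_norm M0); exact: hM.
have mgp : measurable_fun G (EFin \o (fun x => g x * phi x)).
  apply/measurable_EFinP; apply: measurable_funM => //.
  by apply: measurable_test; exact: Cc_infty_continuous cphi.
apply/integrableP; split => //.
case/integrableP : iK => _; apply: le_lt_trans.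
rewrite [leLHS]integral_mkcond [leRHS]integral_mkcond.
rewrite (eq_integral ((fun x => abse ((g x * phi x)%:E)) \_ K))//.
move=> x _; rewrite !patchE; case: ifPn => xG; case: ifPn => xK //.
  by rewrite /= phiK ?mulr0 ?normr0// => /mem_set; exact/negP.
by move: xG; rewrite mem_set//; apply: KG; exact: set_mem.
Qed.

(** The difference of two weak derivatives is orthogonal to every test function. *)
Lemma weak_partial_unique G i f g1 g2 : open G ->
  is_weak_partial G i f g1 -> is_weak_partial G i f g2 ->
  {ae leb n, forall x, G x -> g1 x = g2 x}.
Proof.
move=> oG [_ l1 w1] [_ l2 w2].
have mG := open_measurable_rV oG.
have [m1 i1] := l1; have [m2 i2] := l2.
have lh : loc_integrable G (fun x => g1 x - g2 x).
  split; first exact: measurable_funB.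
  move=> K cK KG; have mK := compact_measurable_rV cK.
  have := integrableB mK (loc_integrable_compact l1 cK KG mG) (loc_integrable_compact l2 cK KG mG).
  by case/integrableP.
have H : forall phi, Cc_infty G phi ->
    \int[leb n]_(x in G) ((g1 x - g2 x) * phi x) = 0.
  move=> phi cphi.
  rewrite (@eq_Rintegral _ _ _ _ _ (fun x => g1 x * phi x - g2 x * phi x)); last first.
    by move=> x _; rewrite mulrBl.
  rewrite RintegralB//; try exact: integrable_loc_test.
  by apply/eqP; rewrite subr_eq0 -eqr_opp -w1// -w2.
apply: filterS (ae_eq0_test oG lh H) => x /= hx /hx /eqP.
by rewrite subr_eq0 => /eqP.
Qed.

(** [weak_partial] is picked by [xget]; uniqueness identifies the pick almost everywhere with any
    explicit weak derivative, which is how its values are computed. *)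
Lemma weak_partialP G i f g : open G -> is_weak_partial G i f g ->
  is_weak_partial G i f (weak_partial G i f) /\
  {ae leb n, forall x, G x -> weak_partial G i f x = g x}.
Proof.
move=> oG wg; have wp : is_weak_partial G i f (weak_partial G i f).
  by rewrite /weak_partial; apply: xgetPex; exists g.
by split => //; exact: weak_partial_unique wp wg.
Qed.

Lemma ae_eq_L2int G f g : measurable G ->
  measurable_fun G (f : _ -> measurableTypeR R) -> measurable_fun G (g : _ -> measurableTypeR R) ->
  {ae leb n, forall x, G x -> f x = g x} ->
  (\int[leb n]_(x in G) (`|f x| ^+ 2 * 1)%:E = \int[leb n]_(x in G) (`|g x| ^+ 2 * 1)%:E)%E.
Proof.
move=> mG mf mg ae; have m2 h : measurable_fun G (h : _ -> measurableTypeR R) ->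
    measurable_fun G (fun x => (`|h x| ^+ 2 * 1)%:E).
  move=> mh; apply/measurable_EFinP; apply: measurable_funM => //.
  by apply: measurable_funX; exact: measurableT_comp.
apply: ae_eq_integral => //; try exact: m2.
by apply: filterS ae => x /= hx /hx ->.
Qed.

Lemma ae_eq_Rintegral G f g : measurable G ->
  measurable_fun G (f : _ -> measurableTypeR R) -> measurable_fun G (g : _ -> measurableTypeR R) ->
  {ae leb n, forall x, G x -> f x = g x} ->
  \int[leb n]_(x in G) f x = \int[leb n]_(x in G) g x.
Proof.
move=> mG mf mg ae; rewrite /Rintegral; congr fine; apply: ae_eq_integral => //.
- exact/measurable_EFinP.
- exact/measurable_EFinP.
- by apply: filterS ae => x /= hx /hx ->.
Qed.

Lemma L2_test G phi : open G -> Cc_infty G phi -> L2 (fun=> 1) G phi.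
Proof.
move=> oG cphi; have cp := Cc_infty_continuous cphi.
have mG := open_measurable_rV oG.
split; first exact: measurable_test.
have lp : loc_integrable G phi by exact: loc_integrable_continuous.
have /integrableP[_] := integrable_loc_test oG lp cphi.
apply: le_lt_trans; rewrite le_eqVlt; apply/orP; left; apply/eqP.
by apply: eq_integral => x _ /=; rewrite mulr1 expr2 -normrM.
Qed.

Lemma Cc_infty_H10 G phi : open G -> Cc_infty G phi -> H10 (fun=> 1) G phi.
Proof.
move=> oG cphi; have mG := open_measurable_rV oG.
split.
  split=> [|i]; first exact: L2_test.
  have [w ae] := weak_partialP oG (Cc_infty_weak_partial i oG cphi).
  split => //; have [_ [mw _] _] := w.
  have [mp fin] := L2_test oG (Cc_infty_partial i cphi).
  split => //; apply: le_lt_trans fin.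
  by rewrite (ae_eq_L2int _ _ _ ae).
(* [phi] approximates itself; the weak derivatives of the zero difference are still picked
   functions, known to vanish only almost everywhere. *)
move=> e e0; exists phi => //.
rewrite (_ : phi \- phi = fun=> 0); last by apply/funext => x; rewrite /= subrr.
have c0 := Cc_infty0 G.
rewrite /H1norm2 integral0_eq; last by move=> x _; rewrite normr0 expr0n mul0r.
rewrite add0e big1 ?lte_fin// => i _.
have [w ae] := weak_partialP oG (Cc_infty_weak_partial i oG c0).
have [_ [mw _] _] := w.
rewrite (ae_eq_L2int (g := fun=> 0)) //.
  by rewrite integral0_eq// => x _; rewrite normr0 expr0n mul0r.
by apply: filterS ae => x /= hx /hx ->; rewrite partial_cst.
Qed.

End weak_partials.

(** * Square-integrable functions and the Cauchy-Schwarz inequality *)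

Section L2_facts.
Variables (R : realType) (n : nat).
Implicit Types (x : 'rV[R]_n) (G D : set 'rV[R]_n) (f g h phi : 'rV[R]_n -> R) (i : 'I_n).
Local Notation mfun D f := (measurable_fun D (f : 'rV[R]_n -> measurableTypeR R)).

Definition sqint D f : \bar R := (\int[leb n]_(x in D) (f x ^+ 2)%:E)%E.

Lemma L2_sqint G f : L2 (fun=> 1) G f -> mfun G f /\ (sqint G f < +oo)%E.
Proof.
move=> [mf fin]; split => //; move: fin; congr (_ < _)%E.
by apply: eq_integral => x _; rewrite mulr1 real_normK ?num_real.
Qed.

Lemma integrable_sq D f : measurable D -> mfun D f -> (sqint D f < +oo)%E ->
  (leb n).-integrable D (EFin \o (fun x => f x ^+ 2)).
Proof.
move=> mD mf fin; apply/integrableP; split.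
  by apply/measurable_EFinP; exact: measurable_funX.
apply: le_lt_trans fin; rewrite le_eqVlt; apply/orP; left; apply/eqP.
by apply: eq_integral => x _ /=; rewrite ger0_norm ?sqr_ge0.
Qed.

Lemma integrable_mul D f g : measurable D -> mfun D f -> mfun D g ->
  (sqint D f < +oo)%E -> (sqint D g < +oo)%E ->
  (leb n).-integrable D (EFin \o (fun x => f x * g x)).
Proof.
move=> mD mf mg f2 g2.
have := integrableD mD (integrable_sq mD mf f2) (integrable_sq mD mg g2).
apply: le_integrable => //; first by apply/measurable_EFinP; exact: measurable_funM.
move=> x _ /=; rewrite lee_fin [leRHS]ger0_norm ?addr_ge0 ?sqr_ge0//.
by rewrite ler_norml; apply/andP; split; nra.
Qed.

Lemma integrable_L2 D f : measurable D -> (leb n D < +oo)%E -> mfun D f ->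
  (sqint D f < +oo)%E -> (leb n).-integrable D (EFin \o f).
Proof.
move=> mD fD mf f2.
have -> : f = fun x => f x * 1 by apply/funext => x; rewrite mulr1.
apply: integrable_mul => //; rewrite /sqint.
by under eq_integral do rewrite expr1n; rewrite integral_cst// mul1e.
Qed.

Lemma Rintegral_sq_le D f (A : R) : measurable D -> mfun D f -> 
  (sqint D f <= A%:E)%E -> \int[leb n]_(x in D) (f x ^+ 2) <= A.
Proof.
move=> mD mf h; rewrite -lee_fin /Rintegral fineK//.
apply: integrable_fin_num => //; apply: integrable_sq => //.
by apply: le_lt_trans h _; rewrite ltry.
Qed.

(** Stated with upper bounds [A] and [B] for the two norms, since only such bounds are at hand
    later. The proof integrates the weighted inequality [2ab <= t a^2 + b^2 / t]. *)
Lemma cauchy_schwarz D f g (A B : R) : measurable D -> mfun D f -> mfun D g ->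
  0 <= A -> 0 <= B ->
  (sqint D f <= (A ^+ 2)%:E)%E -> (sqint D g <= (B ^+ 2)%:E)%E ->
  `|\int[leb n]_(x in D) (f x * g x)| <= A * B.
Proof.
move=> mD mf mg A0 B0 fA gB.
have f2 : (sqint D f < +oo)%E by apply: le_lt_trans fA _; rewrite ltry.
have g2 : (sqint D g < +oo)%E by apply: le_lt_trans gB _; rewrite ltry.
have if2 := integrable_sq mD mf f2.
have ig2 := integrable_sq mD mg g2.
have ifg := integrable_mul mD mf mg f2 g2.
have If := Rintegral_sq_le mD mf fA.
have Ig := Rintegral_sq_le mD mg gB.
set c := `| _ |.
have key e : 0 < e -> c <= (A + e) * (B + e).
  (* The weight that balances the two terms for the bounds [A + e] and [B + e]; the shift by [e]
     keeps it positive when [A] or [B] is 0. *)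
  move=> e0; pose t := (B + e) / (A + e).
  have Ae : 0 < A + e by lra.
  have Be : 0 < B + e by lra.
  have t0 : 0 < t by rewrite divr_gt0.
  have it1 : (leb n).-integrable D (EFin \o (fun x => t / 2 * f x ^+ 2)).
    exact: (integrableZl mD (t / 2) if2).
  have it2 : (leb n).-integrable D (EFin \o (fun x => t^-1 / 2 * g x ^+ 2)).
    exact: (integrableZl mD (t^-1 / 2) ig2).
  have : c <= \int[leb n]_(x in D) (t / 2 * f x ^+ 2 + t^-1 / 2 * g x ^+ 2).
    apply: le_trans (le_normr_Rintegral mD ifg) _.
    apply: le_Rintegral => //.
    - by have := integrable_norm ifg.
    - exact: (integrableD mD it1 it2).
    move=> x _; rewrite normrM.
    rewrite -[X in _ <= _ * X + _]real_normK ?num_real//.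
    rewrite -[X in _ <= _ + _ * X]real_normK ?num_real//.
    move: `|f x| `|g x| => a b.
    have -> : t / 2 * a ^+ 2 + t^-1 / 2 * b ^+ 2 = a * b + t / 2 * (a - t^-1 * b) ^+ 2.
      by field; rewrite gt_eqF.
    by rewrite lerDl mulr_ge0 ?sqr_ge0// divr_ge0// ltW.
  rewrite RintegralD// !RintegralZl//.
  move=> /le_trans; apply.
  apply: (@le_trans _ _ (t / 2 * (A + e) ^+ 2 + t^-1 / 2 * (B + e) ^+ 2)).
    have t2 : 0 <= t / 2 by rewrite divr_ge0// ltW.
    have ti2 : 0 <= t^-1 / 2 by rewrite divr_ge0// invr_ge0 ltW.
    apply: lerD; apply: ler_wpM2l => //.
      by apply: (le_trans If); rewrite lerXn2r ?nnegrE; lra.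
    by apply: (le_trans Ig); rewrite lerXn2r ?nnegrE; lra.
  rewrite le_eqVlt; apply/orP; left; apply/eqP; rewrite /t.
  by field; rewrite !gt_eqF.
rewrite leNgt; apply/negP => h.
(* With [e <= 1], [(A + e)(B + e)] is at most [A B + e (A + B + 1)], which this choice keeps below
   [c]. *)
pose e := Num.min 1 ((c - A * B) / (A + B + 2)).
have ABp : 0 < A + B + 2 by lra.
have e0 : 0 < e by rewrite lt_min ltr01 divr_gt0// subr_gt0.
have e1 : e <= 1 by rewrite ge_min lexx.
have e2 : e * (A + B + 2) <= c - A * B.
  by rewrite -ler_pdivlMr// ge_min lexx orbT.
have := key e e0; nra.
Qed.

(** If [G] were null, so would be its preimages under the homotheties shrinking towards a point of
    [G]; countably many of them cover the space, which is not null. *)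
Lemma leb_open_gt0 G : open G -> G !=set0 -> (0 < leb n G)%E.
Proof.
move=> oG [x Gx]; rewrite lt0e measure_ge0 andbT; apply/eqP => G0.
have /nbhs_ballP[e /= e0 eG] : nbhs x G by apply: open_nbhs_nbhs.
pose B (k : nat) : set 'rV[R]_n := affrV ((k.+1%:R)^-1 * (e / 2)) x @^-1` G.
have mG := open_measurable_rV oG.
have B0 k : leb n (B k) = 0%E.
  rewrite leb_affine//; first by rewrite G0 mule0.
  by rewrite mulf_neq0// ?invr_eq0// gt_eqF// divr_gt0.
have mB k : measurable (B k).
  by rewrite -[X in measurable X]setTI; exact: measurable_affrV.
have : (leb n [set: 'rV[R]_n] <= 0)%E.
  rewrite (_ : setT = \bigcup_k B k).
    have : (leb n).-negligible (\bigcup_k B k).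
      apply: negligible_bigcup => k; apply/negligibleP; [exact: mB|exact: B0].
    by move/negligibleP => -> //; exact: bigcup_measurable.
  apply/esym; rewrite -subTset => v _.
  exists (Num.truncn `|v|) => //; apply: eG; split=> // i j; rewrite (ord1 i).
  have vj : `|v ord0 j| < (Num.truncn `|v|).+1%:R.
    apply: (@le_lt_trans _ _ `|v|); last exact: truncnS_gt.
    by rewrite [leRHS]mx_normrE; exact: (le_bigmax _ (fun p => `|v p.1 p.2|) (ord0, j)).
  rewrite /ball/= !mxE opprD addrCA subrr addr0 normrN normrM normrM normfV.
  rewrite (gtr0_norm (_ : 0 < e / 2)) ?divr_gt0// normr_nat.
  rewrite -mulrA mulrC ltr_pdivrMr//.
  by have := normr_ge0 (v ord0 j); nra.
by rewrite leNgt leb_setT_gt0.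
Qed.

End L2_facts.

(** * Testing the state equation with smooth functions *)

Section state_equation.
Variables (R : realType) (n : nat) (G : set 'rV[R]_n).
Hypotheses (oG : open G) (finG : (leb n G < +oo)%E).
Implicit Types (x : 'rV[R]_n) (f g h phi : 'rV[R]_n -> R) (i : 'I_n).
Local Notation mfun D f := (measurable_fun D (f : 'rV[R]_n -> measurableTypeR R)).
Local Notation one := (fun=> 1 : R).

Let mG := open_measurable_rV oG.

Lemma H1_weak_partial i f : H1 one G f ->
  [/\ is_weak_partial G i f (weak_partial G i f), mfun G (weak_partial G i f) &
      (sqint G (weak_partial G i f) < +oo)%E].
Proof. by move=> [_ /(_ i)[w /L2_sqint[mw fin]]]. Qed.

Lemma is_weak_partialB i f g phi : is_weak_partial G i f g -> Cc_infty G phi ->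
  is_weak_partial G i (f \- phi)%R (fun x => g x - partial i phi x).
Proof.
move=> [[mf lf] [mg lg] wf] cphi.
have [[mp lp] [mdp ldp] wp] := Cc_infty_weak_partial i oG cphi.
have li f1 f2 : loc_integrable G f1 -> loc_integrable G f2 ->
    loc_integrable G (fun x => f1 x - f2 x).
  move=> l1 l2; split; first by apply: measurable_funB; [case: l1|case: l2].
  move=> K cK KG; have mK := compact_measurable_rV cK.
  have := integrableB mK (loc_integrable_compact l1 cK KG mG) (loc_integrable_compact l2 cK KG mG).
  by case/integrableP.
split; [exact: li|exact: li|] => psi cpsi.
rewrite (@eq_Rintegral _ _ _ _ _ (fun x => f x * partial i psi x - phi x * partial i psi x)); last first.
  by move=> x _; rewrite mulrBl.
rewrite [X in _ = - X](@eq_Rintegral _ _ _ _ _ (fun x => g x * psi x - partial i phi x * psi x)); last first.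
  by move=> x _; rewrite mulrBl.
rewrite !RintegralB//; try by apply: integrable_loc_test => //; exact: Cc_infty_partial.
by rewrite wf// wp// opprB opprK addrC.
Qed.

(** True for test functions; in the limit, Cauchy-Schwarz against the constant 1 controls the error,
    as [G] has finite measure. *)
Lemma Rintegral_weak_partial0 i f : H10 one G f ->
  \int[leb n]_(x in G) weak_partial G i f x = 0.
Proof.
move=> [H1f apx].
have [w mw fw] := H1_weak_partial i H1f.
have iw := integrable_L2 mG finG mw fw.
set c := \int[leb n]_(x in G) _.
pose V := fine (leb n G).
have VE : leb n G = V%:E by rewrite fineK// ge0_fin_numE.
have V0 : 0 <= V by rewrite fine_ge0.
have key e : 0 < e -> `|c| <= Num.sqrt V * e.
  move=> e0; have e20 : 0 < e ^+ 2 by rewrite exprn_gt0.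
  have [phi cphi] := apx (e ^+ 2) e20.
  rewrite /H1norm2 => hphi.
  have wB := is_weak_partialB w cphi.
  have [wB' ae] := weak_partialP oG wB.
  have [_ [mB _] _] := wB; have [_ [mB' _] _] := wB'.
  have h2 : (sqint G (fun x => weak_partial G i f x - partial i phi x)%R <= (e ^+ 2)%:E)%E.
    apply: le_trans (ltW hphi).
    rewrite (bigD1 i)//= addeCA -[leLHS]adde0; apply: leeD.
      rewrite (ae_eq_L2int _ _ _ ae)// le_eqVlt; apply/orP; left; apply/eqP.
      by apply: eq_integral => x _; rewrite mulr1 real_normK ?num_real.
    apply: adde_ge0; first by apply: integral_ge0 => x _; rewrite lee_fin mulr1 exprn_ge0.
    by apply: sume_ge0 => j _; apply: integral_ge0 => x _; rewrite lee_fin mulr1 exprn_ge0.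
  have iphi : (leb n).-integrable G (EFin \o partial i phi).
    have := integrable_loc_test oG (loc_integrable_continuous mG (@cst_continuous _ _ (1 : R)))
      (Cc_infty_partial i cphi).
    by apply: eq_integrable => // x _ /=; rewrite mul1r.
  have -> : c = \int[leb n]_(x in G) (1 * (weak_partial G i f x - partial i phi x)).
    rewrite (@eq_Rintegral _ _ _ _ _ (fun x => weak_partial G i f x - partial i phi x)); last first.
      by move=> x _; rewrite mul1r.
    rewrite RintegralB//.
    have [_ [K [cK KG phiK]]] := cphi.
    have [[/smooth_C1 cp _] sp] := (cphi, Cc_infty_supported (Cc_infty_partial i cphi)).
    by rewrite (Rintegral_supported sp) (Rintegral_partial0 i cK) ?subr0.
  apply: cauchy_schwarz => //.
  - exact: ltW.
  - rewrite /sqint sqr_sqrtr//; under eq_integral do rewrite expr1n.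
    by rewrite integral_cst// mul1e -VE.
apply/eqP; rewrite -normr_le0 leNgt; apply/negP => c0.
have s1 : 0 < Num.sqrt V + 1 by rewrite ltr_wpDl ?sqrtr_ge0.
have := key (`|c| / (Num.sqrt V + 1) / 2).
rewrite !divr_gt0// => /(_ isT).
have -> : Num.sqrt V * (`|c| / (Num.sqrt V + 1) / 2) = `|c| * (Num.sqrt V / (Num.sqrt V + 1) / 2).
  by field; rewrite gt_eqF.
rewrite ler_pMr// leNgt => /negP; apply.
rewrite ltr_pdivrMr// ltr_pdivrMr//; have := sqrtr_ge0 V; lra.
Qed.

Lemma integrable_test f phi : mfun G f -> (sqint G f < +oo)%E -> Cc_infty G phi ->
  (leb n).-integrable G (EFin \o (fun x => f x * phi x)).
Proof.
move=> mf f2 cphi; apply: integrable_mul => //.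
  by apply: measurable_test; exact: Cc_infty_continuous cphi.
by have [] := L2_sqint (L2_test oG cphi).
Qed.

Lemma measurable_sum_fun (I : Type) (r : seq I) (F : I -> 'rV[R]_n -> R) (D : set 'rV[R]_n) :
  (forall i : I, mfun D (F i)) -> mfun D (fun x => \sum_(i <- r) F i x).
Proof.
move=> mF; elim: r => [|i r IH].
  rewrite (_ : (fun x => _) = fun=> 0); first exact: measurable_cst.
  by apply/funext => x; rewrite big_nil.
rewrite (_ : (fun x => _) = fun x => F i x + \sum_(i <- r) F i x).
  exact: (measurable_funD (mF i) IH).
by apply/funext => x; rewrite big_cons.
Qed.

Lemma ae_forall_fin (I : finType) (P : I -> 'rV[R]_n -> Prop) :
  (forall i : I, {ae leb n, forall x, P i x}) -> {ae leb n, forall x (i : I), P i x}.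
Proof.
move=> aeP; have : {ae leb n, forall x, forall i : I, i \in enum I -> P i x}.
  elim: (enum I) => [|i r IH]; first exact: aeW.
  apply: filterS2 (aeP i) IH => x Pi Pr j.
  by rewrite inE => /predU1P[->|/Pr].
by apply: filterS => x Px i; apply: Px; rewrite mem_enum.
Qed.

Lemma Rintegral_sum (I : Type) (r : seq I) (F : I -> 'rV[R]_n -> R) :
  (forall i : I, (leb n).-integrable G (EFin \o F i)) ->
  (leb n).-integrable G (EFin \o (fun x => \sum_(i <- r) F i x)) /\
  \int[leb n]_(x in G) (\sum_(i <- r) F i x) = \sum_(i <- r) \int[leb n]_(x in G) F i x.
Proof.
move=> iF; elim: r => [|i r [IH1 IH2]].
  rewrite big_nil; split.
    apply: (eq_integrable _ (cst 0%E)) => //; last exact: integrable0.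
    by move=> x _ /=; rewrite big_nil.
  rewrite (@eq_Rintegral _ _ _ _ _ (fun=> 0)); last by move=> x _; rewrite big_nil.
  by rewrite Rintegral_cst// mul0r.
rewrite big_cons -IH2 -RintegralD//; split.
  have := integrableD mG (iF i) IH1; apply: eq_integrable => // x _ /=.
  by rewrite big_cons.
by apply: eq_Rintegral => x _; rewrite big_cons.
Qed.

Lemma L2_bounded f M : mfun G f -> (forall x, G x -> `|f x| <= M) -> L2 one G f.
Proof.
move=> mf hM; split => //.
have : (leb n).-integrable G (EFin \o (fun x => f x ^+ 2)).
  apply: (@integrable_bounded_on _ _ _ _ (M ^+ 2)) => //.
    exact: measurable_funX.
  by move=> x Gx; rewrite normrX lerXn2r ?nnegrE//; [exact: le_trans (hM x Gx)|exact: hM].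
case/integrableP => _; apply: le_lt_trans; rewrite le_eqVlt; apply/orP; left; apply/eqP.
by apply: eq_integral => x _ /=; rewrite mulr1 normrX.
Qed.

Lemma state_div (y : 'rV[R]_n -> 'rV[R]_n) : vH10 one G y ->
  (forall q, L2_mean0 one G q -> form_b G y q = 0) ->
  forall phi, Cc_infty G phi ->
  \sum_i \int[leb n]_(x in G) (component y i x * partial i phi x) = 0.
Proof.
move=> Hy divy phi cphi.
pose V := fine (leb n G).
have VE : leb n G = V%:E by rewrite fineK// ge0_fin_numE.
pose m := (\int[leb n]_(x in G) phi x) / V.
have cp := Cc_infty_continuous cphi.
have mp : mfun G phi by exact: measurable_test.
have [M hM] : exists M, forall x, `|phi x| <= M.
  have [_ [K [cK _ phiK]]] := cphi.
  by have [M _ hM] := supported_bound cK cp phiK; exists M.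
have iphi : (leb n).-integrable G (EFin \o phi) by exact: (@integrable_bounded_on _ _ _ _ M).
have im : (leb n).-integrable G (EFin \o (fun=> m)).
  by apply: (@integrable_bounded_on _ _ _ _ `|m|).
(* The constant m drops out again: weak partial derivatives of functions in
   H10 have mean 0. *)
have q0 : L2_mean0 one G (fun x => phi x - m).
  split.
    apply: (@L2_bounded _ (M + `|m|)); first exact: measurable_funB.
    move=> x _; apply: le_trans (ler_normB _ _) _; rewrite lerD2r; exact: hM.
  rewrite RintegralB// Rintegral_cst// -/V /m.
  (* If [V = 0] the quotient defining [m] is 0, but then [G] is null and the integral vanishes. *)
  have [V0|V0] := eqVneq V 0; last by rewrite divfK// subrr.
  rewrite V0 mulr0 subr0 /Rintegral null_set_integral//.
    exact/measurable_EFinP.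
  exact: (eq_trans VE (congr1 EFin V0)).
pose w i := weak_partial G i (component y i).
have W i : [/\ is_weak_partial G i (component y i) (w i), mfun G (w i) & (sqint G (w i) < +oo)%E].
  by apply: H1_weak_partial; have [] := Hy i.
have iw i : (leb n).-integrable G (EFin \o w i) by have [_ ? ?] := W i; exact: integrable_L2.
have iwp i : (leb n).-integrable G (EFin \o (fun x => w i x * phi x)).
  by have [_ ? ?] := W i; exact: integrable_test.
have imw i : (leb n).-integrable G (EFin \o (fun x => m * w i x)) by exact: (integrableZl mG m (iw i)).
have iF i : (leb n).-integrable G (EFin \o (fun x => w i x * phi x - m * w i x)).
  exact: (integrableB mG (iwp i) (imw i)).
have := divy _ q0; rewrite /form_b.
rewrite (@eq_Rintegral _ _ _ _ _ (fun x => \sum_i (w i x * phi x - m * w i x))); last first.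
  move=> x _; rewrite mulr_sumr; apply: eq_bigr => i _; rewrite /w; ring.
rewrite (Rintegral_sum _ iF).2 => /eqP; rewrite oppr_eq0 => /eqP E.
apply: oppr_inj; rewrite oppr0 -[RHS]E -sumrN; apply: eq_bigr => i _; rewrite RintegralB// RintegralZl//.
rewrite (Rintegral_weak_partial0 i (Hy i)).
by rewrite mulr0 subr0; have [[_ _ wi] _ _] := W i; rewrite wi// opprK.
Qed.

Lemma state_momentum (y u : 'rV[R]_n -> 'rV[R]_n) p : vH10 one G y ->
  L2 one G p -> (forall i, L2 one G (component u i)) ->
  (forall v, vH10 one G v -> form_a G y v + form_b G v p = L2_inner G u v) ->
  forall k phi, Cc_infty G phi ->
  \int[leb n]_(x in G) (component u k x * phi x) +
  \sum_j \int[leb n]_(x in G) (component y k x * partial j (partial j phi) x) +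
  \int[leb n]_(x in G) (p x * partial k phi x) = 0.
Proof.
move=> Hy /L2_sqint[mp p2] Hu eqn k phi cphi.
pose v x : 'rV[R]_n := phi x *: delta_mx ord0 k.
have cv i : component v i = if i == k then phi else fun=> 0.
  apply/funext => x; rewrite /component /v !mxE eqxx /=.
  by case: eqP => _; rewrite ?mulr1 ?mulr0.
have ccv i : Cc_infty G (component v i) by rewrite cv; case: ifP => _ //; exact: Cc_infty0.
have Hv : vH10 one G v by move=> i; exact: Cc_infty_H10.
have Wv i j := weak_partialP oG (Cc_infty_weak_partial j oG (ccv i)).
have mwv i j : mfun G (weak_partial G j (component v i)).
  by have [[_ [? _] _] _] := Wv i j.
have mpv i j : mfun G (partial j (component v i)).
  by apply: measurable_test; apply: Cc_infty_continuous (Cc_infty_partial j (ccv i)).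
have W i j : [/\ is_weak_partial G j (component y i) (weak_partial G j (component y i)),
    mfun G (weak_partial G j (component y i)) & (sqint G (weak_partial G j (component y i)) < +oo)%E].
  by apply: H1_weak_partial; have [] := Hy i.
have Ea : form_a G y v = - \sum_j \int[leb n]_(x in G) (component y k x * partial j (partial j phi) x).
  rewrite /form_a (bigD1 k)//= [X in _ + X]big1 ?addr0; last first.
    move=> i ik; apply: big1 => j _.
    rewrite (@ae_eq_Rintegral _ _ _ _ (fun=> 0))//.
    - by rewrite Rintegral_cst// mul0r.
    - by have [_ m1 _] := W i j; exact: measurable_funM m1 (mwv i j).
    - have [_ ae] := Wv i j; apply: filterS ae => x /= hx /hx ->.
      by rewrite cv (negPf ik) partial_cst mulr0.
  rewrite -sumrN; apply: eq_bigr => j _.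
  have [[_ _ w] mw _] := W k j.
  rewrite (w _ (Cc_infty_partial j cphi)) opprK.
  apply: ae_eq_Rintegral => //.
  - exact: measurable_funM mw (mwv k j).
  - apply: measurable_funM => //; apply: measurable_test.
    exact: Cc_infty_continuous (Cc_infty_partial j cphi).
  - have [_ ae] := Wv k j; apply: filterS ae => x /= hx /hx ->.
    by rewrite cv eqxx.
have Eb : form_b G v p = - \int[leb n]_(x in G) (p x * partial k phi x).
  rewrite /form_b; congr (- _); apply: ae_eq_Rintegral => //.
  - apply: measurable_funM => //.
    exact: measurable_sum_fun.
  - apply: measurable_funM => //; apply: measurable_test.
    exact: Cc_infty_continuous (Cc_infty_partial k cphi).
  - have : {ae leb n, forall x (i : 'I_n), G x ->
        weak_partial G i (component v i) x = partial i (component v i) x}.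
      by apply: ae_forall_fin => i; have [_ ae] := Wv i i.
    apply: filterS => x /= hx Gx; congr (_ * _).
    rewrite (bigD1 k)//= big1 ?addr0; first by rewrite hx// cv eqxx.
    by move=> i ik; rewrite hx// cv (negPf ik) partial_cst.
have Eu : L2_inner G u v = \int[leb n]_(x in G) (component u k x * phi x).
  apply: eq_Rintegral => x _; rewrite /dot (bigD1 k)//= big1 ?addr0.
    by rewrite /v !mxE !eqxx mulr1.
  by move=> i ik; rewrite /v !mxE (negPf ik) andbF !mulr0.
have := eqn v Hv; rewrite Ea Eb Eu => <-.
by rewrite -addrA addrACA; ring.
Qed.

End state_equation.

(** * Radial bumps and polynomials of degree two *)

Section rbump.
Variables (R : realType) (n : nat).
Implicit Types (x y c v : 'rV[R]_n) (f g phi : 'rV[R]_n -> R) (i j k : 'I_n) (r : R).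

Definition nsq x : R := \sum_i x ord0 i ^+ 2.

Lemma nsq_ge0 x : 0 <= nsq x.
Proof. by apply: sumr_ge0 => i _; rewrite sqr_ge0. Qed.

Lemma enormE x : enorm x = Num.sqrt (nsq x). Proof. by []. Qed.

Lemma sqr_enorm x : enorm x ^+ 2 = nsq x.
Proof. by rewrite sqr_sqrtr// nsq_ge0. Qed.

Lemma enorm_ge0 x : 0 <= enorm x. Proof. exact: sqrtr_ge0. Qed.

Lemma nsqN x : nsq (- x) = nsq x.
Proof. by apply: eq_bigr => i _; rewrite mxE sqrrN. Qed.

Lemma nsqZ r x : nsq (r *: x) = r ^+ 2 * nsq x.
Proof. by rewrite mulr_sumr; apply: eq_bigr => i _; rewrite mxE exprMn. Qed.

Lemma enormZ r x : enorm (r *: x) = `|r| * enorm x.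
Proof. by rewrite enormE nsqZ sqrtrM ?sqr_ge0// sqrtr_sqr. Qed.

Lemma enorm_coord x i : `|x ord0 i| <= enorm x.
Proof.
rewrite -sqrtr_sqr ler_sqrt ?nsq_ge0// /nsq (bigD1 i)//= lerDl.
by apply: sumr_ge0 => j _; rewrite sqr_ge0.
Qed.

(** The standard mollifier [exp(-1 / (1 - |x|^2))] of the unit ball, without normalisation. *)
Definition bump0 x : R := gexp 0 (1 - nsq x).

Definition rbump c r x : R := bump0 (r^-1 *: (x - c)).

Lemma elementary_nsq c r : elementary (fun x => nsq (r^-1 *: (x - c))).
Proof.
rewrite (_ : (fun x => _) = fun x => \sum_i (r^-1 * (x ord0 i - c ord0 i)) * (r^-1 * (x ord0 i - c ord0 i))); last first.
  by apply/funext => x; apply: eq_bigr => i _; rewrite !mxE expr2.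
elim: (index_enum _) => [|i s IH].
  rewrite (_ : (fun x => _) = fun=> 0); first exact: elementary_cst.
  by apply/funext => x; rewrite big_nil.
rewrite (_ : (fun x => _) = fun x => (r^-1 * (x ord0 i - c ord0 i)) * (r^-1 * (x ord0 i - c ord0 i)) +
  \sum_(i <- s) (r^-1 * (x ord0 i - c ord0 i)) * (r^-1 * (x ord0 i - c ord0 i))); last first.
  by apply/funext => x; rewrite big_cons.
apply: elementaryD => //.
have e : elementary (fun x => r^-1 * (x ord0 i - c ord0 i)).
  apply: elementaryM; first exact: elementary_cst.
  by apply: elementaryD; [exact: elementary_coord|exact: elementary_cst].
exact: elementaryM.
Qed.

Lemma elementary_bump_gen (m : nat) c r : elementary (fun x => gexp m (1 - nsq (r^-1 *: (x - c)))).
Proof.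
apply: elementary_gexp; rewrite (_ : (fun x => _) = fun x => 1 + -1 * nsq (r^-1 *: (x - c))).
  apply: elementaryD; first exact: elementary_cst.
  by apply: elementaryM; [exact: elementary_cst|exact: elementary_nsq].
by apply/funext => x; rewrite mulN1r.
Qed.

Lemma elementary_bump c r : elementary (rbump c r).
Proof. exact: elementary_bump_gen. Qed.

Lemma bump01 : bump0 = rbump 0 1.
Proof. by apply/funext => x; rewrite /rbump invr1 scale1r subr0. Qed.

Lemma elementary_bump0 : elementary bump0.
Proof. rewrite bump01; exact: elementary_bump. Qed.

Definition eball c r := [set x : 'rV[R]_n | enorm (x - c) <= r].

Lemma bump0_out x : 1 < enorm x -> bump0 x = 0.
Proof.
move=> h; rewrite /bump0 gexp_le0// subr_le0 -sqr_enorm.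
by rewrite -(expr1n _ 2) lerXn2r ?nnegrE ?enorm_ge0// ltW.
Qed.

Lemma bump_supported c r : 0 < r -> supported (eball c r) (rbump c r).
Proof.
move=> r0 x /negP; rewrite -ltNge => h; rewrite /rbump bump0_out// enormZ.
by rewrite normfV (gtr0_norm r0) ltr_pdivlMl// mulr1.
Qed.

Lemma continuous_enorm_sub c : continuous (fun x => enorm (x - c)).
Proof.
have cn : continuous (fun x => nsq (x - c)).
  have := C1_continuous (elementary_C1 (elementary_nsq c 1)).
  by under eq_fun do rewrite invr1 scale1r.
move=> x; apply: (@continuous_comp _ _ _ (fun x => nsq (x - c)) (@Num.sqrt R)).
  exact: cn.
exact: sqrt_continuous.
Qed.

Lemma compact_eball c r : compact (eball c r).
Proof.
have cl : closed (eball c r).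
  rewrite (_ : eball c r = (fun x => enorm (x - c)) @^-1` [set t | t <= r])//.
  apply: closed_comp => [x _|]; last exact: closed_le.
  exact: continuous_enorm_sub.
have sub : eball c r `<=` cbox (\row_i (c ord0 i - `|r|)) (\row_i (c ord0 i + `|r|)).
  move=> x hx i; rewrite !mxE -ler_distl.
  have := enorm_coord (x - c) i; rewrite !mxE => /le_trans; apply.
  by apply: le_trans hx _; exact: ler_norm.
apply: (subclosed_compact cl _ sub); exact: compact_cbox.
Qed.

Lemma Cc_infty_bump G c r : 0 < r -> eball c r `<=` G -> Cc_infty G (rbump c r).
Proof.
move=> r0 sub; split; first exact/elementary_smooth/elementary_bump.
exists (eball c r); split => //; [exact: compact_eball|exact: bump_supported].
Qed.

Lemma partial_affine f i c r : (forall x, differentiable f x) ->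
  partial i (fun x => f (r *: (x - c))) = fun x => r * partial i f (r *: (x - c)).
Proof.
move=> df; apply/funext => x; rewrite /partial.
have -> : 'D_(delta_mx ord0 i) (fun x => f (r *: (x - c))) x =
          'D_(r *: delta_mx ord0 i) f (r *: (x - c)).
  rewrite /derive; set F := fun h : R => _; set F' := fun h : R => _.
  have -> : F = F'; last by [].
  apply/funext => h; rewrite /F /F' /=; congr (_ *: (f _ - _)).
  by rewrite scalerA mulrC -scalerA -scalerDr addrA.
by rewrite !deriveE// linearZ.
Qed.

Lemma partial_bump c r i : partial i (rbump c r) =
  fun x => r^-1 * partial i bump0 (r^-1 *: (x - c)).
Proof. exact/partial_affine/elementary_differentiable/elementary_bump0. Qed.

Lemma partial2_bump c r i j : partial j (partial i (rbump c r)) =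
  fun x => r^-1 * (r^-1 * partial j (partial i bump0) (r^-1 *: (x - c))).
Proof.
rewrite partial_bump.
have e := elementary_partial i elementary_bump0.
pose g y := r^-1 * partial i bump0 y.
have eg : elementary g by apply: elementaryM => //; exact: elementary_cst.
have dg := elementary_differentiable eg.
transitivity (fun x => r^-1 * partial j g (r^-1 *: (x - c))).
  exact: (partial_affine j c r^-1 dg).
apply/funext => x; congr (_ * _).
rewrite /g (partialM j (f := fun=> r^-1)).
- by rewrite partial_cst mul0r addr0.
- by move=> z; exact: differentiable_cst.
- exact: elementary_differentiable.
Qed.

Lemma Rintegral_rescale f c r : 0 < r ->
  measurable_fun setT (f : _ -> measurableTypeR R) ->
  \int[leb n]_x f (r^-1 *: (x - c)) = r ^+ n * \int[leb n]_x f x.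
Proof.
move=> r0 mf.
have ri0 : r^-1 != 0 by rewrite invr_eq0 gt_eqF.
have := Rintegral_leb_affine (- (r^-1 *: c)) ri0 mf.
rewrite normfV invrK (gtr0_norm r0) => <-.
by apply: eq_Rintegral => x _; rewrite scalerBr.
Qed.

Lemma Rintegral_odd f :
  (leb n).-integrable setT (EFin \o f) -> (forall x, f (- x) = - f x) ->
  \int[leb n]_x f x = 0.
Proof.
move=> intf fodd.
have mf : measurable_fun setT (f : _ -> measurableTypeR R).
  by apply/measurable_EFinP; exact: measurable_int intf.
have N0 : (-1 : R) != 0 by rewrite oppr_eq0 oner_neq0.
have := Rintegral_leb_affine 0 N0 mf.
rewrite normrN1 invr1 expr1n mul1r => E.
have : \int[leb n]_x f x = - \int[leb n]_x f x.
  rewrite -{1}E (@eq_Rintegral _ _ _ _ _ (fun x => -1 * f x)).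
    by rewrite RintegralZl// mulN1r.
  by move=> x _; rewrite addr0 scaleN1r fodd mulN1r.
lra.
Qed.

Definition lap f x := \sum_j partial j (partial j f) x.

Lemma bump0_ge0 x : 0 <= bump0 x. Proof. exact: gexp_ge0. Qed.

Lemma bump0N x : bump0 (- x) = bump0 x.
Proof. by rewrite /bump0 nsqN. Qed.

Definition unit_ball : set 'rV[R]_n := eball 0 1.

Lemma compact_unit_ball : compact unit_ball. Proof. exact: compact_eball. Qed.

Lemma bump0_supported : supported unit_ball bump0.
Proof. by rewrite bump01; exact: bump_supported. Qed.

Lemma integrable_elementary_supported f : elementary f -> supported unit_ball f ->
  (leb n).-integrable setT (EFin \o f).
Proof.
move=> ef sf; apply: (integrable_supported compact_unit_ball) => //.
exact/C1_continuous/elementary_C1.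
Qed.

Lemma partial_even f i : (forall x, differentiable f x) -> (forall x, f (- x) = f x) ->
  forall x, partial i f (- x) = - partial i f x.
Proof.
move=> df fe x; have E : f = fun x => f (-1 *: (x - 0)).
  by apply/funext => z; rewrite subr0 scaleN1r fe.
by rewrite [in RHS]E partial_affine// subr0 scaleN1r mulN1r opprK.
Qed.

Lemma partial_odd f i : (forall x, differentiable f x) -> (forall x, f (- x) = - f x) ->
  forall x, partial i f (- x) = partial i f x.
Proof.
move=> df fo x; have E : f = fun x => -1 * f (-1 *: (x - 0)).
  by apply/funext => z; rewrite subr0 scaleN1r fo mulN1r opprK.
have dc : forall x, differentiable (fun x => f (-1 *: (x - 0))) x.
  have -> : (fun x => f (-1 *: (x - 0))) = fun x => -1 * f x.
    by apply/funext => z; rewrite subr0 scaleN1r fo mulN1r.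
  by move=> z; apply: differentiableM => //; exact: differentiable_cst.
rewrite [in RHS]E (partialM i (f := fun=> -1))//.
  by rewrite partial_cst mul0r addr0 partial_affine// subr0 scaleN1r mulrA mulrNN mulr1 mul1r.
Qed.

Lemma lap_bump0N x : lap bump0 (- x) = lap bump0 x.
Proof.
apply: eq_bigr => j _; apply: partial_odd.
  exact/elementary_differentiable/elementary_partial/elementary_bump0.
apply: partial_even; last exact: bump0N.
exact/elementary_differentiable/elementary_bump0.
Qed.

(** A zero integral would make the bump vanish almost everywhere, but it is positive on the open
    unit ball, a set of positive measure. *)
Lemma bump0_int_gt0 : 0 < \int[leb n]_x bump0 x.
Proof.
rewrite lt0r Rintegral_ge0 ?andbT; last by move=> x _; exact: bump0_ge0.
apply/eqP => E.
have ib := integrable_elementary_supported elementary_bump0 bump0_supported.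
have E2 : (\int[leb n]_x (bump0 x)%:E = 0)%E.
  have fin := integrable_fin_num measurableT ib.
  by rewrite -[LHS](fineK fin); congr EFin; exact: E.
pose U := [set x : 'rV[R]_n | enorm (x - 0) < 1].
have oU : open U.
  rewrite (_ : U = (fun x => enorm (x - 0)) @^-1` [set t | t < 1])//.
  apply: open_comp => [x _|]; last exact: open_lt.
  exact: continuous_enorm_sub.
have U0 : U !=set0.
  by exists 0; rewrite /U/= subr0 enormE /nsq big1 ?sqrtr0// => i _; rewrite mxE expr0n.
have := leb_open_gt0 oU U0; rewrite lt0e => /andP[/eqP + _]; apply.
have : ae_eq (leb n) setT (fun x => (bump0 x)%:E) (cst 0%E).
  have := ae_eq_integral_abs (leb n) measurableT (f := fun x => (bump0 x)%:E).
  move=> H; apply/H; first by apply: measurable_int ib.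
  by rewrite -[RHS]E2; apply: eq_integral => x _; rewrite /= ger0_norm// bump0_ge0.
move=> ae; have : (leb n).-negligible U.
  apply: negligibleS ae => x Ux /= /(_ I) [] /eqP; apply/negP.
  rewrite gt_eqF// /bump0 gexp_gt0// subr_gt0 -sqr_enorm expr_lt1 ?enorm_ge0//.
  by move: Ux; rewrite /U/= subr0.
by move/negligibleP; apply; exact: open_measurable_rV.
Qed.

End rbump.

(** * Polynomials of degree at most two in matrix form *)

Section quadratic.
Variables (R : realType) (n : nat).
Implicit Types (x y c v z : 'rV[R]_n) (f g phi q : 'rV[R]_n -> R) (i j : 'I_n) (r : R).

Definition sc (M : 'M[R]_1) : R := M 0 0.

(** In matrix form, the expansion about any point is a matrix identity. [A] is not assumed
    symmetric, so products of affine functions fit directly. *)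
Definition quadr q := exists (a : R) (b : 'cV[R]_n) (A : 'M[R]_n),
  forall x, q x = a + sc (x *m b) + sc (x *m A *m x^T).

Definition affr q := exists (a : R) (b : 'cV[R]_n), forall x, q x = a + sc (x *m b).

Lemma scD M N : sc (M + N) = sc M + sc N. Proof. by rewrite /sc mxE. Qed.
Lemma scZ r M : sc (r *: M) = r * sc M. Proof. by rewrite /sc mxE. Qed.
Lemma sc_tr M : sc M^T = sc M. Proof. by rewrite /sc mxE. Qed.

Lemma affr_quadr q : affr q -> quadr q.
Proof.
move=> [a [b h]]; exists a, b, 0 => x.
by rewrite h mulmx0 mul0mx [sc 0]mxE addr0.
Qed.

Lemma affr_cst (a : R) : affr (fun=> a).
Proof. by exists a, 0 => x; rewrite mulmx0 [sc 0]mxE addr0. Qed.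

Lemma affr_coord i : affr (fun x => x ord0 i).
Proof.
exists 0, (delta_mx i 0) => x; rewrite add0r /sc mxE (bigD1 i)//= big1.
  by rewrite addr0 mxE !eqxx mulr1.
by move=> j ji; rewrite mxE (negPf ji) mulr0.
Qed.

Lemma affrD q1 q2 : affr q1 -> affr q2 -> affr (fun x => q1 x + q2 x).
Proof.
move=> [a [b h]] [a' [b' h']]; exists (a + a'), (b + b') => x.
by rewrite h h' mulmxDr scD; ring.
Qed.

Lemma affrZ r q : affr q -> affr (fun x => r * q x).
Proof.
move=> [a [b h]]; exists (r * a), (r *: b) => x.
by rewrite h -scalemxAr scZ; ring.
Qed.

Lemma quadrD q1 q2 : quadr q1 -> quadr q2 -> quadr (fun x => q1 x + q2 x).
Proof.
move=> [a [b [A h]]] [a' [b' [A' h']]]; exists (a + a'), (b + b'), (A + A') => x.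
by rewrite h h' !mulmxDr mulmxDl !scD; ring.
Qed.

Lemma quadrZ r q : quadr q -> quadr (fun x => r * q x).
Proof.
move=> [a [b [A h]]]; exists (r * a), (r *: b), (r *: A) => x.
by rewrite h -!scalemxAr -scalemxAl !scZ; ring.
Qed.

Lemma quadrM q1 q2 : affr q1 -> affr q2 -> quadr (fun x => q1 x * q2 x).
Proof.
move=> [a [b h]] [a' [b' h']]; exists (a * a'), (a *: b' + a' *: b), (b *m b'^T) => x.
rewrite h h' !mulmxDr -!scalemxAr scD !scZ.
have -> : sc (x *m (b *m b'^T) *m x^T) = sc (x *m b) * sc (x *m b').
  rewrite mulmxA -mulmxA -trmx_mul /sc mxE big_ord1 [in X in _ * X]mxE.
  by [].
ring.
Qed.

(** Splits off one variable, which presents a quadratic monomial as a product of two affine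
    functions. *)
Lemma monomial_split (m : 'I_n -> nat) (s : nat) : (\sum_i m i = s.+1)%N ->
  exists i m', (\sum_i m' i = s)%N /\
    forall x, \prod_i x ord0 i ^+ m i = x ord0 i * \prod_i x ord0 i ^+ m' i.
Proof.
move=> hs; have [i hi] : exists i, (0 < m i)%N.
  apply/existsP; rewrite -[[exists i, _]]negbK negb_exists; apply/negP => /forallP h.
  by move: hs; rewrite big1// => i _; apply/eqP; rewrite -leqn0 leqNgt.
exists i, (fun j => m j - (j == i))%N.
have E j : j != i -> (m j - (j == i) = m j)%N by move=> /negPf ->; rewrite subn0.
split.
  move: hs; rewrite (bigD1 i)//= => hs.
  rewrite (bigD1 i)//= eqxx (eq_bigr _ E).
  by move: hs; case: (m i) hi => // k _; rewrite addSn subn1 => -[].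
move=> x; rewrite (bigD1 i)//= [in RHS](bigD1 i)//= eqxx mulrA -exprS subn1 prednK//.
by congr (_ * _); apply: eq_bigr => j /E ->.
Qed.

Lemma monomial0 (m : 'I_n -> nat) : (\sum_i m i = 0)%N -> forall x, \prod_i x ord0 i ^+ m i = 1.
Proof.
move=> h x; apply: big1 => i _.
by move/eqP: h; rewrite sum_nat_eq0 => /forallP/(_ i)/eqP ->.
Qed.

Lemma quadr_sum (I : Type) (s : seq I) (P : pred I) (F : I -> 'rV[R]_n -> R) :
  (forall i : I, P i -> quadr (F i)) -> quadr (fun x => \sum_(i <- s | P i) F i x).
Proof.
move=> hF; elim: s => [|i s IH].
  rewrite (_ : (fun x => _) = fun=> 0); first exact/affr_quadr/affr_cst.
  by apply/funext => x; rewrite big_nil.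
case Pi : (P i); last first.
  by under eq_fun do rewrite big_cons Pi.
under eq_fun do rewrite big_cons Pi; apply: quadrD => //; exact: hF.
Qed.

Lemma affr_sum (I : Type) (s : seq I) (P : pred I) (F : I -> 'rV[R]_n -> R) :
  (forall i : I, P i -> affr (F i)) -> affr (fun x => \sum_(i <- s | P i) F i x).
Proof.
move=> hF; elim: s => [|i s IH].
  rewrite (_ : (fun x => _) = fun=> 0); first exact: affr_cst.
  by apply/funext => x; rewrite big_nil.
case Pi : (P i); last first.
  by under eq_fun do rewrite big_cons Pi.
under eq_fun do rewrite big_cons Pi; apply: affrD => //; exact: hF.
Qed.

Lemma monomial_affr (m : 'I_n -> nat) : (\sum_i m i <= 1)%N ->
  affr (fun x => \prod_i x ord0 i ^+ m i).
Proof.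
rewrite leq_eqVlt ltnS leqn0 => /orP[/eqP|/eqP] h.
  have [i [m' [h' E]]] := monomial_split h.
  rewrite (_ : (fun x => _) = fun x => x ord0 i); first exact: affr_coord.
  by apply/funext => x; rewrite E monomial0// mulr1.
rewrite (_ : (fun x => _) = fun=> 1); first exact: affr_cst.
by apply/funext => x; rewrite monomial0.
Qed.

Lemma monomial_quadr (m : 'I_n -> nat) : (\sum_i m i <= 2)%N ->
  quadr (fun x => \prod_i x ord0 i ^+ m i).
Proof.
rewrite leq_eqVlt ltnS => /orP[/eqP h|]; last by move/monomial_affr/affr_quadr.
have [i [m' [h' E]]] := monomial_split h.
rewrite (_ : (fun x => _) = fun x => x ord0 i * \prod_i x ord0 i ^+ m' i).
  by apply: quadrM; [exact: affr_coord|apply: monomial_affr; rewrite h'].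
exact/funext.
Qed.

Lemma is_P2_quadr q : is_Pk 2 q -> quadr q.
Proof.
move=> [c hc].
rewrite (_ : q = fun x => \sum_(m : {ffun 'I_n -> 'I_3} | (\sum_i m i <= 2)%N)
            c m * \prod_i x ord0 i ^+ m i); last exact/funext.
apply: quadr_sum => m hm; apply: quadrZ; exact: (monomial_quadr (m := fun i => m i)).
Qed.

Lemma is_P1_affr q : is_Pk 1 q -> affr q.
Proof.
move=> [c hc].
rewrite (_ : q = fun x => \sum_(m : {ffun 'I_n -> 'I_2} | (\sum_i m i <= 1)%N)
            c m * \prod_i x ord0 i ^+ m i); last exact/funext.
apply: affr_sum => m hm; apply: affrZ; exact: (monomial_affr (m := fun i => m i)).
Qed.

Lemma elementary_sum (I : Type) (s : seq I) (F : I -> 'rV[R]_n -> R) :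
  (forall i : I, elementary (F i)) -> elementary (fun x => \sum_(i <- s) F i x).
Proof.
move=> eF; elim: s => [|i s IH].
  rewrite (_ : (fun x => _) = fun=> 0); first exact: elementary_cst.
  by apply/funext => x; rewrite big_nil.
under eq_fun do rewrite big_cons; exact: elementaryD.
Qed.

Lemma elementary_lin (b : 'cV[R]_n) : elementary (fun x => sc (x *m b)).
Proof.
rewrite (_ : (fun x => _) = fun x => \sum_i x ord0 i * b i 0); last first.
  by apply/funext => x; rewrite /sc mxE.
apply: elementary_sum => i; apply: elementaryM; [exact: elementary_coord|exact: elementary_cst].
Qed.

Lemma elementary_quad (A : 'M[R]_n) : elementary (fun x => sc (x *m A *m x^T)).
Proof.
rewrite (_ : (fun x => _) = fun x => \sum_i (\sum_j x ord0 j * A j i) * x ord0 i); last first.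
  by apply/funext => x; rewrite /sc mxE; apply: eq_bigr => i _; rewrite !mxE.
apply: elementary_sum => i; apply: elementaryM; last exact: elementary_coord.
apply: elementary_sum => j; apply: elementaryM; [exact: elementary_coord|exact: elementary_cst].
Qed.

Lemma quadr_elementary q : quadr q -> elementary q.
Proof.
move=> [a [b [A h]]].
rewrite (_ : q = fun x => a + sc (x *m b) + sc (x *m A *m x^T)); last exact/funext.
apply: elementaryD; last exact: elementary_quad.
by apply: elementaryD; [exact: elementary_cst|exact: elementary_lin].
Qed.

(** The exact second-order expansion at [c]; the gradient contains both [A] and its transpose
    because [A] may fail to be symmetric. *)
Lemma quadr_taylor (a : R) (b : 'cV[R]_n) (A : 'M[R]_n) c z (t : R) :
  let q x := a + sc (x *m b) + sc (x *m A *m x^T) in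
  q (c + t *: z) = q c + t * sc (z *m (b + A *m c^T + A^T *m c^T)) + t ^+ 2 * sc (z *m A *m z^T).
Proof.
move=> q; rewrite /q.
have -> : (c + t *: z)^T = c^T + t *: z^T by rewrite linearD linearZ.
rewrite !(mulmxDl, mulmxDr, =^~ scalemxAl, =^~ scalemxAr) !(scD, scZ).
have -> : sc (z *m (A^T *m c^T)) = sc (c *m A *m z^T).
  by rewrite -[LHS]sc_tr !trmx_mul !trmxK.
rewrite !mulmxA; ring.
Qed.

Lemma derive_quadr (a : R) (b : 'cV[R]_n) (A : 'M[R]_n) c z :
  'D_z (fun x => a + sc (x *m b) + sc (x *m A *m x^T)) c =
  sc (z *m (b + A *m c^T + A^T *m c^T)).
Proof.
apply: cvg_lim => //.
set l := sc (z *m (b + A *m c^T + A^T *m c^T)).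
have : l + h * sc (z *m A *m z^T) @[h --> (0:R)^'] --> l + 0 * sc (z *m A *m z^T).
  apply: cvgD; first exact: cvg_cst.
  apply: cvgM; last exact: cvg_cst.
  by apply: cvg_within_filter; exact: cvg_id.
rewrite mul0r addr0; apply: cvg_trans; apply: near_eq_cvg; near=> h.
have h0 : h != 0 by near: h; exists 1 => //=.
rewrite /= [h *: z + c]addrC quadr_taylor -/l /GRing.scale/=.
by field.
Unshelve. all: by end_near || exact: dnbhs_filter.
Qed.

Lemma partial_quadr q i : quadr q -> affr (partial i q).
Proof.
move=> [a [b [A h]]].
exists (sc (delta_mx ord0 i *m b)), ((A + A^T)^T *m (delta_mx ord0 i)^T) => x.
rewrite (_ : q = fun x => a + sc (x *m b) + sc (x *m A *m x^T)); last exact/funext.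
rewrite /partial derive_quadr !mulmxDr scD scD -addrA; congr (_ + _).
rewrite -[in RHS]sc_tr -scD; congr sc.
by rewrite !trmx_mul !trmxK mulmxDr mulmxDl !mulmxA.
Qed.

Lemma partial_affr q i : affr q -> exists a : R, partial i q = fun=> a.
Proof.
move=> [a [b h]]; exists (sc (delta_mx ord0 i *m b)); apply/funext => x.
rewrite (_ : q = fun x => a + sc (x *m b) + sc (x *m 0 *m x^T)); last first.
  by apply/funext => z; rewrite h mulmx0 mul0mx [sc 0]mxE addr0.
by rewrite /partial derive_quadr trmx0 !mul0mx !addr0.
Qed.

Lemma lap_quadr q : quadr q -> exists a : R, lap q = fun=> a.
Proof.
move=> hq; have /choice[a ha] (j : 'I_n) := partial_affr j (partial_quadr j hq).
by exists (\sum_j a j); apply/funext => x; apply: eq_bigr => j _; rewrite ha.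
Qed.

End quadratic.

(** * Moments and derivatives of the bump *)

Section moments.
Variables (R : realType) (n : nat).
Implicit Types (x y c v z : 'rV[R]_n) (f g phi q : 'rV[R]_n -> R) (i j : 'I_n) (r : R).

Local Notation Phi := (@bump0 R n).
Definition bump_mass : R := \int[leb n]_x Phi x.

Lemma bump_mass_gt0 : 0 < bump_mass. Proof. exact: bump0_int_gt0. Qed.

Lemma integrable_mul_bump0 f : elementary f ->
  (leb n).-integrable setT (EFin \o (fun x => f x * Phi x)).
Proof.
move=> ef; apply: integrable_elementary_supported.
  by apply: elementaryM => //; exact: elementary_bump0.
by move=> x /bump0_supported ->; rewrite mulr0.
Qed.

(** After the substitution [x = c + r z] the linear term is odd and drops out. [K] is the second
    moment of the quadratic part; it is the same for all [c] and [r], which allows its elimination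
    between two radii. *)
Lemma bump_moment q : quadr q -> exists K, forall c r, 0 < r ->
  \int[leb n]_x (q x * rbump c r x) = r ^+ n * (bump_mass * q c + r ^+ 2 * K).
Proof.
move=> [a [b [A hq]]].
exists (\int[leb n]_x (sc (x *m A *m x^T) * Phi x)) => c r r0.
pose F z := q (c + r *: z) * Phi z.
have eL : elementary (fun z => sc (z *m (b + A *m c^T + A^T *m c^T))) by exact: elementary_lin.
have eQ := elementary_quad A.
have FE z : F z = q c * Phi z + (r * (sc (z *m (b + A *m c^T + A^T *m c^T)) * Phi z) +
    r ^+ 2 * (sc (z *m A *m z^T) * Phi z)).
  rewrite /F !hq (quadr_taylor a b A c z r); ring.
have eF : elementary F.
  rewrite (funext FE); repeat (apply: elementaryD || apply: elementaryM);
    by [exact: elementary_cst|exact: elementary_bump0|].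
have -> : \int[leb n]_x (q x * rbump c r x) = \int[leb n]_x F (r^-1 *: (x - c)).
  apply: eq_Rintegral => x _; rewrite /F /rbump scalerA mulfV ?gt_eqF// scale1r.
  by rewrite [c + _]addrC subrK.
rewrite Rintegral_rescale//; last first.
  by apply: continuous_measurable_rV; apply: C1_continuous; exact: elementary_C1.
congr (_ * _).
have i1 := integrable_elementary_supported (@elementary_bump0 R n) (@bump0_supported R n).
have i2 := integrable_mul_bump0 eL.
have i3 := integrable_mul_bump0 eQ.
rewrite (@eq_Rintegral _ _ _ _ _ _ _ (fun z _ => FE z)).
rewrite RintegralD//; [|exact: (integrableZl measurableT (q c) i1)|]; last first.
  exact: (integrableD measurableT (integrableZl measurableT r i2) (integrableZl measurableT (r ^+ 2) i3)).
rewrite RintegralD//; [|exact: (integrableZl measurableT r i2)|exact: (integrableZl measurableT (r ^+ 2) i3)].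
rewrite !RintegralZl// [X in r * X]Rintegral_odd//.
  by rewrite mulr0 add0r mulrC.
by move=> x; rewrite bump0N mulNmx -scaleN1r scZ mulN1r mulNr.
Qed.

(** Four times the mean at radius [r] minus the mean at radius [2 r] cancels the second moment and
    leaves three times the value at [c]; the bounds add up to [4 B + B]. *)
Lemma quadr_point_bound q c r B : quadr q -> 0 < r ->
  `|\int[leb n]_x (q x * rbump c r x)| <= B * r ^+ n ->
  `|\int[leb n]_x (q x * rbump c (2 * r) x)| <= B * (2 * r) ^+ n ->
  3 * bump_mass * `|q c| <= 5 * B.
Proof.
move=> hq r0; have [K hK] := bump_moment hq.
have r20 : 0 < 2 * r by rewrite mulr_gt0.
rewrite !hK// !normrM !(gtr0_norm (exprn_gt0 _ _))//.
rewrite !(mulrC B) !ler_pM2l ?exprn_gt0//.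
set a := bump_mass * q c => h1 h2.
have -> : 3 * bump_mass * `|q c| = `|3 * a|.
  by rewrite /a !normrM (gtr0_norm bump_mass_gt0) (gtr0_norm (_ : 0 < 3))// mulrA.
have -> : 3 * a = 4 * (a + r ^+ 2 * K) - (a + (2 * r) ^+ 2 * K) by ring.
apply: le_trans (ler_normB _ _) _; rewrite normrM (gtr0_norm (_ : 0 < 4))//; lra.
Qed.

Definition lin (v : 'rV[R]_n) x : R := \sum_i v ord0 i * x ord0 i.

Lemma elementary_lincomb v : elementary (lin v).
Proof.
apply: elementary_sum => i; apply: elementaryM; [exact: elementary_cst|exact: elementary_coord].
Qed.

Lemma partial_lin v j : partial j (lin v) = fun=> v ord0 j.
Proof.
apply/funext => x; rewrite /partial.
rewrite (_ : lin v = fun x => 0 + sc (x *m v^T) + sc (x *m 0 *m x^T)).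
  rewrite derive_quadr trmx0 !mul0mx !addr0 /sc mxE (bigD1 j)//= big1 ?addr0.
    by rewrite !mxE !eqxx mul1r.
  by move=> i ij; rewrite !mxE (negPf ij) andbF mul0r.
apply/funext => z; rewrite add0r mulmx0 mul0mx [sc 0]mxE addr0 /sc mxE.
by apply: eq_bigr => i _; rewrite mxE mulrC.
Qed.

Lemma lin_sqr_le v x : lin v x ^+ 2 <= nsq v * nsq x.
Proof.
have V0 := nsq_ge0 v; have [Vz|Vz] := eqVneq (nsq v) 0.
  have vz i : v ord0 i = 0.
    move/eqP: Vz; rewrite psumr_eq0; last by move=> j _; rewrite sqr_ge0.
    by move=> /allP/(_ i (mem_index_enum i)) /=; rewrite sqrf_eq0 => /eqP.
  by rewrite /lin big1 ?expr0n ?Vz ?mul0r// => i _; rewrite vz mul0r.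
have Vp : 0 < nsq v by rewrite lt0r Vz.
(* The squared length of [x] minus its projection onto [v], cleared of the denominator [nsq v]. *)
have : 0 <= \sum_i (nsq v * x ord0 i - lin v x * v ord0 i) ^+ 2.
  by apply: sumr_ge0 => i _; rewrite sqr_ge0.
rewrite (eq_bigr (fun i => nsq v ^+ 2 * x ord0 i ^+ 2 + (- (2 * nsq v * lin v x) * (v ord0 i * x ord0 i) + lin v x ^+ 2 * v ord0 i ^+ 2))); last by move=> i _; ring.
rewrite !big_split /= -!mulr_sumr -/(lin v x) -/(nsq v) -/(nsq x) => h.
have : 0 <= nsq v * (nsq v * nsq x - lin v x ^+ 2) by apply: le_trans h _; lra.
by rewrite pmulr_rge0// subr_ge0.
Qed.

Lemma partial_bump0 j x : partial j Phi x = - 2 * x ord0 j * gexp 2 (1 - nsq x).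
Proof.
have en : elementary (@nsq R n).
  have := @elementary_nsq R n 0 1; by under eq_fun do rewrite invr1 scale1r subr0.
have dn := elementary_differentiable en.
have dn1 : forall x, differentiable (fun x => 1 + -1 * nsq x) x.
  by apply: elementary_differentiable; apply: elementaryD; [exact: elementary_cst|
    apply: elementaryM => //; exact: elementary_cst].
have E : Phi = fun x => gexp 0 (1 + -1 * nsq x).
  by apply/funext => z; rewrite mulN1r.
have dc (a : R) : forall x : 'rV[R]_n, differentiable (fun=> a) x.
  by move=> z; exact: differentiable_cst.
rewrite E partial_gexp// oppr0 mul0r add0r mulN1r mulrC; congr (_ * _).
rewrite partialD//; last first.
  by apply: elementary_differentiable; apply: elementaryM => //; exact: elementary_cst.
rewrite partial_cst add0r partialM// partial_cst mul0r addr0 mulN1r.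
have -> : partial j (@nsq R n) x = 2 * x ord0 j; last by rewrite mulNr.
rewrite (_ : @nsq R n = fun x => 0 + sc (x *m 0) + sc (x *m 1%:M *m x^T)); last first.
  apply/funext => z; rewrite mulmx0 [sc 0]mxE !add0r mulmx1 /sc mxE.
  by apply: eq_bigr => i _; rewrite mxE expr2.
rewrite /partial derive_quadr trmx1 !mul1mx add0r mulmxDr scD.
have -> : sc (delta_mx 0 j *m x^T) = x ord0 j.
  rewrite /sc mxE (bigD1 j)//= big1 ?addr0; first by rewrite !mxE !eqxx mul1r.
  by move=> i ij; rewrite !mxE (negPf ij) andbF mul0r.
ring.
Qed.

Definition lap_mass : R := \int[leb n]_x `|lap Phi x|.

Lemma elementary_lap f : elementary f -> elementary (lap f).
Proof. by move=> ef; apply: elementary_sum => j; do 2 apply: elementary_partial. Qed.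

Lemma supported_lap K f : compact K -> supported K f -> supported K (lap f).
Proof.
move=> cK sf x nK; rewrite /lap big1// => j _.
by apply: (supported_partial j cK) => //; exact: supported_partial.
Qed.

End moments.

(** * The Laplacian of the bump against the absolute value of a linear form *)

Section abs_laplacian.
Variables (R : realType) (n : nat).
Implicit Types (x y c v z : 'rV[R]_n) (f g phi q : 'rV[R]_n -> R) (i j : 'I_n) (r : R).

Local Notation Phi := (@bump0 R n).

Section smoothed_abs.
Variables (v : 'rV[R]_n) (e : R).
Hypothesis e0 : 0 < e.

(* |l| is not differentiable; Green's formula is applied to this approximation. *)
Definition smooth_abs x := Num.sqrt (lin v x * lin v x + e ^+ 2).

Let sq_gt0 x : 0 < lin v x * lin v x + e ^+ 2.
Proof. by rewrite ltr_wpDl ?exprn_gt0// -expr2 sqr_ge0. Qed.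

Lemma smooth_abs_gt0 x : 0 < smooth_abs x. Proof. by rewrite sqrtr_gt0. Qed.

Lemma partial_smooth_abs j :
  partial j smooth_abs = fun x => v ord0 j * lin v x * (smooth_abs x)^-1.
Proof.
have el := elementary_lincomb v.
have esq : elementary (fun x => lin v x * lin v x + e ^+ 2).
  by apply: elementaryD; [exact: elementaryM|exact: elementary_cst].
have dl := elementary_differentiable el.
have dsq := elementary_differentiable esq.
apply/funext => x; rewrite /partial derive_comp_real//; last first.
  by have [] := is_derive1_sqrt (sq_gt0 x).
rewrite derive_sqrt// -/(smooth_abs x) -[X in _ * X]/(partial j (fun x => lin v x * lin v x + e ^+ 2) x).
rewrite partialD; [|exact: elementary_differentiable (elementaryM el el)
  |by move=> z; exact: differentiable_cst].
rewrite partial_cst addr0 partialM// partial_lin.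
by field; rewrite gt_eqF// smooth_abs_gt0.
Qed.

Lemma C1_smooth_abs : C1 smooth_abs.
Proof.
have el := elementary_lincomb v.
have esq : elementary (fun x => lin v x * lin v x + e ^+ 2).
  by apply: elementaryD; [exact: elementaryM|exact: elementary_cst].
have dsmooth x : differentiable smooth_abs x.
  apply: differentiable_comp_real; first exact: elementary_differentiable.
  by have [] := is_derive1_sqrt (sq_gt0 x).
have cs : continuous smooth_abs by move=> x; exact: differentiable_continuous.
split=> // j; rewrite partial_smooth_abs; apply: continuous_mul.
  have : elementary (fun x => v ord0 j * lin v x).
    by apply: elementaryM => //; exact: elementary_cst.
  by move=> /elementary_C1 /C1_continuous.
move=> x; apply: continuousV; last exact: cs.
by rewrite gt_eqF// smooth_abs_gt0.
Qed.

Lemma smooth_abs_near x : 0 <= smooth_abs x - `|lin v x| <= e.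
Proof.
have h : smooth_abs x ^+ 2 = `|lin v x| ^+ 2 + e ^+ 2.
  by rewrite sqr_sqrtr ?ltW// real_normK ?num_real// expr2.
have s0 := smooth_abs_gt0 x; have l0 := normr_ge0 (lin v x).
have e0' := ltW e0; apply/andP; split.
  by rewrite subr_ge0 -ler_sqr ?nnegrE ?(ltW s0)// h lerDl sqr_ge0.
rewrite lerBlDl -ler_sqr ?nnegrE ?addr_ge0 ?(ltW s0)// h sqrrD.
have := mulr_ge0 l0 e0'; lra.
Qed.

End smoothed_abs.

Lemma sum_partial_bump0 v x :
  \sum_j v ord0 j * partial j Phi x = - 2 * lin v x * gexp 2 (1 - nsq x).
Proof.
rewrite /lin mulr_sumr mulr_suml; apply: eq_bigr => j _.
by rewrite partial_bump0; ring.
Qed.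

(** Integrating [l d_v Phi] by parts in the unit direction [v] gives minus the mass of the bump, and
    [d_v Phi] equals [- 2 l] times the factor [gexp 2 (1 - nsq x)]. *)
Lemma Rintegral_lin_partial v : nsq v = 1 ->
  \int[leb n]_x (lin v x ^+ 2 * gexp 2 (1 - nsq x)) = bump_mass R n / 2.
Proof.
move=> v1; have el := elementary_lincomb v.
have eb := @elementary_bump0 R n.
have cU := @compact_unit_ball R n.
have sU := @bump0_supported R n.
have ij j : (leb n).-integrable setT (EFin \o (fun x => v ord0 j * (lin v x * partial j Phi x))).
  apply: integrable_elementary_supported.
    apply: elementaryM; first exact: elementary_cst.
    by apply: elementaryM => //; exact: elementary_partial.
  by move=> x nU; rewrite (supported_partial j cU sU)// !mulr0.
have ij' j : (leb n).-integrable setT (EFin \o (fun x => lin v x * partial j Phi x)).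
  apply: integrable_elementary_supported.
    by apply: elementaryM => //; exact: elementary_partial.
  by move=> x nU; rewrite (supported_partial j cU sU)// !mulr0.
have : \int[leb n]_x (\sum_j v ord0 j * (lin v x * partial j Phi x)) = - bump_mass R n.
  rewrite (Rintegral_sum openT _ ij).2.
  rewrite (eq_bigr (fun j => - (bump_mass R n) * v ord0 j ^+ 2)).
    by rewrite -mulr_sumr -/(nsq v) v1 mulr1.
  move=> j _; rewrite RintegralZl//.
  rewrite (Rintegral_parts j (elementary_C1 el) (elementary_C1 eb) cU sU).
  rewrite partial_lin RintegralZl//; last exact: integrable_elementary_supported.
  by rewrite /bump_mass; ring.
rewrite (@eq_Rintegral _ _ _ _ _ (fun x => -2 * (lin v x ^+ 2 * gexp 2 (1 - nsq x)))); last first.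
  move=> x _; rewrite (eq_bigr (fun j => lin v x * (v ord0 j * partial j Phi x))).
    by rewrite -mulr_sumr sum_partial_bump0; ring.
  by move=> j _; ring.
rewrite RintegralZl//; first by lra.
apply: integrable_elementary_supported.
  apply: elementaryM; first by rewrite /= ; exact: (elementaryM el el).
  have := elementary_bump_gen 2 (0 : 'rV[R]_n) 1.
  by under eq_fun do rewrite invr1 scale1r subr0.
move=> x /negP; rewrite /= -ltNge subr0 => x1.
rewrite gexp_le0 ?mulr0// subr_le0 -sqr_enorm.
by rewrite -(expr1n _ 2) lerXn2r ?nnegrE ?enorm_ge0// ltW.
Qed.

(** In the sense of distributions the Laplacian of [|l|] is twice the surface measure of the
    hyperplane [l = 0], whence positivity. Quantitatively, the smoothed modulus contributes at least
    half the mass, and replacing it by [|l|] costs at most a quarter. *)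
Lemma abs_lap_lower v : nsq v = 1 ->
  bump_mass R n / 4 <= \int[leb n]_x (`|lin v x| * lap Phi x).
Proof.
move=> v1; have el := elementary_lincomb v.
have eb := @elementary_bump0 R n.
have cU := @compact_unit_ball R n.
have sU := @bump0_supported R n.
have mass0 := @bump_mass_gt0 R n.
have elap := elementary_lap eb.
have slap := supported_lap cU sU.
have ilap : (leb n).-integrable setT (EFin \o (lap Phi)) by exact: integrable_elementary_supported.
have L0 : 0 <= lap_mass R n by apply: Rintegral_ge0.
(* The second bound makes the smoothing error [e * lap_mass] at most a quarter of the mass; [e <= 1]
   keeps the smoothed modulus below 2 on the unit ball. *)
pose e := Num.min 1 (bump_mass R n / (4 * (lap_mass R n + 1))).
have L1 : 0 < 4 * (lap_mass R n + 1) by rewrite mulr_gt0// ltr_wpDl.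
have e0 : 0 < e by rewrite lt_min ltr01 divr_gt0.
have e1 : e <= 1 by rewrite ge_min lexx.
have eL : e * lap_mass R n <= bump_mass R n / 4.
  have : e * (4 * (lap_mass R n + 1)) <= bump_mass R n.
    by rewrite -ler_pdivlMr// ge_min lexx orbT.
  nra.
pose b := smooth_abs v e.
have cb : C1 b by exact: C1_smooth_abs.
have ccont := C1_continuous cb.
have clap : continuous (lap Phi) by exact/C1_continuous/elementary_C1.
have clin : continuous (fun x => `|lin v x|).
  move=> x; apply: (@continuous_comp _ _ _ (lin v) (@Num.norm R R)); last exact: norm_continuous.
  exact: (C1_continuous (elementary_C1 el)).
have isup f : continuous f -> supported (@unit_ball R n) f -> (leb n).-integrable setT (EFin \o f).
  by move=> cf sf; exact: (integrable_supported cU).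
have part_sup j := supported_partial j cU sU.
have c_p j : continuous (partial j Phi) by exact/C1_continuous/elementary_C1/elementary_partial.
have c_pp j : continuous (partial j (partial j Phi)).
  by apply/C1_continuous/elementary_C1; do 2 apply: elementary_partial.
(* One integration by parts: both gradients are explicit, and their product is the nonnegative
   function on the right, up to sign. *)
have I1 : \int[leb n]_x (b x * lap Phi x) =
    \int[leb n]_x (2 * (lin v x ^+ 2 * gexp 2 (1 - nsq x)) / b x).
  rewrite (@eq_Rintegral _ _ _ _ _ (fun x => \sum_j b x * partial j (partial j Phi) x)); last first.
    by move=> x _; rewrite mulr_sumr.
  rewrite (Rintegral_sum openT _ _).2; last first.
    move=> j; apply: isup; first exact: continuous_mul.
    by move=> x nU; rewrite (supported_partial j cU)// mulr0.
  rewrite (eq_bigr (fun j => \int[leb n]_x (-1 * (partial j b x * partial j Phi x)))).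
    rewrite -(Rintegral_sum openT _ _).2.
      apply: eq_Rintegral => x _.
      rewrite (eq_bigr (fun j => - (lin v x) / b x * (v ord0 j * partial j Phi x))).
        by rewrite -mulr_sumr sum_partial_bump0; ring.
      by move=> j _; rewrite /b partial_smooth_abs//; ring.
    move=> j; apply: isup.
      apply: continuous_mul; first exact: cst_continuous.
      by apply: continuous_mul => //; exact: cb.2.
    by move=> x nU; rewrite part_sup// !mulr0.
  move=> j _.
  have isj : (leb n).-integrable setT (EFin \o (fun x => partial j b x * partial j Phi x)).
    apply: isup; first by apply: continuous_mul => //; exact: cb.2.
    by move=> x nU; rewrite part_sup// mulr0.
  rewrite (Rintegral_parts j cb (elementary_C1 (elementary_partial j eb)) cU (part_sup j)).
  by rewrite (RintegralZl (-1) measurableT isj) mulN1r.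
have sD x : ~ unit_ball x -> gexp 2 (1 - nsq x) = 0.
  move=> /negP; rewrite /= -ltNge subr0 => x1.
  rewrite gexp_le0// subr_le0 -sqr_enorm.
  by rewrite -(expr1n _ 2) lerXn2r ?nnegrE ?enorm_ge0// ltW.
have eD : elementary (fun x : 'rV[R]_n => gexp 2 (1 - nsq x)).
  have := elementary_bump_gen 2 (0 : 'rV[R]_n) 1.
  by under eq_fun do rewrite invr1 scale1r subr0.
have I2 : bump_mass R n / 2 <= \int[leb n]_x (b x * lap Phi x).
  rewrite I1 -(Rintegral_lin_partial v1); apply: le_Rintegral => //.
  - apply: integrable_elementary_supported; last by move=> x /sD ->; rewrite mulr0.
    by apply: elementaryM => //; exact: (elementaryM el el).
  - apply: isup; last by move=> x /sD ->; rewrite !mulr0 mul0r.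
    apply: continuous_mul.
      apply: C1_continuous; apply: elementary_C1.
      apply: elementaryM; first exact: elementary_cst.
      by apply: elementaryM => //; exact: (elementaryM el el).
    move=> x; apply: continuousV; last exact: ccont.
    by rewrite gt_eqF// smooth_abs_gt0.
  move=> x _; have [x1|x1] := pselect (unit_ball x); last by rewrite sD// !mulr0 mul0r.
  have b0 : 0 < b x by rewrite smooth_abs_gt0.
  (* Hence [2 / b >= 1], and the integrand dominates the one of [Rintegral_lin_partial]. *)
  have b2 : b x <= 2.
    have nx : nsq x <= 1.
      move: x1; rewrite /unit_ball /eball /= subr0 => x1.
      by rewrite -sqr_enorm expr_le1// enorm_ge0.
    have lx := lin_sqr_le v x; rewrite v1 mul1r in lx.
    have : b x ^+ 2 <= 2 ^+ 2.
      rewrite sqr_sqrtr; last by rewrite addr_ge0 ?sqr_ge0// -expr2 sqr_ge0.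
      nra.
    by rewrite ler_sqr ?nnegrE// ltW.
  set t := lin v x ^+ 2 * _.
  have t0 : 0 <= t by rewrite mulr_ge0 ?sqr_ge0 ?gexp_ge0.
  by rewrite ler_pdivlMr// mulrC ler_wpM2r.
have I3 : \int[leb n]_x (b x * lap Phi x) - \int[leb n]_x (`|lin v x| * lap Phi x)
   <= e * lap_mass R n.
  rewrite -RintegralB//.
  - rewrite /lap_mass -RintegralZl//; last exact: integrable_norm ilap.
    apply: le_Rintegral => //.
    + apply: isup; last by move=> x nU; rewrite slap// !mulr0 subrr.
      have -> : (fun x => b x * lap Phi x - `|lin v x| * lap Phi x) =
        (fun x => b x * lap Phi x + (-1 * `|lin v x|) * lap Phi x).
        by apply/funext => x; rewrite mulN1r mulNr.
      apply: continuous_add; apply: continuous_mul => //.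
      by apply: continuous_mul => //; exact: cst_continuous.
    + exact: (integrableZl measurableT e (integrable_norm ilap)).
    move=> x _; rewrite -mulrBl.
    have /andP[h1 h2] := smooth_abs_near v e0 x.
    apply: le_trans (ler_norm _) _; rewrite normrM ler_wpM2r//.
    by rewrite ger0_norm.
  - by apply: isup; [exact: continuous_mul|move=> x nU; rewrite slap// mulr0].
  - by apply: isup; [exact: continuous_mul|move=> x nU; rewrite slap// mulr0].
lra.
Qed.

End abs_laplacian.

(** * Simplices and conforming meshes *)

Section lin_facts.
Variables (R : realType) (n : nat).
Implicit Types (x y v z : 'rV[R]_n) (r : R).

Lemma linD v x y : lin v (x + y) = lin v x + lin v y.
Proof. by rewrite -big_split; apply: eq_bigr => i _; rewrite mxE mulrDr. Qed.

Lemma linZ v r x : lin v (r *: x) = r * lin v x.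
Proof. by rewrite mulr_sumr; apply: eq_bigr => i _; rewrite mxE mulrCA. Qed.

Lemma linN v x : lin v (- x) = - lin v x.
Proof. by rewrite -scaleN1r linZ mulN1r. Qed.

Lemma linB v x y : lin v (x - y) = lin v x - lin v y.
Proof. by rewrite linD linN. Qed.

Lemma lin_nsq v : lin v v = nsq v.
Proof. by apply: eq_bigr => i _; rewrite expr2. Qed.

Lemma lin_dot v x : lin v x = dot x v.
Proof. by apply: eq_bigr => i _; rewrite mulrC. Qed.

Lemma linZl r v x : lin (r *: v) x = r * lin v x.
Proof. by rewrite mulr_sumr; apply: eq_bigr => i _; rewrite mxE mulrA. Qed.

Lemma lin_suml (I : Type) (s : seq I) (v : I -> 'rV[R]_n) x :
  lin (\sum_(i <- s) v i) x = \sum_(i <- s) lin (v i) x.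
Proof.
rewrite /lin exchange_big /=; apply: eq_bigr => j _.
by rewrite summxE mulr_suml.
Qed.

Lemma lin_mul (A : 'cV[R]_n) x : lin A^T x = (x *m A) 0 0.
Proof. by rewrite /lin mxE; apply: eq_bigr => i _; rewrite mxE mulrC. Qed.

Lemma lin_norm_le v x : `|lin v x| <= enorm v * enorm x.
Proof.
rewrite -ler_sqr ?nnegrE// ?mulr_ge0 ?enorm_ge0//.
by rewrite real_normK ?num_real// exprMn !sqr_enorm lin_sqr_le.
Qed.

Lemma enorm_eq0 v : (enorm v == 0) = (v == 0).
Proof.
apply/idP/idP => [h|/eqP ->].
  apply/eqP/rowP => i; rewrite mxE; apply/eqP; rewrite -normr_le0.
  by apply: le_trans (enorm_coord v i) _; rewrite (eqP h).
by rewrite enormE /nsq big1 ?sqrtr0// => i _; rewrite mxE expr0n.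
Qed.

Lemma enorm_gt0 v : (0 < enorm v) = (v != 0).
Proof. by rewrite lt0r enorm_ge0 andbT enorm_eq0. Qed.

Lemma enormN v : enorm (- v) = enorm v.
Proof. by rewrite enormE nsqN. Qed.

Lemma enormD x y : enorm (x + y) <= enorm x + enorm y.
Proof.
rewrite -ler_sqr ?nnegrE ?addr_ge0 ?enorm_ge0// sqrrD !sqr_enorm.
have -> : nsq (x + y) = nsq x + lin x y *+ 2 + nsq y.
  by rewrite /nsq /lin mulr2n -!big_split; apply: eq_bigr => i _; rewrite !mxE /=; ring.
rewrite lerD2r lerD2l lerMn2r /=.
exact: le_trans (ler_norm _) (lin_norm_le x y).
Qed.

End lin_facts.

(** * Barycentric coordinates *)

Section barycentric.
Variables (R : realType) (n : nat).
Local Notation pt := 'rV[R]_n.+1.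
Implicit Types (T : simplex R n) (x y z c : pt) (k : 'I_n.+2).

(** The gradient of the [k]-th barycentric coordinate: a column of the inverse edge matrix, or minus
    the sum of all columns for vertex 0, because the coordinates sum to 1. *)
Definition bgrad T k : pt :=
  if unlift ord0 k is Some i then (col i (invmx (edges T)))^T
  else - \sum_i (col i (invmx (edges T)))^T.

(** An affine function on the whole space, so that it can also be evaluated across a side, in the
    neighbouring simplex. *)
Definition bary T k x : R := (k == ord0)%:R + lin (bgrad T k) (x - row ord0 T).

Lemma baryB T k x y : bary T k y - bary T k x = lin (bgrad T k) (y - x).
Proof. by rewrite /bary !linB; ring. Qed.

Lemma bary_line T k x z (t : R) :
  bary T k (x + t *: z) = bary T k x + t * lin (bgrad T k) z.
Proof.
have -> : t * lin (bgrad T k) z = bary T k (x + t *: z) - bary T k x.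
  by rewrite baryB addrAC subrr add0r linZ.
ring.
Qed.

Lemma bary_sum T x : \sum_k bary T k x = 1.
Proof.
rewrite big_split /= big_ord_recl big1 ?addr0// -[RHS]addr0; congr (_ + _).
rewrite -lin_suml big_ord_recl /bgrad unlift_none.
under [X in _ + X]eq_bigr do rewrite liftK.
by rewrite addNr /lin big1// => i _; rewrite mxE mul0r.
Qed.

Lemma comb_edges T (c : 'rV[R]_n.+2) : \sum_k c ord0 k = 1 ->
  c *m T - row ord0 T = (\row_i c ord0 (lift ord0 i)) *m edges T.
Proof.
move=> c1; apply/rowP => j; rewrite !mxE.
rewrite -[X in _ - X]mul1r -c1 mulr_suml -sumrB big_ord_recl subrr add0r.
by apply: eq_bigr => i _; rewrite !mxE mulrBr.
Qed.

Lemma bary_comb T (c : 'rV[R]_n.+2) : nondegenerate T -> \sum_k c ord0 k = 1 ->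
  forall k, bary T k (c *m T) = c ord0 k.
Proof.
move=> nT c1.
have H i : bary T (lift ord0 i) (c *m T) = c ord0 (lift ord0 i).
  rewrite /bary add0r /bgrad liftK lin_mul comb_edges//.
  by rewrite colE mulmxA -(mulmxA _ (edges T)) mulmxV// mulmx1 -colE !mxE.
move=> k; case: (unliftP ord0 k) => [i ->|->]; first exact: H.
have h := bary_sum T (c *m T); have h' := c1.
rewrite big_ord_recl in h; rewrite big_ord_recl in h'.
have E : \sum_(i < n.+1) bary T (lift ord0 i) (c *m T) = \sum_(i < n.+1) c ord0 (lift ord0 i).
  by apply: eq_bigr => i _; exact: H.
by apply: (addIr (\sum_(i < n.+1) c ord0 (lift ord0 i))); rewrite -{1}E; exact: etrans h (esym h').
Qed.

Lemma bary_mul T x : nondegenerate T -> (\row_k bary T k x) *m T = x.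
Proof.
move=> nT; pose c : 'rV[R]_n.+2 := \row_k bary T k x.
have c1 : \sum_k c ord0 k = 1 by rewrite -[RHS](bary_sum T x); apply: eq_bigr => k _; rewrite mxE.
apply/eqP; rewrite -(subr_eq0 _ x); apply/eqP.
have -> : c *m T - x = (c *m T - row ord0 T) - (x - row ord0 T).
  by rewrite opprB addrA subrK.
rewrite comb_edges//; apply/eqP; rewrite subr_eq0; apply/eqP.
rewrite -[RHS]mulmx1 -(mulVmx nT) mulmxA; congr (_ *m _).
apply/rowP => i; rewrite !mxE /bary add0r /bgrad liftK /lin.
by apply: eq_bigr => j _; rewrite !mxE mulrC.
Qed.

Lemma chullP T x : nondegenerate T -> chull T x <-> forall k, 0 <= bary T k x.
Proof.
move=> nT; split.
  by move=> [c [c0 c1 ->]] k; rewrite bary_comb.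
move=> h; exists (\row_k bary T k x); split; first by move=> k; rewrite mxE.
  by rewrite -[RHS](bary_sum T x); apply: eq_bigr => k _; rewrite mxE.
by rewrite bary_mul.
Qed.

Lemma row_comb T k : row k T = delta_mx 0 k *m T.
Proof. exact: rowE. Qed.

Lemma bary_row T k l : nondegenerate T -> bary T k (row l T) = (k == l)%:R.
Proof.
move=> nT; rewrite row_comb bary_comb//; first by rewrite mxE eqxx.
rewrite (bigD1 l)//= big1 ?addr0; first by rewrite mxE !eqxx.
by move=> i il; rewrite mxE (negPf il) andbF.
Qed.

Lemma chull_row T k : nondegenerate T -> chull T (row k T).
Proof. by move=> nT; apply/chullP => // l; rewrite bary_row// ler0n. Qed.

Lemma chull_side T i x : nondegenerate T ->
  chull (side T i) x <-> bary T i x = 0 /\ forall k, 0 <= bary T k x.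
Proof.
move=> nT; split.
  move=> [c [c0 c1 ->]].
  pose c' : 'rV[R]_n.+2 := \row_k if unlift i k is Some l then c ord0 l else 0.
  have c'i : c' ord0 i = 0 by rewrite mxE unlift_none.
  have c'l l : c' ord0 (lift i l) = c ord0 l by rewrite mxE liftK.
  have bigi (F : 'I_n.+2 -> R) : \sum_k F k = F i + \sum_l F (lift i l).
    rewrite (bigD1 i)//=; congr (_ + _).
    rewrite (reindex_omap (lift i) (unlift i)) /=.
      by apply: eq_bigl => l; rewrite liftK eqxx andbT eq_sym neq_lift.
    by move=> k; case: unliftP => [l ->|->]; rewrite ?eqxx.
  have E : c *m side T i = c' *m T.
    apply/rowP => j; rewrite !mxE bigi c'i mul0r add0r.
    by apply: eq_bigr => l _; rewrite c'l !mxE.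
  have s1 : \sum_k c' ord0 k = 1.
    by rewrite bigi c'i add0r -c1; apply: eq_bigr => l _; rewrite c'l.
  rewrite E; split; first by rewrite bary_comb.
  by move=> k; rewrite bary_comb//; case: (unliftP i k) => [l ->|->]; rewrite ?c'l ?c'i.
move=> [xi x0]; exists (\row_l bary T (lift i l) x).
have bigi (F : 'I_n.+2 -> R) : \sum_k F k = F i + \sum_l F (lift i l).
  rewrite (bigD1 i)//=; congr (_ + _).
  rewrite (reindex_omap (lift i) (unlift i)) /=.
    by apply: eq_bigl => l; rewrite liftK eqxx andbT eq_sym neq_lift.
  by move=> k; case: unliftP => [l ->|->]; rewrite ?eqxx.
split; first by move=> l; rewrite mxE.
  have := bary_sum T x; rewrite bigi xi add0r => <-.
  by apply: eq_bigr => l _; rewrite mxE.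
rewrite -[LHS](bary_mul x nT); apply/rowP => j; rewrite !mxE bigi !mxE xi mul0r add0r.
by apply: eq_bigr => l _; rewrite !mxE.
Qed.

Lemma affine_bary (f : pt -> R) T x : nondegenerate T -> affr f ->
  f x = \sum_k bary T k x * f (row k T).
Proof.
move=> nT [a [b h]].
rewrite (eq_bigr (fun k => bary T k x * a + bary T k x * sc (row k T *m b))); last first.
  by move=> k _; rewrite h mulrDr.
rewrite big_split /= -mulr_suml bary_sum mul1r h; congr (_ + _).
rewrite -{1}(bary_mul x nT) -mulmxA /sc mxE.
apply: eq_bigr => k _; rewrite mxE; congr (_ * _).
by rewrite !mxE; apply: eq_bigr => j _; rewrite !mxE.
Qed.

Lemma affr_bary T k : affr (bary T k).
Proof.
exists ((k == ord0)%:R - lin (bgrad T k) (row ord0 T)), (bgrad T k)^T => x.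
by rewrite /bary linB /sc -lin_mul trmxK; ring.
Qed.

Lemma bary_bound T k x : nondegenerate T -> chull T x -> 0 <= bary T k x <= 1.
Proof.
move=> nT /chullP h; rewrite h//=.
rewrite -(bary_sum T x) (bigD1 k)//= lerDl; apply: sumr_ge0 => l _; exact: h.
Qed.

(** Along the diameter of the ball parallel to the gradient, of length [2 rho], the coordinate stays
    between 0 and 1. *)
Lemma bgrad_bound T k x0 (rho : R) : nondegenerate T -> 0 < rho ->
  eball x0 rho `<=` chull T -> 2 * rho * enorm (bgrad T k) <= 1.
Proof.
move=> nT rho0 sub; set g := bgrad T k.
have [->|g0] := eqVneq (enorm g) 0; first by rewrite mulr0.
have gp : 0 < enorm g by rewrite lt0r g0 enorm_ge0.
pose t := rho / enorm g.
have t0 : 0 < t by rewrite divr_gt0.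
have tg : t * enorm g = rho by rewrite divfK.
have h1 : chull T (x0 + t *: g).
  by apply: sub; rewrite /eball/= addrC addKr enormZ (gtr0_norm t0) tg.
have h2 : chull T (x0 + (- t) *: g).
  by apply: sub; rewrite /eball/= addrC addKr enormZ normrN (gtr0_norm t0) tg.
have /andP[_ b1] := bary_bound k nT h1.
have /andP[b2 _] := bary_bound k nT h2.
move: b1 b2; rewrite !bary_line -/g lin_nsq -sqr_enorm expr2 mulrA tg mulNr !mulrA tg.
by lra.
Qed.

Lemma bgrad_neq0 T k : nondegenerate T -> (0 < n)%N -> bgrad T k != 0.
Proof.
move=> nT _; apply/eqP => g0.
have [l kl] : exists l, l != k.
  by exists (lift k ord0); rewrite eq_sym neq_lift.
have := baryB T k (row l T) (row k T).
rewrite !bary_row// eqxx eq_sym (negPf kl) subr0 g0 /lin big1; first by move/eqP; rewrite oner_eq0.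
by move=> i _; rewrite mxE mul0r.
Qed.

End barycentric.

(** * Neighbouring simplices, normals, and balls in the domain *)

Section mesh_geometry.
Variables (R : realType) (n : nat).
Local Notation pt := 'rV[R]_n.+1.
Implicit Types (T : simplex R n) (x y z c : pt) (k i j : 'I_n.+2).

Lemma subfaceE T (I : {set 'I_n.+2}) x : nondegenerate T -> subface T I x ->
  forall k, k \notin I -> bary T k x = 0.
Proof. by move=> nT [c [c0 c1 cI ->]] k kI; rewrite bary_comb// cI. Qed.

Lemma conforming_interior (A : set pt) (M : mesh R n) T T' x :
  conforming_mesh A M -> T \in M -> T' \in M ->
  (forall k, 0 < bary T k x) -> (forall k, 0 < bary T' k x) -> T = T'.
Proof.
move=> [nd _ cf] TM TM' xT xT'; apply/eqP/negPn/negP => TT'.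
have [hT [I [J [EI EJ]]]] := cf T T' TM TM' TT'.
have nT := nd _ TM; have nT' := nd _ TM'.
have xx : (chull T `&` chull T') x.
  by split; apply/chullP => // k; exact: ltW.
have full S (K : {set 'I_n.+2}) : nondegenerate S -> (forall k, 0 < bary S k x) -> subface S K x ->
    forall y, chull S y -> subface S K y.
  move=> nS xS sx y [c [c0 c1 ->]]; exists c; split => // k kK.
  by have := subfaceE nS sx kK => h; have := xS k; rewrite h ltxx.
apply: hT; apply/seteqP; split => y hy.
  have : (chull T `&` chull T') y.
    by rewrite EI; apply: full => //; rewrite -EI.
  by case.
have : (chull T `&` chull T') y.
  by rewrite EJ; apply: full => //; rewrite -EJ.
by case.
Qed.

(** Points of a side at a definite barycentric distance from the other sides; around them a ball of
    proportional radius is covered by [T] and its neighbour. *)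
Definition inner_side T i (th : R) c :=
  bary T i c = 0 /\ forall k, k != i -> th <= bary T k c.

Lemma inner_side_chull T i th c : nondegenerate T -> 0 <= th -> inner_side T i th c ->
  chull (side T i) c.
Proof.
move=> nT th0 [ci ck]; apply/chull_side => //; split => // k.
by have [->|/ck] := eqVneq k i; [rewrite ci|exact: le_trans].
Qed.

Lemma side_vertex T i k : nondegenerate T -> k != i -> chull (side T i) (row k T).
Proof.
move=> nT ki; apply/chull_side => //; rewrite bary_row// eq_sym (negPf ki).
by split => // l; rewrite bary_row// ler0n.
Qed.

Section shared.
Variables (T T' : simplex R n) (i j : 'I_n.+2).
Hypotheses (nT : nondegenerate T) (nT' : nondegenerate T').
Hypothesis hS : chull (side T i) = chull (side T' j).

(** The point obtained by moving from [c] away from vertex [k] of [T'] by the fraction [th] is still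
    in the side. Its [k]-th coordinate in [T'] is [(1 + th) b - th >= 0], hence
    [b >= th / (1 + th) >= th / 2]. *)
Lemma inner_side_shared th c : 0 < th <= 1 -> inner_side T i th c ->
  inner_side T' j (th / 2) c.
Proof.
move=> /andP[th0 th1] hc; have [ci ck] := hc.
have cS : chull (side T' j) c by rewrite -hS; apply: inner_side_chull hc => //; exact: ltW.
have [cj _] := (chull_side j c nT').1 cS.
split => // k kj.
have vS : chull (side T i) (row k T') by rewrite hS; exact: side_vertex.
have [vi v0] := (chull_side i _ nT).1 vS.
have v1 l : bary T l (row k T') <= 1.
  by have /andP[] := bary_bound l nT ((chullP _ nT).2 v0).
pose y := c + (- th) *: (row k T' - c).
have yE l : bary T l y = (1 + th) * bary T l c - th * bary T l (row k T').
  by rewrite /y bary_line -baryB; ring.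
have yE' l : bary T' l y = (1 + th) * bary T' l c - th * bary T' l (row k T').
  by rewrite /y bary_line -baryB; ring.
have yS : chull (side T i) y.
  apply/chull_side => //; rewrite yE ci vi !mulr0 subrr; split => // l.
  rewrite yE; have [->|li] := eqVneq l i; first by rewrite ci vi !mulr0 subrr.
  have := ck l li; have := v1 l; nra.
rewrite hS in yS; have [_ /(_ k)] := (chull_side j y nT').1 yS.
rewrite yE' bary_row// eqxx mulr1 => h; nra.
Qed.

(** Both coordinates are affine and vanish at the vertices of the common side, so they are
    proportional. *)
Lemma bary_shared : exists kappa, kappa != 0 /\ forall x, bary T' j x = kappa * bary T i x.
Proof.
exists (bary T' j (row i T)).
have E x : bary T' j x = bary T' j (row i T) * bary T i x.
  rewrite (affine_bary x nT (affr_bary T' j)) (bigD1 i)//= big1 ?addr0; first by rewrite mulrC.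
  move=> k ki; have := side_vertex nT ki; rewrite hS => /(chull_side j _ nT').1[-> _].
  by rewrite mulr0.
split => //; apply/eqP => h; have := E (row j T').
by rewrite h mul0r bary_row// eqxx => /eqP; rewrite oner_eq0.
Qed.

(* Moving from c towards the apex of T stays inside T, and inside T' as well
   when both simplices lie on the same side of their common face. *)
Lemma shared_opposite (A : set pt) (M : mesh R n) th c : 0 < th <= 1 -> inner_side T i th c ->
  conforming_mesh A M -> T \in M -> T' \in M -> T' != T ->
  exists2 kappa, kappa < 0 & forall x, bary T' j x = kappa * bary T i x.
Proof.
move=> th01 hc cM TM TM' TT'; have [kappa [k0 kE]] := bary_shared.
exists kappa => //; rewrite ltNge; apply/negP => kge.
have kp : 0 < kappa by rewrite lt0r k0.
have hc' := inner_side_shared th01 hc.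
have [ci ck] := hc; have [cj ck'] := hc'; have /andP[th0 th1] := th01.
pose m := \sum_k (`|bary T k (row i T) - bary T k c| + `|bary T' k (row i T) - bary T' k c|).
have m0 : 0 <= m by apply: sumr_ge0 => k _; rewrite addr_ge0.
(* [m] bounds the variation of all coordinates from [c] to the apex, so at the fraction [t] of this
   segment they change by at most [th / 4] and those starting above [th / 2] remain positive. *)
pose t := th / 4 / (1 + m).
have m1 : 0 < 1 + m by lra.
have t0 : 0 < t by rewrite !divr_gt0.
have tm : t * m <= th / 4.
  have : t * (1 + m) = th / 4 by rewrite /t divfK// gt_eqF.
  by nra.
have mk k : `|bary T k (row i T) - bary T k c| <= m /\ `|bary T' k (row i T) - bary T' k c| <= m.
  rewrite /m (bigD1 k)//=.
  have : 0 <= \sum_(l | l != k) (`|bary T l (row i T) - bary T l c| + `|bary T' l (row i T) - bary T' l c|).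
    by apply: sumr_ge0 => l _; rewrite addr_ge0.
  have := normr_ge0 (bary T k (row i T) - bary T k c).
  have := normr_ge0 (bary T' k (row i T) - bary T' k c).
  by move=> ? ? ?; split; lra.
pose x := c + t *: (row i T - c).
have tb (a b : R) : `|a| <= m -> th / 2 <= b -> 0 < b + t * a.
  move=> am bt; have : - m <= a by move: am; rewrite ler_norml => /andP[].
  move=> am'; have : t * - m <= t * a by rewrite ler_pM2l.
  lra.
have xi : bary T i x = t.
  by rewrite /x bary_line -baryB bary_row// eqxx ci subr0 add0r mulr1.
have TE : T = T'.
  apply: (conforming_interior cM TM TM' (x := x)) => k.
  - have [->|ki] := eqVneq k i; first by rewrite xi.
    rewrite /x bary_line -baryB; apply: tb; first by have [] := mk k.
    by have := ck k ki; lra.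
  - have [->|kj] := eqVneq k j; first by rewrite kE xi mulr_gt0.
    rewrite /x bary_line -baryB; apply: tb; first by have [] := mk k.
    exact: ck'.
by move: TT'; rewrite TE eqxx.
Qed.

End shared.

(** Gradients are at most [1 / (2 rho)], so within distance [th * rho] a coordinate changes by at
    most [th / 2]; only the sign of the [i]-th one remains to be assumed. *)
Lemma inner_ball T i th c (rho : R) : nondegenerate T -> 0 < rho -> 0 < th ->
  (forall k, 2 * rho * enorm (bgrad T k) <= 1) -> inner_side T i th c ->
  forall x, eball c (th * rho) x -> 0 <= bary T i x -> chull T x.
Proof.
move=> nT rho0 th0 hg [ci ck] x hx xi; apply/chullP => // k.
have [->//|ki] := eqVneq k i.
have := ck k ki; have -> : bary T k x = bary T k c + lin (bgrad T k) (x - c).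
  by rewrite -baryB; ring.
have : `|lin (bgrad T k) (x - c)| <= th / 2.
  apply: le_trans (lin_norm_le _ _) _.
  have := hg k; have := enorm_ge0 (bgrad T k); move: hx; rewrite /eball/=.
  have := enorm_ge0 (x - c); nra.
rewrite ler_norml => /andP[h _]; lra.
Qed.

(** [side_normal] is picked by [xget], hence uniqueness is the point: an admissible normal defines
    an affine function that vanishes on the side and is nonnegative on [T], so it is a nonnegative
    multiple of the gradient. *)
Lemma side_normalE T i (S : 'M[R]_n.+1) : nondegenerate T -> chull S = chull (side T i) ->
  bgrad T i != 0 ->
  side_normal S T = (enorm (bgrad T i))^-1 *: bgrad T i.
Proof.
move=> nT hS g0; set g := bgrad T i; have gp : 0 < enorm g by rewrite enorm_gt0.
have gE x y : chull (side T i) y -> lin g (x - y) = bary T i x.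
  by move=> /(chull_side i _ nT).1[yi _]; rewrite -baryB yi subr0.
have exS : exists y, chull (side T i) y.
  by exists (row (lift i ord0) T); apply: side_vertex => //; rewrite eq_sym neq_lift.
have [y0 y0S] := exS.
rewrite /side_normal; apply: xget_unique => /=; rewrite hS.
  split.
  - by rewrite enormZ normfV (gtr0_norm gp) mulVf// gt_eqF.
  - move=> x y xS yS; rewrite -lin_dot linZl gE//.
    by have [-> _] := (chull_side i _ nT).1 xS; rewrite mulr0.
  - move=> x y xT yS; rewrite -lin_dot linZl gE//.
    rewrite mulr_ge0 ?invr_ge0 ?enorm_ge0//; exact: ((chullP _ nT).1 xT i).
move=> nu [nu1 nuS nuT].
pose f x := lin nu (x - y0).
have af : affr f.
  exists (- lin nu y0), nu^T => x; rewrite /f linB /sc -lin_mul trmxK; ring.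
have fE x : f x = f (row i T) * bary T i x.
  rewrite (affine_bary x nT af) (bigD1 i)//= big1 ?addr0; first by rewrite mulrC.
  move=> k ki; rewrite /f lin_dot nuS ?mulr0//; exact: side_vertex.
have fi0 : 0 <= f (row i T) by rewrite /f lin_dot; apply: nuT => //; exact: chull_row.
have nuE : nu = f (row i T) *: g.
  have lE z : lin nu z = lin (f (row i T) *: g) z.
    have -> : lin nu z = f (y0 + z) by rewrite /f addrC addKr.
    rewrite fE linZl -(gE _ _ y0S); congr (_ * lin _ _).
    by rewrite addrC addKr.
  apply/rowP => k; have := lE (delta_mx 0 k).
  have ld (v : pt) : lin v (delta_mx 0 k) = v ord0 k.
    rewrite /lin (bigD1 k)//= big1 ?addr0; first by rewrite mxE !eqxx mulr1.
    by move=> l lk; rewrite mxE (negPf lk) andbF mulr0.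
  by rewrite !ld.
move: nu1; rewrite {1}nuE enormZ (ger0_norm fi0) => h.
have -> : (enorm g)^-1 = f (row i T).
  by apply: (mulIf (lt0r_neq0 gp)); rewrite mulVf ?gt_eqF// h.
exact: nuE.
Qed.

Lemma open_eball (c : pt) (r : R) : open [set x | enorm (x - c) < r].
Proof.
rewrite (_ : [set x | _] = (fun x => enorm (x - c)) @^-1` [set t | t < r])//.
apply: open_comp => [x _|]; last exact: open_lt.
exact: continuous_enorm_sub.
Qed.

Lemma enorm0 m : enorm (0 : 'rV[R]_m) = 0.
Proof. by rewrite enormE /nsq big1 ?sqrtr0// => i _; rewrite mxE expr0n. Qed.

Lemma nbhs_eball (c : pt) (r : R) : 0 < r -> nbhs c [set x | enorm (x - c) < r].
Proof.
by move=> r0; apply: open_nbhs_nbhs; split; [exact: open_eball|rewrite /= subrr enorm0].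
Qed.

Lemma nsq_mul m (v : 'rV[R]_m) : nsq v = sc (v *m v^T).
Proof. by rewrite /sc mxE; apply: eq_bigr => i _; rewrite mxE expr2. Qed.

Lemma enorm_mul_orth m (v : 'rV[R]_m) (Q : 'M[R]_m) : Q *m Q^T = 1%:M ->
  enorm (v *m Q) = enorm v.
Proof.
by move=> QQ; rewrite !enormE !nsq_mul trmx_mul mulmxA -(mulmxA v) QQ mulmx1.
Qed.

Lemma enorm_col' (v : pt) : enorm (col' ord_max v) <= enorm v.
Proof.
rewrite !enormE ler_sqrt ?nsq_ge0// /nsq [leRHS](bigD1 ord_max)//=.
rewrite -[leLHS]add0r lerD ?sqr_ge0//.
rewrite (reindex_omap (lift ord_max) (unlift ord_max)) /=; last first.
  by move=> k; case: unliftP => [l ->|->]; rewrite ?eqxx.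
rewrite le_eqVlt; apply/orP; left; apply/eqP.
apply: eq_big => [l|l _]; last by rewrite mxE.
by rewrite liftK eqxx andbT eq_sym neq_lift.
Qed.

(** Excludes slits: the mesh covers the closure of the domain, while test functions live in its
    interior. Were [x] outside [A], it would be a boundary point; a step downwards along the axis of
    the graph would reach a point with a neighbourhood below the graph, so outside [A], yet in the
    closure. *)
Lemma lipschitz_regular_open (A : set pt) : open A -> lipschitz_boundary A ->
  forall x (r : R), 0 < r -> (forall y, enorm (y - x) < r -> closure A y) -> A x.
Proof.
move=> oA lA x r r0 sub; apply: contrapT => nAx.
have bx : boundary A x.
  split; last by apply: subset_closure.
  by apply: sub; rewrite subrr enorm0.
have [r' [L [Q [gamma [r'0 QQ lip gr]]]]] := lA x bx.
have QQ' : Q^T *m Q = 1%:M by exact: mulmx1C.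
pose e : pt := delta_mx 0 ord_max *m Q^T.
have eQ : e *m Q = delta_mx 0 ord_max by rewrite /e -mulmxA QQ' mulmx1.
have e1 : enorm e = 1.
  rewrite -(enorm_mul_orth e QQ) eQ enormE /nsq (bigD1 ord_max)//= big1 ?addr0.
    by rewrite mxE !eqxx expr1n sqrtr1.
  by move=> i im; rewrite mxE (negPf im) andbF expr0n.
pose s := Num.min r r' / 2.
have s0 : 0 < s by rewrite divr_gt0// lt_min r0.
have [sr sr'] : 2 * s <= r /\ 2 * s <= r'.
  by rewrite /s mulrC divfK//; split; rewrite ge_min lexx ?orbT.
pose y := x - s *: e.
have yx : enorm (y - x) = s.
  by rewrite /y addrAC subrr add0r enormN enormZ e1 mulr1 gtr0_norm.
have /sub : enorm (y - x) < r by rewrite yx; lra.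
(* A displacement by less than [d] changes the height above the graph by at most
   [(1 + |L|) d <= s / 2], less than the depth [s] of [y]. *)
pose d := Num.min s (s / (2 * (1 + `|L|))).
have L1 : 0 < 2 * (1 + `|L|) by rewrite mulr_gt0// ltr_pwDl.
have d0 : 0 < d by rewrite lt_min s0 divr_gt0.
have ds : d <= s by rewrite ge_min lexx.
have dL : d * (2 * (1 + `|L|)) <= s by rewrite -ler_pdivlMr// ge_min lexx orbT.
move=> /(_ _ (nbhs_eball y d0)) [z [Az zd]].
have zd' : enorm (z - y) < d by exact: zd.
have zr : enorm (z - x) < r'.
  have -> : z - x = (z - y) + (y - x) by rewrite addrA subrK.
  by apply: le_lt_trans (enormD _ _) _; rewrite yx; lra.
have /(gr z zr) := Az.
have nx : (x *m Q) ord0 ord_max <= gamma (col' ord_max (x *m Q)).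
  rewrite leNgt; apply/negP => h; apply: nAx; apply/gr => //.
  by rewrite subrr enorm0.
have yQ : y *m Q = x *m Q - s *: delta_mx 0 ord_max.
  by rewrite /y mulmxBl -scalemxAl eQ.
have cy : col' ord_max (y *m Q) = col' ord_max (x *m Q).
  by rewrite yQ; apply/rowP => k; rewrite !mxE eqxx /= eq_sym (negPf (neq_lift _ _)) mulr0 subr0.
have my : (y *m Q) ord0 ord_max = (x *m Q) ord0 ord_max - s.
  by rewrite yQ !mxE !eqxx mulr1.
have zy : enorm (z *m Q - y *m Q) < d.
  by rewrite -mulmxBl enorm_mul_orth.
have h1 := le_lt_trans (enorm_coord (z *m Q - y *m Q) ord_max) zy.
have h2 : `|gamma (col' ord_max (z *m Q)) - gamma (col' ord_max (y *m Q))| <= `|L| * d.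
  apply: le_trans (lip _ _) _.
  have -> : col' ord_max (z *m Q) - col' ord_max (y *m Q) = col' ord_max (z *m Q - y *m Q).
    by apply/rowP => k; rewrite !mxE.
  apply: (@le_trans _ _ (`|L| * enorm (col' ord_max (z *m Q - y *m Q)))).
    by rewrite ler_wpM2r ?enorm_ge0// ler_norm.
  rewrite ler_wpM2l//; apply: le_trans (enorm_col' _) (ltW zy).
move: h1 h2; rewrite cy [X in `|X| < _](_ : _ = (z *m Q) ord0 ord_max - (y *m Q) ord0 ord_max); last by rewrite !mxE.
rewrite my ltr_norml ler_norml => /andP[_ h1] /andP[h2 _] h3.
have : `|L| * d + d <= s / 2 by lra.
lra.
Qed.

Lemma eball_sub_open (A : set pt) c (r r' : R) : open A -> lipschitz_boundary A ->
  r < r' -> eball c r' `<=` closure A -> eball c r `<=` A.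
Proof.
move=> oA lA rr' sub x xr.
apply: (lipschitz_regular_open oA lA (x := x) (r := r' - r)); first by rewrite subr_gt0.
move=> y yx; apply: sub; rewrite /eball/=.
have -> : y - c = (y - x) + (x - c) by rewrite addrA subrK.
apply: le_trans (enormD _ _) _; move: xr; rewrite /eball/=; lra.
Qed.

End mesh_geometry.

(** * Integral bounds and extrapolation on simplices *)

Section nonnegative_integrals.
Variables (R : realType) (n : nat).
Implicit Types (G K : set 'rV[R]_n) (f g : 'rV[R]_n -> R).

(* No measurability is assumed: nonnegative integrals are suprema over the
   simple functions below the integrand. *)
Lemma nneg_integral_le G K f g : K `<=` G -> (forall x, K x -> 0 <= f x <= g x) ->
  (forall x, G x -> 0 <= g x) ->
  (\int[leb n]_(x in K) (f x)%:E <= \int[leb n]_(x in G) (g x)%:E)%E.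
Proof.
move=> KG hf hg; rewrite [leLHS]integral_mkcond [leRHS]integral_mkcond.
rewrite [leLHS]ge0_integralTE; last first.
  by move=> x; rewrite patchE; case: ifPn => // /set_mem /hf /andP[? _]; rewrite lee_fin.
rewrite [leRHS]ge0_integralTE; last first.
  by move=> x; rewrite patchE; case: ifPn => // /set_mem /hg; rewrite lee_fin.
apply: le_ereal_sup => _ [h hh <-]; exists h => // x; apply: le_trans (hh x) _.
rewrite !patchE; case: ifPn => [xK|_]; last by case: ifPn => // /set_mem /hg; rewrite lee_fin.
by rewrite mem_set ?lee_fin; [have /andP[] := hf x (set_mem xK)|exact/KG/set_mem].
Qed.

Lemma integral_subset_le G K f (B : R) : measurable G -> K `<=` G -> 0 <= B ->
  (forall x, K x -> 0 <= f x <= B) ->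
  (\int[leb n]_(x in K) (f x)%:E <= B%:E * leb n G)%E.
Proof. by move=> mG KG B0 hf; rewrite -integral_cst//; exact: nneg_integral_le. Qed.

End nonnegative_integrals.

Section diameters.
Variables (R : realType) (n : nat).
Local Notation pt := 'rV[R]_n.+1.
Implicit Types (T : simplex R n) (x y z c : pt) (k i j : 'I_n.+2).

Lemma enorm_sum (I : Type) (s : seq I) (v : I -> pt) :
  enorm (\sum_(i <- s) v i) <= \sum_(i <- s) enorm (v i).
Proof.
elim: s => [|i s IH]; first by rewrite !big_nil enorm0.
by rewrite !big_cons; apply: le_trans (enormD _ _) _; rewrite lerD2l.
Qed.

Lemma enorm_le_diam T x y : nondegenerate T -> chull T x -> chull T y ->
  enorm (x - y) <= diam (chull T).
Proof.
move=> nT xT yT; apply: sup_upper_bound; last by exists x, y.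
split; first by exists (enorm (x - y)), x, y.
(* Boundedness has to be shown, as [sup] only bounds sets that have an upper bound. *)
exists (\sum_k enorm (row k T) + \sum_k enorm (row k T)) => _ [u [v [uT vT ->]]].
have H w : chull T w -> enorm w <= \sum_k enorm (row k T).
  move=> [e [e0 e1 ->]]; rewrite mulmx_sum_row; apply: le_trans (enorm_sum _ _) _.
  apply: ler_sum => k _; rewrite enormZ (ger0_norm (e0 k)) ler_piMl ?enorm_ge0//.
  by rewrite -e1 (bigD1 k)//= lerDl sumr_ge0.
by apply: le_trans (enormD _ _) _; rewrite enormN lerD// H.
Qed.

Lemma diam_gt0 T : nondegenerate T -> 0 < diam (chull T).
Proof.
move=> nT; apply: lt_le_trans (enorm_le_diam nT (chull_row ord0 nT) (chull_row ord_max nT)).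
rewrite enorm_gt0; apply/eqP => h.
have := baryB T ord0 (row ord_max T) (row ord0 T); rewrite !bary_row//= h.
have -> : lin (bgrad T ord0) 0 = 0 by rewrite /lin big1// => i _; rewrite mxE mulr0.
by rewrite subr0 => /eqP; rewrite oner_eq0.
Qed.

(** The supremum may not be attained, so a ball is taken whose diameter exceeds half of it; its
    radius is then more than [diam / (4 s)]. *)
Lemma inball_exists T (s : R) : nondegenerate T -> 1 <= s ->
  diam (chull T) <= s * inball_diam (chull T) ->
  exists x0, eball x0 (diam (chull T) / (4 * s)) `<=` chull T.
Proof.
move=> nT s1 hd; have d0 := diam_gt0 nT.
have s0 : 0 < s by lra.
have ib0 : 0 < inball_diam (chull T).
  by rewrite -(pmulr_rgt0 _ s0); exact: lt_le_trans hd.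
have ne : [set t : R | exists x r,
    [/\ 0 < r, [set y | enorm (y - x) <= r] `<=` chull T & t = 2 * r]] !=set0.
  apply/set0P/eqP => E; move: ib0; rewrite /inball_diam E sup0 ltxx//.
have ib2 : inball_diam (chull T) / 2 < inball_diam (chull T) by lra.
have [_ [x0 [r [r0 sub ->]]] hr] := sup_gt ne ib2.
exists x0 => y hy; apply: sub; apply: le_trans hy _.
rewrite ler_pdivrMr ?mulr_gt0//.
have := hr; nra.
Qed.

Lemma leb_eball_le c (r : R) : 0 < r ->
  leb n.+1 (eball c r) = ((r ^+ n.+1)%:E * leb n.+1 (@unit_ball R n.+1))%E.
Proof.
move=> r0; have rN : r^-1 != 0 by rewrite invr_eq0 gt_eqF.
have := leb_affine (- (r^-1 *: c)) rN (compact_measurable_rV (@compact_unit_ball R n.+1)).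
rewrite normfV (gtr0_norm r0) invrK => <-; congr (leb _ _).
apply/seteqP; split => x; rewrite /affrV /unit_ball /eball /= subr0 -scalerBr enormZ normfV (gtr0_norm r0);
  by rewrite ler_pdivrMl// mulr1.
Qed.

Definition ball_vol : R := fine (leb n.+1 (@unit_ball R n.+1)).

Lemma ball_vol_ge0 : 0 <= ball_vol.
Proof. by rewrite fine_ge0. Qed.

(** The simplex lies in the ball around one of its vertices whose radius is the diameter. *)
Lemma integral_simplex_le T (f : pt -> R) (B : R) : nondegenerate T ->
  (forall x, chull T x -> 0 <= f x <= B) -> 0 <= B ->
  (\int[leb n.+1]_(x in chull T) (f x)%:E <=
   (B * (diam (chull T) ^+ n.+1 * ball_vol))%:E)%E.
Proof.
move=> nT hf B0; set h := diam _; have h0 : 0 < h by exact: diam_gt0.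
pose K := eball (row ord0 T) h.
have mK : measurable K by apply: compact_measurable_rV; exact: compact_eball.
apply: le_trans (integral_subset_le mK _ B0 hf) _.
  by move=> x Tx; apply: enorm_le_diam => //; exact: chull_row.
rewrite (leb_eball_le (row ord0 T) h0).
by rewrite -(fineK (_ : leb n.+1 (@unit_ball R n.+1) \is a fin_num)) -?EFinM//
  ge0_fin_numE//; apply: leb_compact_lty; exact: compact_unit_ball.
Qed.

(** On the line through [x0] and [x], the values at the parameters -1, 0 and 1 bound the linear
    coefficient by [M] and the quadratic one by [2 M]. At the parameter [t = H / rho >= 1] this
    gives [M + t M + 2 t^2 M <= 4 t^2 M]. *)
Lemma quadr_extrapolate (q : pt -> R) x0 x (rho H M : R) : quadr q ->
  0 < rho -> rho <= H -> enorm (x - x0) <= H ->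
  (forall y, eball x0 rho y -> `|q y| <= M) ->
  `|q x| <= 4 * (H / rho) ^+ 2 * M.
Proof.
move=> [a [b [A hq]]] rho0 rH xH hM.
have H0 : 0 < H by lra.
pose t := H / rho; have t1 : 1 <= t by rewrite /t ler_pdivlMr// mul1r.
pose z := t^-1 *: (x - x0).
have tN : t != 0 by rewrite gt_eqF//; lra.
have zr : enorm z <= rho.
  have tp : 0 < t by lra.
  by rewrite enormZ normfV (gtr0_norm tp) ler_pdivrMl// /t divfK// gt_eqF.
have qE s : q (x0 + s *: z) = q x0 + s * sc (z *m (b + A *m x0^T + A^T *m x0^T)) + s ^+ 2 * sc (z *m A *m z^T).
  by rewrite !hq (quadr_taylor a b A x0 z s).
move: (sc _) (sc _) qE => m l qE.
have q0 : `|q x0| <= M by apply: hM; rewrite /eball/= subrr enorm0 ltW.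
have q1 : `|q x0 + l + m| <= M.
  have := hM (x0 + 1 *: z); rewrite qE mul1r expr1n mul1r; apply.
  by rewrite /eball/= addrC addKr scale1r.
have q2 : `|q x0 - l + m| <= M.
  have := hM (x0 + (-1) *: z); rewrite qE mulN1r sqrrN expr1n mul1r; apply.
  by rewrite /eball/= addrC addKr scaleN1r enormN.
have -> : x = x0 + t *: z by rewrite /z scalerA mulfV// scale1r [RHS]addrC subrK.
rewrite qE -/t.
move: q0 q1 q2; rewrite !ler_norml => /andP[? ?] /andP[? ?] /andP[? ?].
have [hl1 hl2] : - M <= l /\ l <= M by split; lra.
have [hm1 hm2] : - (2 * M) <= m /\ m <= 2 * M by split; lra.
have M0 : 0 <= M by lra.
have t2 : t <= t ^+ 2 by nra.
have t0 : 0 <= t by lra.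
have [a1 a2] : - (t ^+ 2 * M) <= t * l /\ t * l <= t ^+ 2 * M by split; nra.
have [b1 b2] : - (2 * (t ^+ 2 * M)) <= t ^+ 2 * m /\ t ^+ 2 * m <= 2 * (t ^+ 2 * M).
  by have := sqr_ge0 t; split; nra.
have : M <= t ^+ 2 * M by rewrite ler_peMl//; nra.
by move=> ?; apply/andP; split; lra.
Qed.

End diameters.

(** * The residual functional *)

Section residual_functional.
Variables (R : realType) (n : nat).
Implicit Types (x y c v z : 'rV[R]_n) (f g phi q F : 'rV[R]_n -> R) (i j k : 'I_n) (r : R).
Local Notation mfun D f := (measurable_fun D (f : 'rV[R]_n -> measurableTypeR R)).
Local Notation Phi := (@bump0 R n).

Definition resc (F : 'rV[R]_n -> R) c r x := F (r^-1 *: (x - c)).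

Lemma resc_supported F c r : 0 < r -> supported (@unit_ball R n) F ->
  supported (eball c r) (resc F c r).
Proof.
move=> r0 sF x nx; apply: sF => h; apply: nx; move: h.
rewrite /unit_ball /eball/= subr0 enormZ normfV (gtr0_norm r0).
by rewrite ler_pdivrMl// mulr1.
Qed.

Lemma continuous_resc F c r : continuous F -> continuous (resc F c r).
Proof.
move=> cF x; apply: (@continuous_comp _ _ _ (fun x => x - c) (fun y => F (r^-1 *: y))).
  apply: (@continuousB R 'rV[R]_n _ id (cst c)); [exact: cvg_id|exact: cst_continuous].
have cs : continuous (fun y : 'rV[R]_n => r^-1 *: y) by exact: scaler_continuous.
exact: (@continuous_comp _ _ _ (fun y => r^-1 *: y) F _ (cs (x - c)) (cF _)).
Qed.

Lemma Rintegral_resc F c r : 0 < r -> continuous F ->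
  \int[leb n]_x resc F c r x = r ^+ n * \int[leb n]_x F x.
Proof. by move=> r0 cF; apply: Rintegral_rescale => //; exact: continuous_measurable_rV. Qed.

Lemma measurable_eball c r : measurable (eball c r).
Proof. by apply: compact_measurable_rV; exact: compact_eball. Qed.

Lemma integrable_resc F c r : 0 < r -> continuous F -> supported (@unit_ball R n) F ->
  (leb n).-integrable setT (EFin \o resc F c r).
Proof.
move=> r0 cF sF; apply: (integrable_supported (@compact_eball _ _ c r)).
  exact: continuous_resc.
exact: resc_supported.
Qed.

Lemma sqint_resc F c r (a : R) : 0 < r -> continuous F -> supported (@unit_ball R n) F ->
  sqint (eball c r) (fun x => a * resc F c r x) =
  (a ^+ 2 * (r ^+ n * \int[leb n]_x (F x ^+ 2)))%:E.
Proof.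
move=> r0 cF sF.
have cF2 : continuous (fun x => F x * F x) by exact: continuous_mul.
have sF2 : supported (@unit_ball R n) (fun x => F x * F x) by move=> x /sF ->; rewrite mulr0.
have iF := integrable_resc c r0 cF2 sF2.
have iaF := integrableZl measurableT (a ^+ 2) iF.
have E : (\int[leb n]_x (a ^+ 2 * resc (fun x => F x * F x)%R c r x)%R%:E =
   (a ^+ 2 * (r ^+ n * \int[leb n]_x (F x ^+ 2)))%:E)%E.
  rewrite -[LHS]fineK; last exact: integrable_fin_num iaF.
  congr EFin; rewrite -[fine _]/(Rintegral _ _ (fun x => a ^+ 2 * resc (fun x => F x * F x) c r x)).
  by rewrite RintegralZl// Rintegral_resc.
rewrite -E /sqint integral_mkcond; apply: eq_integral => x _; rewrite patchE; case: ifPn => xK.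
  by congr EFin; rewrite /resc expr2; ring.
have nK : ~ eball c r x by move=> h; move: xK; rewrite mem_set.
by congr EFin; rewrite (resc_supported (c := c) r0 sF2) ?mulr0.
Qed.

Lemma Rintegral_supported_sub (G K : set 'rV[R]_n) f : K `<=` G -> supported K f ->
  \int[leb n]_(x in G) f x = \int[leb n]_(x in K) f x.
Proof.
move=> KG sf; rewrite !Rintegral_supported//.
by move=> x nG; apply: sf => /KG.
Qed.

(** The L2 norm of a rescaled test function carries [r^(n/2)], its L1 norm [r^n]; this difference is
    the source of the square roots in [err]. *)
Lemma L2_pairing_bound (G : set 'rV[R]_n) f F c r (a N : R) : eball c r `<=` G ->
  measurable G -> mfun G f -> 0 < r -> 0 <= a -> 0 <= N -> continuous F -> supported (@unit_ball R n) F ->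
  (sqint (eball c r) f <= (N ^+ 2)%:E)%E ->
  `|\int[leb n]_(x in G) (f x * (a * resc F c r x))| <=
   N * (a * (Num.sqrt (r ^+ n) * Num.sqrt (\int[leb n]_x (F x ^+ 2)))).
Proof.
move=> KG mG mf r0 a0 N0 cF sF hN.
have sR := resc_supported (c := c) r0 sF.
rewrite (Rintegral_supported_sub KG); last by move=> x /sR ->; rewrite !mulr0.
have I0 : 0 <= \int[leb n]_x (F x ^+ 2) by apply: Rintegral_ge0 => x _; rewrite sqr_ge0.
apply: cauchy_schwarz => //.
- exact: measurable_eball.
- exact: measurable_funS mf.
- by apply: measurable_test; apply: continuous_mul; [exact: cst_continuous|exact: continuous_resc].
- by rewrite !mulr_ge0 ?sqrtr_ge0.
- rewrite sqint_resc// lee_fin !exprMn !sqr_sqrtr//.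
  by rewrite exprn_ge0// ltW.
Qed.

Lemma Linf_pairing_bound (G : set 'rV[R]_n) f F c r (N : R) : eball c r `<=` G ->
  measurable G -> mfun G f -> 0 < r -> 0 <= N -> continuous F -> supported (@unit_ball R n) F ->
  {ae leb n, forall x, eball c r x -> `|f x| <= N} ->
  `|\int[leb n]_(x in G) (f x * resc F c r x)| <= N * (r ^+ n * \int[leb n]_x `|F x|).
Proof.
move=> KG mG mf r0 N0 cF sF hN.
have sR := resc_supported (c := c) r0 sF.
have mK := measurable_eball c r.
have cA : continuous (fun x => `|F x|).
  by move=> x; apply: (@continuous_comp _ _ _ F (@Num.norm R R)); [exact: cF|exact: norm_continuous].
have sA : supported (@unit_ball R n) (fun x => `|F x|) by move=> x /sF ->; rewrite normr0.
have iA := integrable_resc c r0 cA sA.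
have mfK : mfun (eball c r) f by exact: measurable_funS mf.
have mR : mfun (eball c r) (resc F c r) by apply: measurable_test; exact: continuous_resc.
have mfR : mfun (eball c r) (fun x => f x * resc F c r x) by exact: measurable_funM.
have iNA : (leb n).-integrable (eball c r) (EFin \o (fun x => N * resc (fun x => `|F x|) c r x)).
  exact: (integrableS measurableT mK (@subsetT _ _) (integrableZl measurableT N iA)).
have le : (\int[leb n]_(x in eball c r) `|(f x * resc F c r x)%:E| <=
    \int[leb n]_(x in eball c r) (N * resc (fun x => `|F x|)%R c r x)%R%:E)%E.
  apply: ae_ge0_le_integral => //.
  - by have /measurable_EFinP mE := mfR; exact: measurableT_comp.
  - by move=> x _; rewrite lee_fin mulr_ge0// /resc normr_ge0.
  - exact: measurable_int iNA.
  - apply: filterS hN => x hx xK; rewrite lee_fin normrM /resc.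
    by rewrite ler_wpM2r//; exact: hx.
have ifR : (leb n).-integrable (eball c r) (EFin \o (fun x => f x * resc F c r x)).
  apply/integrableP; split; first exact/measurable_EFinP.
  apply: le_lt_trans le _; rewrite ltey_eq; apply/orP; left.
  exact: (integrable_fin_num mK iNA).
rewrite (Rintegral_supported_sub KG); last by move=> x /sR ->; rewrite mulr0.
apply: (@le_trans _ _ (\int[leb n]_(x in eball c r) (N * resc (fun x => `|F x|) c r x))).
  apply: le_trans (le_normr_Rintegral mK ifR) _.
  rewrite -lee_fin /Rintegral !fineK//; [exact: (integrable_fin_num mK iNA)|].
  exact: (integrable_fin_num mK (integrable_norm ifR)).
rewrite Rintegral_supported; last by move=> x nK; rewrite (resc_supported (c := c) r0 sA)// mulr0.
by rewrite RintegralZl// Rintegral_resc.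
Qed.

End residual_functional.

(** * Scaling of the error terms *)

Section test_constants.
Variables (R : realType) (n : nat).
Local Notation Phi := (@bump0 R n).

Lemma sum_bounds (I : Type) (t1 t2 t3 t4 : R) (f : I -> R) :
  0 <= t1 -> 0 <= t2 -> 0 <= t3 -> 0 <= t4 -> (forall k, f k <= t2) ->
  let A := 1 + t1 + t2 + t3 + t4 in
  [/\ 1 <= A, t1 <= A, forall k, f k <= A, t3 <= A & t4 <= A].
Proof.
move=> ? ? ? ? hf A; rewrite /A; split; try lra.
by move=> k; apply: le_trans (hf k) _; lra.
Qed.

Definition test_cst : R :=
  1 + Num.sqrt (\int[leb n]_x (Phi x ^+ 2))
  + \sum_k Num.sqrt (\int[leb n]_x (partial k Phi x ^+ 2))
  + \sum_k \int[leb n]_x `|partial k (partial k Phi) x|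
  + \sum_k \int[leb n]_x `|partial k Phi x|.

Lemma test_cst_bounds :
  [/\ 1 <= test_cst, Num.sqrt (\int[leb n]_x (Phi x ^+ 2)) <= test_cst,
      forall k, Num.sqrt (\int[leb n]_x (partial k Phi x ^+ 2)) <= test_cst,
      \sum_k \int[leb n]_x `|partial k (partial k Phi) x| <= test_cst &
      \sum_k \int[leb n]_x `|partial k Phi x| <= test_cst].
Proof.
have h1 := sqrtr_ge0 (\int[leb n]_x (Phi x ^+ 2)).
have h2 : 0 <= \sum_k Num.sqrt (\int[leb n]_x (partial k Phi x ^+ 2)).
  by apply: sumr_ge0 => k _; exact: sqrtr_ge0.
have h3 : 0 <= \sum_k \int[leb n]_x `|partial k (partial k Phi) x|.
  by apply: sumr_ge0 => k _; apply: Rintegral_ge0.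
have h4 : 0 <= \sum_k \int[leb n]_x `|partial k Phi x|.
  by apply: sumr_ge0 => k _; apply: Rintegral_ge0.
have h5 k : Num.sqrt (\int[leb n]_x (partial k Phi x ^+ 2)) <=
    \sum_k Num.sqrt (\int[leb n]_x (partial k Phi x ^+ 2)).
  rewrite [leRHS](bigD1 k)//= lerDl; apply: sumr_ge0 => l _; exact: sqrtr_ge0.
exact: (sum_bounds (f := fun k => Num.sqrt (\int[leb n]_x (partial k Phi x ^+ 2))) h1 h2 h3 h4 h5).
Qed.

(* The size of the momentum residual tested at scale r, relative to r^n. *)
Definition err (Nu Ny Np r : R) : R :=
  Nu / Num.sqrt (r ^+ n) + Ny / r ^+ 2 + Np / (Num.sqrt (r ^+ n) * r).

Lemma err_ge0 Nu Ny Np r : 0 <= Nu -> 0 <= Ny -> 0 <= Np -> 0 < r -> 0 <= err Nu Ny Np r.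
Proof.
move=> u0 y0 p0 r0; rewrite !addr_ge0// divr_ge0// ?sqrtr_ge0 ?exprn_ge0 ?mulr_ge0 ?sqrtr_ge0//;
  exact: ltW.
Qed.

(** The three terms scale with [t^(-n/2)], [t^-2] and [t^(-n/2-1)]; the integer power [t^-(n+2)]
    dominates them all. *)
Lemma err_scale Nu Ny Np r (t : R) : 0 <= Nu -> 0 <= Ny -> 0 <= Np -> 0 < r -> 0 < t <= 1 ->
  err Nu Ny Np (t * r) <= (t ^- (n + 2)) * err Nu Ny Np r.
Proof.
move=> u0 y0 p0 r0 /andP[t0 t1].
have sr0 : 0 < Num.sqrt (r ^+ n) by rewrite sqrtr_gt0 exprn_gt0.
have tn0 : 0 < t ^+ n by rewrite exprn_gt0.
have st : t ^+ n <= Num.sqrt (t ^+ n).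
  rewrite -{1}(sqr_sqrtr (ltW tn0)) expr2 ler_piMr ?sqrtr_ge0//.
  by rewrite -sqrtr1 ler_sqrt// exprn_ile1// ltW.
have sE : Num.sqrt ((t * r) ^+ n) = Num.sqrt (t ^+ n) * Num.sqrt (r ^+ n).
  by rewrite exprMn sqrtrM// ltW.
rewrite /err sE !mulrDr; have st0 : 0 < Num.sqrt (t ^+ n) by rewrite sqrtr_gt0.
have tinv : (Num.sqrt (t ^+ n))^-1 <= t ^- n by rewrite lef_pV2 ?posrE.
have t20 : 0 < t ^+ 2 by rewrite exprn_gt0.
have tn2 : t ^- (n + 2) = t ^- n * t ^- 2 by rewrite exprD invfM.
have ti1 : 1 <= t^-1 by rewrite invf_ge1.
have ti2 : t^-1 <= t ^- 2 by rewrite lef_pV2 ?posrE// expr2 ler_piMl// ltW.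
have tin : 1 <= t ^- n by rewrite invf_ge1// exprn_ile1// ltW.
have ti0 : 0 < t ^- n by rewrite invr_gt0.
have ti2' : 1 <= t ^- 2 by lra.
have rs : 0 <= (Num.sqrt (r ^+ n))^-1 by rewrite invr_ge0 ltW.
rewrite tn2; apply: lerD; first apply: lerD.
- rewrite invfM mulrCA; apply: ler_wpM2r; first by rewrite mulr_ge0.
  by apply: le_trans tinv _; rewrite ler_peMr// ltW.
- rewrite exprMn invfM mulrCA; apply: ler_wpM2r.
    by rewrite mulr_ge0// invr_ge0 exprn_ge0// ltW.
  by rewrite ler_peMl// ltW// invr_gt0.
- have -> : Np / (Num.sqrt (t ^+ n) * Num.sqrt (r ^+ n) * (t * r)) =
    ((Num.sqrt (t ^+ n))^-1 * t^-1) * (Np / (Num.sqrt (r ^+ n) * r)).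
    by rewrite !invfM; ring.
  apply: ler_wpM2r; first by rewrite divr_ge0// mulr_ge0// ltW.
  by apply: ler_pM => //; rewrite invr_ge0 ltW.
Qed.

End test_constants.

Section functional_bounds.
Variables (R : realType) (n : nat) (G : set 'rV[R]_n).
Hypotheses (oG : open G) (finG : (leb n G < +oo)%E).
Implicit Types (x c v z : 'rV[R]_n) (f g phi q F : 'rV[R]_n -> R) (i j k : 'I_n) (r : R).
Local Notation mfun D f := (measurable_fun D (f : 'rV[R]_n -> measurableTypeR R)).
Local Notation Phi := (@bump0 R n).

Let mG := open_measurable_rV oG.

Definition sqfun f := mfun G f /\ (sqint G f < +oo)%E.

(** The [k]-th momentum equation tested with [phi], all derivatives on [phi]. It is linear in
    [(U, Y, P)] and vanishes for the exact solution. *)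
Definition momentum_fun (U Y P : 'rV[R]_n -> R) k phi : R :=
  \int[leb n]_(x in G) (U x * phi x) +
  \sum_j \int[leb n]_(x in G) (Y x * partial j (partial j phi) x) +
  \int[leb n]_(x in G) (P x * partial k phi x).

Lemma Rintegral_testB f g phi : sqfun f -> sqfun g -> Cc_infty G phi ->
  \int[leb n]_(x in G) ((f x - g x) * phi x) =
  \int[leb n]_(x in G) (f x * phi x) - \int[leb n]_(x in G) (g x * phi x).
Proof.
move=> [mf f2] [mg g2] cphi; rewrite -RintegralB//; try exact: integrable_test.
by apply: eq_Rintegral => x _; rewrite mulrBl.
Qed.

Lemma momentum_funB (U Y P U' Y' P' : 'rV[R]_n -> R) k phi :
  sqfun U -> sqfun Y -> sqfun P -> sqfun U' -> sqfun Y' -> sqfun P' -> Cc_infty G phi ->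
  momentum_fun (fun x => U x - U' x) (fun x => Y x - Y' x) (fun x => P x - P' x) k phi =
  momentum_fun U Y P k phi - momentum_fun U' Y' P' k phi.
Proof.
move=> sU sY sP sU' sY' sP' cphi; rewrite /momentum_fun.
rewrite (Rintegral_testB sU sU' cphi) (Rintegral_testB sP sP' (Cc_infty_partial k cphi)).
rewrite (eq_bigr _ (fun j _ => Rintegral_testB sY sY'
  (Cc_infty_partial j (Cc_infty_partial j cphi)))).
rewrite sumrB; ring.
Qed.

Lemma sqfunB f g : sqfun f -> sqfun g -> mfun G (fun x => f x - g x).
Proof. by move=> [mf _] [mg _]; exact: measurable_funB. Qed.

Lemma supported_bump0_partial i : supported (@unit_ball R n) (partial i Phi).
Proof. exact/supported_partial/bump0_supported/compact_unit_ball. Qed.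

Lemma continuous_elementary f : elementary f -> continuous f.
Proof. by move=> /elementary_C1 /C1_continuous. Qed.

Lemma momentum_bound (U Y P : 'rV[R]_n -> R) k c r (Nu Ny Np : R) :
  mfun G U -> mfun G Y -> mfun G P -> 0 < r -> eball c r `<=` G ->
  0 <= Nu -> 0 <= Ny -> 0 <= Np ->
  (sqint (eball c r) U <= (Nu ^+ 2)%:E)%E ->
  {ae leb n, forall x, eball c r x -> `|Y x| <= Ny} ->
  (sqint (eball c r) P <= (Np ^+ 2)%:E)%E ->
  `|momentum_fun U Y P k (rbump c r)| <= test_cst R n * (r ^+ n * err n Nu Ny Np r).
Proof.
move=> mU mY mP r0 KG u0 y0 p0 hU hY hP.
have [A1 A2 A3 A4 _] := test_cst_bounds R n.
set A := test_cst R n in A1 A2 A3 A4 *.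
have cP : continuous Phi by exact/continuous_elementary/elementary_bump0.
have cPk : continuous (partial k Phi).
  by apply: continuous_elementary; apply: elementary_partial; exact: elementary_bump0.
have cPjj j : continuous (partial j (partial j Phi)).
  by apply: continuous_elementary; do 2 apply: elementary_partial; exact: elementary_bump0.
have sP := @bump0_supported R n.
have sPk := supported_bump0_partial k.
have sPjj j : supported (@unit_ball R n) (partial j (partial j Phi)).
  exact/supported_partial/supported_bump0_partial/compact_unit_ball.
have s0 : 0 < Num.sqrt (r ^+ n) by rewrite sqrtr_gt0 exprn_gt0.
set s := Num.sqrt (r ^+ n) in s0 *.
have ss : s * s = r ^+ n by rewrite -expr2 sqr_sqrtr// exprn_ge0// ltW.
have ri0 : 0 < r^-1 by rewrite invr_gt0.
have B1 : `|\int[leb n]_(x in G) (U x * rbump c r x)| <= A * (r ^+ n * (Nu / s)).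
  rewrite (@eq_Rintegral _ _ _ _ _ (fun x => U x * (1 * resc Phi c r x))); last first.
    by move=> x _; rewrite mul1r.
  apply: le_trans (L2_pairing_bound KG mG mU r0 ler01 u0 cP sP hU) _.
  rewrite -/s -ss mul1r.
  have -> : A * (s * s * (Nu / s)) = Nu * (s * A) by field; rewrite gt_eqF.
  by rewrite ler_wpM2l// ler_wpM2l// ltW.
have B3 : `|\int[leb n]_(x in G) (P x * partial k (rbump c r) x)| <= A * (r ^+ n * (Np / (s * r))).
  rewrite partial_bump.
  apply: le_trans (L2_pairing_bound KG mG mP r0 (ltW ri0) p0 cPk sPk hP) _.
  rewrite -/s -ss.
  have -> : A * (s * s * (Np / (s * r))) = Np * (r^-1 * (s * A)) by field; rewrite !gt_eqF.
  by rewrite ler_wpM2l// ler_wpM2l ?(ltW ri0)// ler_wpM2l// ltW.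
have B2 : `|\sum_j \int[leb n]_(x in G) (Y x * partial j (partial j (rbump c r)) x)|
    <= A * (r ^+ n * (Ny / r ^+ 2)).
  apply: le_trans (ler_norm_sum _ _ _) _.
  apply: (@le_trans _ _ (\sum_j (r^-1 * r^-1 * Ny) * (r ^+ n * \int[leb n]_x `|partial j (partial j Phi) x|))).
    apply: ler_sum => j _.
    rewrite (@eq_Rintegral _ _ _ _ _ (fun x => (r^-1 * r^-1 * Y x) * resc (partial j (partial j Phi)) c r x)); last first.
      by move=> x _; rewrite partial2_bump /resc; ring.
    apply: (Linf_pairing_bound KG) => //.
    - by apply: measurable_funM => //; exact: measurable_cst.
    - by rewrite !mulr_ge0// ltW.
    - apply: filterS hY => x hx xK; rewrite normrM ger0_norm; last by rewrite mulr_ge0// ltW.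
      by apply: ler_wpM2l; [rewrite mulr_ge0// ltW|exact: hx].
  rewrite -mulr_sumr -mulr_sumr.
  have -> : A * (r ^+ n * (Ny / r ^+ 2)) = (r^-1 * r^-1 * Ny) * (r ^+ n * A) by field; rewrite gt_eqF.
  rewrite ler_wpM2l//; first by rewrite !mulr_ge0// ltW.
  by rewrite ler_wpM2l// exprn_ge0// ltW.
rewrite /momentum_fun /err -/s !mulrDr.
apply: le_trans (ler_normD _ _) _; apply: lerD => //.
by apply: le_trans (ler_normD _ _) _; apply: lerD.
Qed.

Lemma divergence_bound (Y : 'I_n -> 'rV[R]_n -> R) c r (Ny : R) :
  (forall i, mfun G (Y i)) -> 0 < r -> eball c r `<=` G -> 0 <= Ny ->
  (forall i, {ae leb n, forall x, eball c r x -> `|Y i x| <= Ny}) ->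
  `|\sum_i \int[leb n]_(x in G) (Y i x * partial i (rbump c r) x)| <=
   test_cst R n * (r ^+ n * (Ny / r)).
Proof.
move=> mY r0 KG y0 hY.
have [_ _ _ _ A5] := test_cst_bounds R n.
set A := test_cst R n in A5 *.
have cPk k : continuous (partial k Phi).
  by apply: continuous_elementary; apply: elementary_partial; exact: elementary_bump0.
have ri0 : 0 < r^-1 by rewrite invr_gt0.
apply: le_trans (ler_norm_sum _ _ _) _.
apply: (@le_trans _ _ (\sum_j (r^-1 * Ny) * (r ^+ n * \int[leb n]_x `|partial j Phi x|))).
  apply: ler_sum => j _.
  rewrite (@eq_Rintegral _ _ _ _ _ (fun x => (r^-1 * Y j x) * resc (partial j Phi) c r x)); last first.
    by move=> x _; rewrite partial_bump /resc; ring.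
  apply: (Linf_pairing_bound KG) => //.
  - exact: measurable_funM (@measurable_cst _ _ _ _ _ r^-1) (mY j).
  - by rewrite !mulr_ge0// ltW.
  - exact: supported_bump0_partial.
  - apply: filterS (hY j) => x hx xK; rewrite normrM ger0_norm; last by rewrite ltW.
    by apply: ler_wpM2l; [rewrite ltW|exact: hx].
rewrite -mulr_sumr -mulr_sumr.
have -> : A * (r ^+ n * (Ny / r)) = (r^-1 * Ny) * (r ^+ n * A) by field; rewrite gt_eqF.
rewrite ler_wpM2l//; first by rewrite !mulr_ge0// ltW.
by rewrite ler_wpM2l// exprn_ge0// ltW.
Qed.

End functional_bounds.

(** * Integral identities for polynomials against a bump *)

Section identities.
Variables (R : realType) (n : nat) (G : set 'rV[R]_n).
Hypotheses (oG : open G) (finG : (leb n G < +oo)%E).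
Implicit Types (x c v z nu : 'rV[R]_n) (f g phi q F : 'rV[R]_n -> R) (i j k : 'I_n) (r : R).
Local Notation mfun D f := (measurable_fun D (f : 'rV[R]_n -> measurableTypeR R)).
Local Notation Phi := (@bump0 R n).

Let mG := open_measurable_rV oG.

(** Integrability and value travel together, so that linear combinations of identities need no
    separate integrability proofs. *)
Definition has_int f (a : R) :=
  (leb n).-integrable setT (EFin \o f) /\ \int[leb n]_x f x = a.

Lemma has_intD f g (a b : R) : has_int f a -> has_int g b ->
  has_int (fun x => f x + g x) (a + b).
Proof.
move=> [fi <-] [gi <-]; split; first exact: (integrableD measurableT fi gi).
by rewrite RintegralD.
Qed.

Lemma has_intZ f (t a : R) : has_int f a -> has_int (fun x => t * f x) (t * a).
Proof.
move=> [fi <-]; split; first exact: (integrableZl measurableT t fi).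
by rewrite RintegralZl.
Qed.

Lemma has_int_sum (I : Type) (s : seq I) (f : I -> 'rV[R]_n -> R) (a : I -> R) :
  (forall i : I, has_int (f i) (a i)) ->
  has_int (fun x => \sum_(i <- s) f i x) (\sum_(i <- s) a i).
Proof.
move=> h; elim: s => [|i s IH].
  rewrite big_nil (_ : (fun x => _) = fun=> 0); last by apply/funext => x; rewrite big_nil.
  split; last by rewrite Rintegral_cst// mul0r.
  exact: (@integrable0 _ _ _ _ setT).
rewrite big_cons (_ : (fun x => _) = fun x => f i x + \sum_(i <- s) f i x).
  exact: has_intD.
by apply/funext => x; rewrite big_cons.
Qed.

Lemma has_int_test f phi : sqfun G f -> Cc_infty G phi ->
  has_int (fun x => f x * phi x) (\int[leb n]_(x in G) (f x * phi x)).
Proof.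
move=> [mf f2] cphi.
have sp : supported G (fun x => f x * phi x).
  by move=> x /(Cc_infty_supported cphi) ->; rewrite mulr0.
split; last by rewrite (Rintegral_supported sp).
have := integrable_test oG mf f2 cphi.
move/(integrable_mkcond _ mG); apply: eq_integrable => // x _.
by rewrite patchE; case: ifPn => //; rewrite notin_setE => /sp /= ->.
Qed.

(** Gathers the functional into one integrand on the whole space, ready for pointwise comparison
    with the identities for polynomials. *)
Lemma has_int_momentum U Y P k phi : sqfun G U -> sqfun G Y -> sqfun G P -> Cc_infty G phi ->
  has_int (fun x => U x * phi x + Y x * lap phi x + P x * partial k phi x)
    (momentum_fun G U Y P k phi).
Proof.
move=> sU sY sP cphi; apply: has_intD; last exact/has_int_test/Cc_infty_partial.
apply: has_intD; first exact: has_int_test.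
under eq_fun do rewrite mulr_sumr; apply: has_int_sum => j.
by apply: has_int_test => //; do 2 apply: Cc_infty_partial.
Qed.

Lemma has_int_parts i f g K : elementary f -> elementary g -> compact K -> supported K g ->
  has_int (fun x => f x * partial i g x + partial i f x * g x) 0.
Proof.
move=> ef eg cK sg; have e1 := elementaryM ef (elementary_partial i eg).
have e2 := elementaryM (elementary_partial i ef) eg.
have i1 : (leb n).-integrable setT (EFin \o (fun x => f x * partial i g x)).
  apply: (integrable_supported cK); first exact: continuous_elementary.
  by move=> x nx; rewrite (supported_partial i cK)// mulr0.
have i2 : (leb n).-integrable setT (EFin \o (fun x => partial i f x * g x)).
  apply: (integrable_supported cK); first exact: continuous_elementary.
  by move=> x /sg ->; rewrite mulr0.
split; first exact: (integrableD measurableT i1 i2).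
rewrite RintegralD// (Rintegral_parts i (elementary_C1 ef) (elementary_C1 eg) cK sg).
by rewrite addNr.
Qed.

Lemma has_int_green f g K : elementary f -> elementary g -> compact K -> supported K g ->
  has_int (fun x => f x * lap g x + (-1) * (lap f x * g x)) 0.
Proof.
move=> ef eg cK sg.
have H j : has_int (fun x => f x * partial j (partial j g) x + (-1) * (partial j (partial j f) x * g x)) 0.
  have h1 := has_int_parts j ef (elementary_partial j eg) cK (supported_partial j cK sg).
  have h2 := has_int_parts j (elementary_partial j ef) eg cK sg.
  have := has_intD h1 (has_intZ (-1) h2); rewrite mulr0 addr0.
  by congr has_int; apply/funext => x; ring.
have := has_int_sum (index_enum 'I_n) H; rewrite big1//.
congr has_int; apply/funext => x.
by rewrite big_split /= -!mulr_sumr -mulr_suml.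
Qed.

Lemma has_int_elementary f K : elementary f -> compact K -> supported K f ->
  has_int f (\int[leb n]_x f x).
Proof.
move=> ef cK sf; split => //.
by apply: (integrable_supported cK) => //; exact: continuous_elementary.
Qed.

Section ball.
Variables (c : 'rV[R]_n) (r : R).
Hypotheses (r0 : 0 < r) (KG : eball c r `<=` G).
Let K := eball c r.
Let cK : compact K. Proof. exact: compact_eball. Qed.
Let B := rbump c r.
Let eB : elementary B. Proof. exact: elementary_bump. Qed.
Let sB : supported K B. Proof. exact: bump_supported. Qed.
Let cB : Cc_infty G B. Proof. exact: Cc_infty_bump. Qed.

Lemma momentum_interior U Y P k uq yq pq : sqfun G U -> sqfun G Y -> sqfun G P ->
  quadr uq -> quadr yq -> affr pq ->
  (forall x, K x -> [/\ U x = uq x, Y x = yq x & P x = pq x]) ->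
  momentum_fun G U Y P k B =
  \int[leb n]_x ((uq x + lap yq x - partial k pq x) * B x).
Proof.
move=> sU sY sP quq qyq apq hK.
have eu := quadr_elementary quq; have ey := quadr_elementary qyq.
have ep := quadr_elementary (affr_quadr apq).
have h1 := has_int_green ey eB cK sB.
have h2 := has_int_parts k ep eB cK sB.
have eq_ : elementary (fun x => (uq x + lap yq x + (-1) * partial k pq x) * B x).
  apply: elementaryM => //; apply: elementaryD; first by apply: elementaryD => //; exact: elementary_lap.
  by apply: elementaryM; [exact: elementary_cst|exact: elementary_partial].
have h3 := has_int_elementary eq_ cK (fun x nx => etrans (congr1 _ (sB nx)) (mulr0 _)).
have [_ <-] := has_int_momentum k sU sY sP cB.
have [_] := has_intD h3 (has_intD h1 h2); rewrite !addr0 => E.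
transitivity (\int[leb n]_x ((uq x + lap yq x + (-1) * partial k pq x) * B x)); last first.
  by apply: eq_Rintegral => x _; rewrite mulN1r.
rewrite -E; apply: eq_Rintegral => x _.
have [Kx|nK] := pselect (K x).
  by have [-> -> ->] := hK x Kx; ring.
by rewrite sB// (supported_lap cK sB)// (supported_partial k cK sB)//; ring.
Qed.

Lemma divergence_interior (Y yq : 'I_n -> 'rV[R]_n -> R) :
  (forall i, sqfun G (Y i)) -> (forall i, quadr (yq i)) ->
  (forall i x, K x -> Y i x = yq i x) ->
  \sum_i \int[leb n]_(x in G) (Y i x * partial i B x) =
  - \int[leb n]_x ((\sum_i partial i (yq i) x) * B x).
Proof.
move=> sY qy hK.
have ey i := quadr_elementary (qy i).
have H i : has_int (fun x => partial i (yq i) x * B x) (- \int[leb n]_(x in G) (Y i x * partial i B x)).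
  have h1 := has_int_parts i (ey i) eB cK sB.
  have h2 := has_int_test (sY i) (Cc_infty_partial i cB).
  have := has_intD h1 (has_intZ (-1) h2); rewrite add0r mulN1r.
  congr has_int; apply/funext => x; have [Kx|nK] := pselect (K x).
    by rewrite hK//; ring.
  by rewrite sB// (supported_partial i cK sB)//; ring.
have [_] := has_int_sum (index_enum 'I_n) H.
rewrite sumrN => /(congr1 -%R); rewrite opprK => <-; congr (- _).
by apply: eq_Rintegral => x _; rewrite mulr_suml.
Qed.

Section jump.
Variables (nu : 'rV[R]_n).
Hypothesis nu1 : nsq nu = 1.

Let l x := lin nu (x - c).
(** The value on the hyperplane is 0, so oddness about [c] holds at every point, not just almost
    everywhere. *)
Definition side_sign x : R := \1_[set x | 0 < lin nu (x - c)] x - \1_[set x | lin nu (x - c) < 0] x.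

Let side_signE x : [\/ 0 < l x /\ side_sign x = 1, l x = 0 /\ side_sign x = 0 |
  l x < 0 /\ side_sign x = -1].
Proof.
rewrite /side_sign !indicE; case: (ltgtP (l x) 0) => h.
- apply: Or33; split => //; rewrite memNset ?mem_set//= ?sub0r//.
  by move=> h'; have := lt_trans h h'; rewrite ltxx.
- apply: Or31; split => //; rewrite mem_set// memNset ?subr0//=.
  by move=> h'; have := lt_trans h h'; rewrite ltxx.
- apply: Or32; split => //; rewrite !memNset ?subrr//=; rewrite -/(l x) h ltxx//.
Qed.

Lemma side_sign_mul x : side_sign x * lin nu (x - c) = `|lin nu (x - c)|.
Proof.
rewrite -/(l x); case: (side_signE x) => -[h ->].
- by rewrite mul1r gtr0_norm.
- by rewrite mul0r h normr0.
- by rewrite mulN1r ltr0_norm.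
Qed.

Lemma side_sign_bound x : `|side_sign x| <= 1.
Proof. by case: (side_signE x) => -[_ ->]; rewrite ?normr1 ?normr0 ?normrN1. Qed.

Let refl x := -1 *: x + (c + c).

Let reflE x : refl x - c = - (x - c).
Proof. by rewrite /refl scaleN1r -addrA addrK opprB addrC. Qed.

Lemma side_sign_refl x : side_sign (-1 *: x + (c + c)) = - side_sign x.
Proof.
have E : l (refl x) = - l x by rewrite /l reflE linN.
rewrite -/(refl x); case: (side_signE x) => -[h ->]; case: (side_signE (refl x)) => -[h' ->];
  rewrite ?oppr0 ?opprK//; exfalso; move: h'; rewrite E; lra.
Qed.

Lemma measurable_side_sign : mfun setT side_sign.
Proof.
have cl : continuous (fun x => lin nu (x - c)).
  rewrite (_ : (fun x => _) = fun x => lin nu x + (- lin nu c)).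
    apply: continuous_elementary; apply: elementaryD; [exact: elementary_lincomb|exact: elementary_cst].
  by apply/funext => x; rewrite linB.
apply: measurable_funB; apply: measurable_indic; apply: open_measurable_rV.
- rewrite (_ : [set x | _] = (fun x => lin nu (x - c)) @^-1` [set t | 0 < t])//.
  by apply: open_comp; [move=> x _; exact: cl|exact: open_gt].
- rewrite (_ : [set x | _] = (fun x => lin nu (x - c)) @^-1` [set t | t < 0])//.
  by apply: open_comp; [move=> x _; exact: cl|exact: open_lt].
Qed.

Lemma Rintegral_odd_about f : (leb n).-integrable setT (EFin \o f) ->
  (forall x, f (-1 *: x + (c + c)) = - f x) -> \int[leb n]_x f x = 0.
Proof.
move=> intf fodd.
have mf : mfun setT f by apply/measurable_EFinP; exact: measurable_int intf.
have N0 : (-1 : R) != 0 by rewrite oppr_eq0 oner_neq0.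
have := Rintegral_leb_affine (c + c) N0 mf.
rewrite normrN1 invr1 expr1n mul1r => E.
have : \int[leb n]_x f x = - \int[leb n]_x f x.
  rewrite -{1}E (@eq_Rintegral _ _ _ _ _ (fun x => -1 * f x)).
    by rewrite RintegralZl// mulN1r.
  by move=> x _; rewrite fodd mulN1r.
move: (\int[leb n]_x f x) => I; lra.
Qed.

(* A function that is odd about c integrates to 0; multiplying by side_sign
   turns even functions into odd ones. *)
Lemma has_int_odd f : continuous f -> supported K f ->
  (forall x, f (-1 *: x + (c + c)) = f x) -> has_int (fun x => side_sign x * f x) 0.
Proof.
move=> cf sf fe; have [M M0 hM] := supported_bound cK cf sf.
have is_ : (leb n).-integrable setT (EFin \o (fun x => side_sign x * f x)).
  apply: (@integrable_bounded_supported _ _ K _ M).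
  - exact: compact_measurable_rV.
  - exact: leb_compact_lty.
  - exact: measurable_funM measurable_side_sign (continuous_measurable_rV cf).
  - by move=> x; rewrite normrM; apply: le_trans (hM x); rewrite ler_piMl// side_sign_bound.
  - by move=> x /sf ->; rewrite mulr0.
split=> //; apply: Rintegral_odd_about => // x.
by rewrite side_sign_refl fe mulNr.
Qed.

Let scaled_refl x : r^-1 *: (refl x - c) = - (r^-1 *: (x - c)).
Proof. by rewrite reflE scalerN. Qed.

Lemma B_refl x : B (-1 *: x + (c + c)) = B x.
Proof. by rewrite /B /rbump -/(refl x) scaled_refl bump0N. Qed.

Lemma partial_B_refl k x : partial k B (-1 *: x + (c + c)) = - partial k B x.
Proof.
rewrite /B partial_bump -/(refl x) scaled_refl partial_even ?mulrN//.
- exact/elementary_differentiable/elementary_bump0.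
- exact: bump0N.
Qed.

Lemma lap_BE : lap B = fun x => r^-1 * r^-1 * lap Phi (r^-1 *: (x - c)).
Proof.
apply/funext => x; rewrite /lap mulr_sumr; apply: eq_bigr => j _.
by rewrite /B partial2_bump mulrA.
Qed.

Lemma lap_B_refl x : lap B (-1 *: x + (c + c)) = lap B x.
Proof. by rewrite lap_BE -/(refl x) scaled_refl lap_bump0N. Qed.

Lemma elementary_lB : elementary (fun x => lin nu (x - c)).
Proof.
rewrite (_ : (fun x => _) = fun x => lin nu x + (- lin nu c)).
  by apply: elementaryD; [exact: elementary_lincomb|exact: elementary_cst].
by apply/funext => x; rewrite linB.
Qed.

(** Rescaling of [abs_lap_lower]: the distance gives a factor [r], the Laplacian [r^-2], the volume
    [r^n]. *)
Lemma abs_lap_B : r ^+ n * r^-1 * (bump_mass R n / 4) <= \int[leb n]_x (`|lin nu (x - c)| * lap B x).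
Proof.
rewrite (@eq_Rintegral _ _ _ _ _ (fun x => r^-1 * resc (fun y => `|lin nu y| * lap Phi y) c r x)); last first.
  move=> x _; rewrite lap_BE /resc linZ normrM (gtr0_norm (_ : 0 < r^-1)) ?invr_gt0//.
  by ring.
have cf : continuous (fun y => `|lin nu y| * lap Phi y).
  apply: continuous_mul; last exact/continuous_elementary/elementary_lap/elementary_bump0.
  move=> x; apply: (@continuous_comp _ _ _ (lin nu) (@Num.norm R R)); last exact: norm_continuous.
  exact: (continuous_elementary (elementary_lincomb nu)).
have sf : supported (@unit_ball R n) (fun y => `|lin nu y| * lap Phi y).
  move=> x nx; rewrite (supported_lap _ (@bump0_supported R n))// ?mulr0//.
  exact: compact_unit_ball.
rewrite RintegralZl//; last exact: integrable_resc.
rewrite Rintegral_resc//.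
rewrite [X in X <= _](_ : _ = r^-1 * (r ^+ n * (bump_mass R n / 4))); last by ring.
rewrite ler_wpM2l ?invr_ge0 ?(ltW r0)// ler_wpM2l ?exprn_ge0 ?(ltW r0)//.
exact: abs_lap_lower.
Qed.

(** Vanishing on a disc of the hyperplane forces the gradient at [c] to be normal. What remains
    beyond the normal part is a quadratic form centred at [c], hence even about [c]. *)
Lemma quadr_vanish (a : R) (b : 'cV[R]_n) (A : 'M[R]_n) :
  let w x := a + sc (x *m b) + sc (x *m A *m x^T) in
  (forall x, K x -> lin nu (x - c) = 0 -> w x = 0) ->
  forall x, w x = 'D_nu w c * lin nu (x - c) + sc ((x - c) *m A *m (x - c)^T).
Proof.
move=> w hw x; rewrite derive_quadr.
set b' := b + A *m c^T + A^T *m c^T.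
have wE z (t : R) : w (c + t *: z) = w c + t * sc (z *m b') + t ^+ 2 * sc (z *m A *m z^T).
  exact: quadr_taylor.
have Kc : K c by rewrite /K /eball/= subrr enormE /nsq big1 ?sqrtr0 ?ltW// => i _; rewrite mxE expr0n.
have wc : w c = 0 by apply: hw => //; rewrite subrr /lin big1// => i _; rewrite mxE mulr0.
(* The values at [c + t z] and [c - t z] both vanish, and their difference isolates the linear term;
   [t] is small enough to stay in the ball. *)
have tang z : lin nu z = 0 -> sc (z *m b') = 0.
  move=> lz; pose t := r / (1 + enorm z).
  have e1 : 0 < 1 + enorm z by rewrite ltr_pwDl ?enorm_ge0.
  have t0 : 0 < t by rewrite divr_gt0.
  have hz (s : R) : `|s| = t -> w (c + s *: z) = 0.
    move=> st; apply: hw; last by rewrite addrC addKr linZ lz mulr0.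
    rewrite /K /eball/= addrC addKr enormZ st /t mulrAC ler_pdivrMr//.
    by rewrite ler_wpM2l ?(ltW r0)// lerDr.
  have := hz t (gtr0_norm t0); have := hz (- t); rewrite normrN => /(_ (gtr0_norm t0)).
  rewrite !wE wc sqrrN => h1 h2.
  have : t * sc (z *m b') = 0 by lra.
  by move/eqP; rewrite mulf_eq0 gt_eqF//= => /eqP.
have -> : w x = w (c + 1 *: (x - c)) by rewrite scale1r [c + _]addrC subrK.
rewrite wE wc add0r mul1r expr1n mul1r; congr (_ + _).
pose z := x - c; rewrite -/z.
(* Removing the normal component makes [z] tangential; this uses that [nu] is a unit vector. *)
have := tang (z - lin nu z *: nu).
rewrite linB linZ lin_nsq nu1 mulr1 subrr => /(_ erefl).
rewrite mulmxBl -scalemxAl -scaleN1r scD scZ scZ; lra.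
Qed.

End jump.

End ball.

End identities.

(** * Residuals and jumps *)

(* B, L and D stand for phi, lap phi and d_k phi, and s for the sign of l; after
   the second one, the summands on the right-hand side integrate to 0. *)
Lemma jump_split (R : realType) (U Y P q1 q2 p1 p2 J l Q beta s L D B d1 d2 e1 e2 : R) :
  Y = (q1 + q2) / 2 + J / 2 * `|l| + s / 2 * Q ->
  P = (p1 + p2) / 2 + beta / 2 * `|l| ->
  (U + (d1 - e1 + (d2 - e2)) / 2 + s / 2 * (d1 - e1 - (d2 - e2))) * B =
  (U * B + Y * L + P * D) + (- (J / 2)) * (`|l| * L) + (- 2^-1) * (q1 * L + (-1) * (d1 * B))
  + (- 2^-1) * (q2 * L + (-1) * (d2 * B)) + (- 2^-1) * (p1 * D + e1 * B)
  + (- 2^-1) * (p2 * D + e2 * B) + (- 2^-1) * (s * (Q * L))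
  + (- (beta / 2)) * (`|l| * D) + ((d1 - e1 - (d2 - e2)) / 2) * (s * B).
Proof. by move=> -> ->; move: `|l| => a; field. Qed.

(** * The jump of the normal derivative across a hyperplane *)

Section jump_bound.
Variables (R : realType) (n : nat) (G : set 'rV[R]_n).
Hypotheses (oG : open G).
Variables (c nu : 'rV[R]_n) (r : R).
Hypotheses (r0 : 0 < r) (KG : eball c r `<=` G) (nu1 : nsq nu = 1).
Let K := eball c r.
Let cK : compact K. Proof. exact: compact_eball. Qed.
Let B := rbump c r.
Let eB : elementary B. Proof. exact: elementary_bump. Qed.
Let sB : supported K B. Proof. exact: bump_supported. Qed.
Let cB : Cc_infty G B. Proof. exact: Cc_infty_bump. Qed.
Let l x := lin nu (x - c).
Let s := side_sign c nu.
Implicit Types (x : 'rV[R]_n).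

Let reflE x : (-1 *: x + (c + c)) - c = - (x - c).
Proof. by rewrite scaleN1r -addrA addrK opprB addrC. Qed.

Lemma has_int_abs_lap : has_int (fun x => `|l x| * lap B x) (\int[leb n]_x (`|l x| * lap B x)).
Proof.
split=> //; apply: (integrable_supported cK).
  apply: continuous_mul; last exact/continuous_elementary/elementary_lap.
  move=> x; apply: (@continuous_comp _ _ _ l (@Num.norm R R)); last exact: norm_continuous.
  exact: (continuous_elementary (elementary_lB c nu)).
by move=> x nx; rewrite (supported_lap cK sB)// mulr0.
Qed.

Lemma has_int_abs_partial k : has_int (fun x => `|l x| * partial k B x) 0.
Proof.
have i1 : (leb n).-integrable setT (EFin \o (fun x => `|l x| * partial k B x)).
  apply: (integrable_supported cK).
    apply: continuous_mul; last exact/continuous_elementary/elementary_partial.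
    move=> x; apply: (@continuous_comp _ _ _ l (@Num.norm R R)); last exact: norm_continuous.
    exact: (continuous_elementary (elementary_lB c nu)).
  by move=> x nx; rewrite (supported_partial k cK sB)// mulr0.
split => //; apply: (@Rintegral_odd_about _ _ c _) => // x.
by rewrite partial_B_refl /l reflE linN normrN mulrN.
Qed.

Lemma has_int_sign_quad (A : 'M[R]_n) :
  has_int (fun x => s x * (sc ((x - c) *m A *m (x - c)^T) * lap B x)) 0.
Proof.
have eq_ : elementary (fun x => sc ((x - c) *m A *m (x - c)^T)).
  rewrite (_ : (fun x => _) = fun x => sc (x *m A *m x^T) +
    ((-1) * sc (x *m (A *m c^T + A^T *m c^T)) + sc (c *m A *m c^T))).
    apply: elementaryD; first exact: elementary_quad.
    apply: elementaryD; last exact: elementary_cst.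
    by apply: elementaryM; [exact: elementary_cst|exact: elementary_lin].
  apply/funext => x; have := quadr_taylor 0 0 A x c (-1).
  rewrite /= !mulmx0 ![sc 0]mxE !add0r scaleN1r => ->.
  rewrite sqrrN expr1n mul1r -[sc (x *m A *m x^T) + _ + _]addrA; congr (_ + (_ * _ + _)).
  by rewrite -[LHS]sc_tr trmx_mul linearD /= !trmx_mul !trmxK !mulmxDr mulmxDl !scD !mulmxA addrC.
apply: (has_int_odd (r := r)).
- by apply: continuous_elementary; apply: elementaryM => //; exact: elementary_lap.
- by move=> x nx; rewrite (supported_lap cK sB)// mulr0.
- move=> x; rewrite lap_B_refl; congr (_ * _); rewrite reflE.
  by rewrite linearN mulNmx mulNmx mulmxN opprK.
Qed.

Lemma has_int_sign_bump : has_int (fun x => s x * B x) 0.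
Proof.
apply: (has_int_odd (r := r)) => //; first exact: continuous_elementary.
by move=> x; rewrite /B B_refl.
Qed.

Lemma bump_integral : has_int B (r ^+ n * bump_mass R n).
Proof.
have [iB _] := has_int_elementary eB cK sB; split => //.
rewrite (@eq_Rintegral _ _ _ _ _ (resc (@bump0 R n) c r))//.
by rewrite Rintegral_resc//; exact/continuous_elementary/elementary_bump0.
Qed.

Lemma has_int_le f a (M : R) : 0 <= M -> has_int f a -> (forall x, `|f x| <= M * B x) ->
  `|a| <= M * (r ^+ n * bump_mass R n).
Proof.
move=> M0 [fi <-] hf; have [iB <-] := has_intZ M bump_integral.
apply: le_trans (le_normr_Rintegral measurableT fi) _.
apply: le_Rintegral => //.
exact: (integrable_norm fi).
Qed.

(** [Y] is the mean of [q1] and [q2] plus half the sign times [q1 - q2], and by [quadr_vanish] this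
    sign turns the difference into [J |l|] plus an odd remainder. The functional minus [J / 2] times
    the integral of [|l| lap B] is thus the integral of the elementwise residuals against the bump,
    bounded by [M]. The 8 is this 2 times the 4 of [abs_lap_B]. *)
Lemma jump_bound U Y P k q1 q2 p1 p2 (M : R) : 0 <= M ->
  sqfun G U -> sqfun G Y -> sqfun G P -> quadr q1 -> quadr q2 -> affr p1 -> affr p2 ->
  (forall x, K x -> 0 <= l x -> [/\ Y x = q1 x, P x = p1 x &
     `|U x + lap q1 x - partial k p1 x| <= M]) ->
  (forall x, K x -> l x <= 0 -> [/\ Y x = q2 x, P x = p2 x &
     `|U x + lap q2 x - partial k p2 x| <= M]) ->
  `|'D_nu q1 c - 'D_nu q2 c| * (r ^+ n * r^-1 * (bump_mass R n / 8)) <=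
  `|momentum_fun G U Y P k B| + M * (r ^+ n * bump_mass R n).
Proof.
move=> M0 sU sY sP hq1 hq2 hp1 hp2 H1 H2.
have [d1 d1E] := lap_quadr hq1; have [d2 d2E] := lap_quadr hq2.
have [e1 e1E] := partial_affr k hp1; have [e2 e2E] := partial_affr k hp2.
have eq1 := quadr_elementary hq1; have eq2 := quadr_elementary hq2.
have ep1 := quadr_elementary (affr_quadr hp1); have ep2 := quadr_elementary (affr_quadr hp2).
(* On the hyperplane both polynomials equal [Y], so [quadr_vanish] applies to their difference. *)
have [A [J [JE wE]]] : exists A, exists J, J = 'D_nu q1 c - 'D_nu q2 c /\
    forall x, q1 x - q2 x = J * l x + sc ((x - c) *m A *m (x - c)^T).
  have [a [b [A hA]]] := hq1; have [a' [b' [A' hA']]] := hq2.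
  exists (A - A'), ('D_nu q1 c - 'D_nu q2 c); split => // x.
  have E z : q1 z - q2 z = (a - a') + sc (z *m (b - b')) + sc (z *m (A - A') *m z^T).
    rewrite hA hA' !mulmxBr mulmxBl /sc !mxE; ring.
  have -> : 'D_nu q1 c - 'D_nu q2 c =
      'D_nu (fun x => (a - a') + sc (x *m (b - b')) + sc (x *m (A - A') *m x^T)) c.
    rewrite (funext hA) (funext hA') !derive_quadr linearB /= !mulmxBl !(mulmxDr, mulmxN) /sc !mxE; ring.
  rewrite E; apply: (quadr_vanish r0 nu1) => z Kz lz; rewrite -E.
  have [<- _ _] : [/\ Y z = q1 z, P z = p1 z & `|U z + lap q1 z - partial k p1 z| <= M].
    by apply: H1; rewrite // /l lz.
  have [<- _ _] : [/\ Y z = q2 z, P z = p2 z & `|U z + lap q2 z - partial k p2 z| <= M].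
    by apply: H2; rewrite // /l lz.
  by rewrite subrr.
have [beta pE] : exists beta, forall x, p1 x - p2 x = beta * l x.
  have [a [b hA]] := hp1; have [a' [b' hA']] := hp2.
  have E z : p1 z - p2 z = (a - a') + sc (z *m (b - b')) + sc (z *m 0 *m z^T).
    rewrite hA hA' !mulmxBr mulmx0 mul0mx /sc !mxE; ring.
  (* For the affine pressures the quadratic form is zero, and the difference is an exact multiple of
     [l]. *)
  have V := @quadr_vanish _ _ c r r0 nu nu1 (a - a') (b - b') 0.
  eexists => x; rewrite E V => [|z Kz lz].
    by rewrite mulmx0 mul0mx [sc 0]mxE addr0.
  rewrite -E; have [_ <- _] : [/\ Y z = q1 z, P z = p1 z & `|U z + lap q1 z - partial k p1 z| <= M].
    by apply: H1; rewrite // /l lz.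
  have [_ <- _] : [/\ Y z = q2 z, P z = p2 z & `|U z + lap q2 z - partial k p2 z| <= M].
    by apply: H2; rewrite // /l lz.
  by rewrite subrr.
have h0 := has_int_momentum oG k sU sY sP cB.
have h1 := has_int_green eq1 eB cK sB; have h2 := has_int_green eq2 eB cK sB.
have h3 := has_int_parts k ep1 eB cK sB; have h4 := has_int_parts k ep2 eB cK sB.
have h5 := has_int_sign_quad A; have h6 := has_int_abs_partial k.
have h7 := has_int_sign_bump; have h8 := has_int_abs_lap.
have X0 := abs_lap_B c r0 nu1; rewrite -/l in X0.
rewrite d1E in h1; rewrite d2E in h2; rewrite e1E in h3; rewrite e2E in h4.
(* The nine summands of [jump_split] in its order; only the first two have integrals that need not
   vanish. *)
have := has_intD (has_intD (has_intD (has_intD (has_intD (has_intD (has_intD (has_intD h0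
  (has_intZ (- (J / 2)) h8)) (has_intZ (- 2^-1) h1)) (has_intZ (- 2^-1) h2))
  (has_intZ (- 2^-1) h3)) (has_intZ (- 2^-1) h4)) (has_intZ (- 2^-1) h5))
  (has_intZ (- (beta / 2)) h6)) (has_intZ ((d1 - e1 - (d2 - e2)) / 2) h7).
rewrite !mulr0 !addr0 => H.
have b0 x : 0 <= B x by exact: bump0_ge0.
have := has_int_le M0 H; rewrite -/B -JE.
move: (momentum_fun _ _ _ _ _ _) (\int[_]_x _) X0 => m X X0 HH.
have {HH} : `|m + - (J / 2) * X| <= M * (r ^+ n * bump_mass R n).
  apply: HH => x.
  have [Kx|nK] := pselect (K x); last first.
    by rewrite sB// (supported_lap cK sB)// (supported_partial k cK sB)// !(mulr0, addr0) normr0.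
  have sl := side_sign_mul c nu x; rewrite -/(l x) -/(s x) in sl.
  have YE : Y x = (q1 x + q2 x) / 2 + J / 2 * `|l x| + s x / 2 * sc ((x - c) *m A *m (x - c)^T) /\
     P x = (p1 x + p2 x) / 2 + beta / 2 * `|l x| /\
     `|U x + (d1 - e1 + (d2 - e2)) / 2 + s x / 2 * (d1 - e1 - (d2 - e2))| <= M.
    have w := wE x; have pw := pE x.
    move: (sc _) w => Q w.
    have [lp|ln|lz] := ltgtP (l x) 0.
    - have [Y2 P2 U2] := H2 x Kx (ltW lp).
      have sx : s x = -1.
        rewrite ltr0_norm// in sl; apply: (mulIf (_ : l x != 0)); first by rewrite lt_eqF.
        by rewrite sl mulN1r.
      rewrite ltr0_norm// sx Y2 P2; split; first lra; split; first lra.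
      move: U2; rewrite d2E e2E; congr (`|_| <= _); lra.
    - have [Y2 P2 U2] := H1 x Kx (ltW ln).
      have sx : s x = 1.
        rewrite gtr0_norm// in sl; apply: (mulIf (_ : l x != 0)); first by rewrite gt_eqF.
        by rewrite sl mul1r.
      rewrite gtr0_norm// sx Y2 P2; split; first lra; split; first lra.
      move: U2; rewrite d1E e1E; congr (`|_| <= _); lra.
    (* On the hyperplane itself the sign is 0 and the factor is the average of the two residuals,
       both bounded by [M]. *)
    - have lx : 0 <= l x by rewrite lz.
      have lx' : l x <= 0 by rewrite lz.
      have [Y1 P1 U1] := H1 x Kx lx.
      have [Y2 P2 U2] := H2 x Kx lx'.
      have sx : s x = 0.
        by rewrite /s /side_sign !indicE !memNset ?subrr//= -/(l x) lz ltxx.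
      rewrite sx lz normr0; split; first lra; split; first lra.
      move: U1 U2; rewrite d1E e1E d2E e2E !ler_norml => /andP[? ?] /andP[? ?].
      by apply/andP; split; lra.
  case: YE => Y1 [P1 U1].
  have E := jump_split (U x) (lap B x) (partial k B x) (B x) d1 d2 e1 e2 Y1 P1.
  by rewrite -E normrM (ger0_norm (b0 x)); apply: ler_wpM2r.
move=> H'.
have bX : `|J| / 2 * X <= `|m| + M * (r ^+ n * bump_mass R n).
  have rb : 0 <= r ^+ n * r^-1 * (bump_mass R n / 4).
    by rewrite !mulr_ge0 ?exprn_ge0 ?invr_ge0 ?(ltW r0)// ltW// bump_mass_gt0.
  have X1 : 0 <= X by exact: le_trans rb X0.
  have -> : `|J| / 2 * X = `|m - (m + - (J / 2) * X)|.
    rewrite opprD addrA subrr sub0r mulNr opprK normrM normrM (ger0_norm X1).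
    by rewrite (@ger0_norm _ 2^-1)// invr_ge0.
  by apply: le_trans (ler_normB _ _) _; rewrite lerD2l.
apply: le_trans bX.
rewrite [leLHS](_ : _ = `|J| / 2 * (r ^+ n * r^-1 * (bump_mass R n / 4))); last by field; rewrite gt_eqF.
by rewrite ler_wpM2l// divr_ge0.
Qed.

End jump_bound.

(** * Residual and divergence on one simplex *)

Section interior.
Variables (R : realType) (n : nat).
Local Notation pt := 'rV[R]_n.+1.
Implicit Types (T : simplex R n) (x c : pt) (k i : 'I_n.+1).

Lemma eball_shrink x0 c (r s rho : R) : eball x0 s c -> s + r <= rho -> eball c r `<=` eball x0 rho.
Proof.
move=> hc h x hx; apply: le_trans h.
have -> : x - x0 = (c - x0) + (x - c) by rewrite [RHS]addrC subrKA.
by apply: le_trans (enormD _ _) _; apply: lerD.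
Qed.

(** The 5 and the 3 come from [quadr_point_bound], and [t / 8] is the smaller test radius relative
    to [h]. In [res_cst], the factor is that of [quadr_extrapolate] from radius [t h / 4] to
    distance [h / t]. *)
Definition point_cst (t : R) : R := 5 * (test_cst R n.+1 * (t / 8) ^- (n.+1 + 2)) / (3 * bump_mass R n.+1).
Definition res_cst (t : R) : R := 4 * (4 / t ^+ 2) ^+ 2 * point_cst t.

Lemma point_cst_ge0 t : 0 < t -> 0 <= point_cst t.
Proof.
move=> t0; have [A1 _ _ _ _] := test_cst_bounds R n.+1.
rewrite divr_ge0// ?mulr_ge0 ?(ltW (bump_mass_gt0 _ _))//; first lra.
by rewrite invr_ge0 exprn_ge0// divr_ge0// ltW.
Qed.

Lemma res_cst_ge0 t : 0 < t -> 0 <= res_cst t.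
Proof. by move=> t0; rewrite mulr_ge0 ?point_cst_ge0// mulr_ge0// sqr_ge0. Qed.

(** Centres at distance at most [t h / 4] from [x0] and the radii [t h / 8] and [t h / 4] keep all
    test balls in the half ball of radius [t h / 2]. The pointwise bounds near [x0] are then
    extrapolated to the whole simplex. *)
Lemma quadr_simplex_bound T x0 (q : pt -> R) (t h E : R) : nondegenerate T ->
  quadr q -> 0 < t <= 1 -> 0 < h -> eball x0 (t * h) `<=` chull T ->
  diam (chull T) <= h / t -> 0 <= E ->
  (forall c (r : R), 0 < r -> t * h / 8 <= r -> eball c r `<=` eball x0 (t * h / 2) ->
     `|\int[leb n.+1]_x (q x * rbump c r x)| <= test_cst R n.+1 * (t / 8) ^- (n.+1 + 2) * E * r ^+ n.+1) ->
  forall x, chull T x -> `|q x| <= res_cst t * E.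
Proof.
move=> nT hq /andP[t0 t1] h0 sub dT E0 H x Tx.
have th0 : 0 < t * h by rewrite mulr_gt0.
have bm0 := bump_mass_gt0 R n.+1.
have r0 : 0 < t * h / 8 by lra.
have [r20 r2] : 0 < 2 * (t * h / 8) /\ t * h / 8 <= 2 * (t * h / 8) by split; lra.
have [s1 s2] : t * h / 4 + t * h / 8 <= t * h / 2 /\ t * h / 4 + 2 * (t * h / 8) <= t * h / 2 by split; lra.
have P c : eball x0 (t * h / 4) c -> `|q c| <= point_cst t * E.
  move=> hc.
  have h1 := H c _ r0 (lexx _) (eball_shrink hc s1).
  have h2 := H c _ r20 r2 (eball_shrink hc s2).
  have := quadr_point_bound hq r0 h1 h2.
  have -> : point_cst t * E =
     5 * (test_cst R n.+1 * (t / 8) ^- (n.+1 + 2) * E) / (3 * bump_mass R n.+1).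
    by rewrite /point_cst mulrAC !mulrA.
  by rewrite ler_pdivlMr ?mulr_gt0// [_ * (3 * _)]mulrC.
rewrite /res_cst -[leRHS]mulrA.
have -> : 4 / t ^+ 2 = (h / t) / (t * h / 4) by field; rewrite !gt_eqF.
have hx0 : eball x0 (t * h / 4) `<=` chull T.
  by move=> z hz; apply: sub; apply: le_trans hz _; lra.
apply: (@quadr_extrapolate _ _ q x0 x (t * h / 4) (h / t) (point_cst t * E)) => //; first lra.
- apply: (@le_trans _ _ h); first nra.
  by rewrite ler_pdivlMr// ler_piMr// ltW.
- apply: le_trans dT; apply: enorm_le_diam => //; apply: sub.
  by rewrite /eball/= subrr enorm0 ltW.
Qed.

Section residuals.
Variables (G S : set pt) (u y uh yh : pt -> pt) (p ph : pt -> R) (Nu Ny Np : R).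
Hypotheses (oG : open G) (lipG : lipschitz_boundary G).
Hypotheses (su : forall k, sqfun G (component u k)) (sy : forall k, sqfun G (component y k))
  (sp : sqfun G p) (suh : forall k, sqfun G (component uh k))
  (syh : forall k, sqfun G (component yh k)) (sph : sqfun G ph).
Hypothesis momentum0 : forall k phi, Cc_infty G phi ->
  momentum_fun G (component u k) (component y k) p k phi = 0.
Hypothesis divergence0 : forall phi, Cc_infty G phi ->
  \sum_i \int[leb n.+1]_(x in G) (component y i x * partial i phi x) = 0.
Hypotheses (Nu0 : 0 <= Nu) (Ny0 : 0 <= Ny) (Np0 : 0 <= Np).
Hypothesis hu : forall k c r, eball c r `<=` S ->
  (sqint (eball c r) (fun x => (component u k x - component uh k x)%R) <= (Nu ^+ 2)%:E)%E.
Hypothesis hy : forall k c r, eball c r `<=` S ->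
  {ae leb n.+1, forall x, eball c r x -> `|component y k x - component yh k x| <= Ny}.
Hypothesis hp : forall c r, eball c r `<=` S ->
  (sqint (eball c r) (fun x => (p x - ph x)%R) <= (Np ^+ 2)%:E)%E.

(** The functional vanishes on the exact solution, so on the discrete one it is minus its value on
    the errors. *)
Lemma discrete_momentum_bound k c r : 0 < r -> eball c r `<=` G -> eball c r `<=` S ->
  `|momentum_fun G (component uh k) (component yh k) ph k (rbump c r)| <=
  test_cst R n.+1 * (r ^+ n.+1 * err n.+1 Nu Ny Np r).
Proof.
move=> r0 rG rS.
have cB := Cc_infty_bump r0 rG.
have := momentum_funB oG k (su k) (sy k) sp (suh k) (syh k) sph cB.
rewrite momentum0// sub0r => E.
rewrite -normrN -E; apply: momentum_bound => //; first exact: sqfunB.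
- exact: sqfunB.
- exact: sqfunB.
- exact: hu.
- exact: hy.
- exact: hp.
Qed.

Lemma discrete_divergence_bound c r : 0 < r -> eball c r `<=` G -> eball c r `<=` S ->
  `|\sum_i \int[leb n.+1]_(x in G) (component yh i x * partial i (rbump c r) x)| <=
  test_cst R n.+1 * (r ^+ n.+1 * (Ny / r)).
Proof.
move=> r0 rG rS; have cB := Cc_infty_bump r0 rG.
have E : \sum_i \int[leb n.+1]_(x in G) ((component y i x - component yh i x) * partial i (rbump c r) x) =
  - \sum_i \int[leb n.+1]_(x in G) (component yh i x * partial i (rbump c r) x).
  rewrite (eq_bigr _ (fun i _ => Rintegral_testB oG (sy i) (syh i) (Cc_infty_partial i cB))).
  by rewrite sumrB divergence0// sub0r.
rewrite -normrN -E.
apply: (@divergence_bound _ _ _ oG (fun i x => component y i x - component yh i x)) => // i.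
- exact: sqfunB.
- exact: hy.
Qed.

Variables (T : simplex R n) (x0 : pt) (t h : R).
Hypotheses (nT : nondegenerate T) (t01 : 0 < t <= 1) (h0 : 0 < h)
  (sub : eball x0 (t * h) `<=` chull T) (dT : diam (chull T) <= h / t)
  (TG : chull T `<=` closure G) (TS : chull T `<=` S).

Let t0 : 0 < t. Proof. by case/andP: t01. Qed.
Let t1 : t <= 1. Proof. by case/andP: t01. Qed.

(** The full ball is only known to lie in the closure of [G]; halving the radius gives the margin
    required by [eball_sub_open]. *)
Let half_ball : eball x0 (t * h / 2) `<=` G.
Proof.
apply: (@eball_sub_open _ _ _ _ _ (t * h)) => //.
  by have := mulr_gt0 t0 h0; lra.
by move=> x /sub /TG.
Qed.

Lemma err_small r : t * h / 8 <= r -> r <= h ->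
  err n.+1 Nu Ny Np r <= (t / 8) ^- (n.+1 + 2) * err n.+1 Nu Ny Np h.
Proof.
move=> r1 r2.
have r0 : 0 < r by apply: lt_le_trans r1; have := mulr_gt0 t0 h0; lra.
have -> : r = (r / h) * h by rewrite divfK// gt_eqF.
apply: le_trans (err_scale _ Nu0 Ny0 Np0 h0 _) _.
  by rewrite divr_gt0// ler_pdivrMr// mul1r.
apply: ler_wpM2r; first exact: err_ge0.
have rh : t / 8 <= r / h by rewrite ler_pdivlMr//; lra.
rewrite lef_pV2 ?posrE ?exprn_gt0 ?divr_gt0//.
by apply: lerXn2r; rewrite ?nnegrE ?divr_ge0// ltW.
Qed.

(** Two opposite points of the inner ball are [2 r] apart and both lie in the outer one. *)
Let radius c r : 0 < r -> eball c r `<=` eball x0 (t * h / 2) -> r <= t * h / 2.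
Proof.
move=> r0 s; have hn : enorm (delta_mx 0 0 : pt) = 1.
  rewrite enormE /nsq (bigD1 ord0)//= big1 => [|j j0].
    by rewrite mxE !eqxx expr1n addr0 sqrtr1.
  by rewrite mxE (negPf j0) andbF expr0n.
have P (a : R) : `|a| = r -> enorm (c + a *: delta_mx 0 0 - x0) <= t * h / 2.
  by move=> ar; apply: s; rewrite /eball/= addrC addKr enormZ hn mulr1 ar.
have := P r (gtr0_norm r0); have := P (- r); rewrite normrN => /(_ (gtr0_norm r0)) h1 h2.
have : enorm ((r + r) *: (delta_mx 0 0 : pt)) <= t * h / 2 + t * h / 2.
  have -> : (r + r) *: (delta_mx 0 0 : pt) =
     (c + r *: delta_mx 0 0 - x0) - (c + (- r) *: delta_mx 0 0 - x0).
    by apply/rowP => j; rewrite !mxE; ring.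
  by apply: le_trans (enormD _ _) _; rewrite enormN; exact: lerD.
rewrite enormZ hn mulr1 gtr0_norm; lra.
Qed.

Lemma residual_bound k (uq yq pq : pt -> R) : quadr uq -> quadr yq -> affr pq ->
  (forall x, chull T x -> [/\ component uh k x = uq x, component yh k x = yq x & ph x = pq x]) ->
  forall x, chull T x ->
  `|uq x + lap yq x - partial k pq x| <= res_cst t * err n.+1 Nu Ny Np h.
Proof.
move=> hq1 hq2 hq3 HT.
have th0 : 0 < t * h by exact: mulr_gt0.
have [A1 _ _ _ _] := test_cst_bounds R n.+1.
apply: (quadr_simplex_bound (x0 := x0) (t := t) (h := h)) => //.
(* The Laplacian of a quadratic polynomial and the gradient of an affine one are constants, so the
   residual is quadratic like [uq]. *)
- have [d ->] := lap_quadr hq2; have [e ->] := partial_affr k hq3.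
  rewrite (_ : (fun x => _) = fun x => uq x + (d - e)); last by apply/funext => x; ring.
  by apply: quadrD => //; exact/affr_quadr/affr_cst.
- exact: err_ge0.
- move=> c r r0 r1 rs.
  have rT : eball c r `<=` chull T.
    by move=> z /rs hz; apply: sub; apply: le_trans hz _; lra.
  have rG : eball c r `<=` G by move=> z /rs /half_ball.
  rewrite -(momentum_interior oG r0 rG k (suh k) (syh k) sph hq1 hq2 hq3); last first.
    by move=> z /rT /HT.
  apply: le_trans (discrete_momentum_bound k r0 rG _) _; first by move=> z /rT /TS.
  rewrite -!mulrA; apply: ler_wpM2l; first lra.
  rewrite mulrC mulrA; apply: ler_wpM2r; first by rewrite exprn_ge0// ltW.
  apply: err_small => //.
  have := radius r0 rs; have : t * h <= h by rewrite ler_piMl// ltW.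
  lra.
Qed.

(** Scaling would cost only [(t / 8)^-1]; the larger power of [quadr_simplex_bound] is accepted so
    that one constant serves both residuals. *)
Lemma divergence_residual_bound (yq : 'I_n.+1 -> pt -> R) : (forall i, quadr (yq i)) ->
  (forall i x, chull T x -> component yh i x = yq i x) ->
  forall x, chull T x ->
  `|\sum_i partial i (yq i) x| <= res_cst t * (Ny / h).
Proof.
move=> hq HT.
have th0 : 0 < t * h by exact: mulr_gt0.
have [A1 _ _ _ _] := test_cst_bounds R n.+1.
apply: (quadr_simplex_bound (x0 := x0) (t := t) (h := h)) => //.
- by apply: quadr_sum => i _; exact/affr_quadr/partial_quadr.
- by rewrite divr_ge0// ltW.
- move=> c r r0 r1 rs.
  have rT : eball c r `<=` chull T.
    by move=> z /rs hz; apply: sub; apply: le_trans hz _; lra.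
  have rG : eball c r `<=` G by move=> z /rs /half_ball.
  rewrite -normrN -(divergence_interior oG r0 rG syh hq); last first.
    by move=> i z /rT /HT; exact.
  apply: le_trans (discrete_divergence_bound r0 rG _) _; first by move=> z /rT /TS.
  rewrite [leRHS](_ : _ = test_cst R n.+1 * (r ^+ n.+1 * (Ny * ((t / 8) ^- (n.+1 + 2) * h^-1)))); last by ring.
  apply: ler_wpM2l; first lra.
  apply: ler_wpM2l; first by rewrite exprn_ge0// ltW.
  apply: ler_wpM2l => //.
  have t8 : 0 < t / 8 by rewrite divr_gt0.
  have t8' : t / 8 <= 1 by have := t1; lra.
  have : r^-1 <= (t / 8)^-1 * h^-1.
    rewrite -invfM lef_pV2 ?posrE ?mulr_gt0//; by apply: le_trans r1; rewrite mulrAC.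
  move/le_trans; apply; rewrite ler_wpM2r ?invr_ge0 ?(ltW h0)//.
  rewrite lef_pV2 ?posrE ?exprn_gt0// addnS exprS ler_piMr ?exprn_ile1 ?(ltW t8)//.
Qed.

End residuals.
End interior.

(** * The jump on a shared side *)

Section sides.
Variables (R : realType) (n : nat).
Local Notation pt := 'rV[R]_n.+1.
Implicit Types (T : simplex R n) (x c : pt) (k : 'I_n.+1) (i j m : 'I_n.+2).

Lemma affr_midpoint (f : pt -> R) c x : affr f -> f x = 2 * f (2^-1 *: (c + x)) - f c.
Proof. by move=> [a [b h]]; rewrite !h -scalemxAl mulmxDl scZ scD; field. Qed.

Definition side_center T i : pt := (\row_m (if m == i then 0 else n.+1%:R^-1)) *m T.

(** Half the coordinates of the barycentre of a side: the midpoint between the barycentre and any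
    point of the side has at least this depth. *)
Definition side_depth : R := 2^-1 * n.+1%:R^-1.

Lemma side_depth01 : 0 < side_depth <= 1.
Proof.
rewrite mulr_gt0 ?invr_gt0//=; apply: mulr_ile1; rewrite ?invr_ge0 ?invf_le1 ?ler1n//.
Qed.

Lemma bary_side_center T i m : nondegenerate T ->
  bary T m (side_center T i) = if m == i then 0 else n.+1%:R^-1.
Proof.
move=> nT; rewrite bary_comb ?mxE//.
rewrite (bigD1 i)//= mxE eqxx add0r (eq_bigr (fun=> n.+1%:R^-1)); last first.
  by move=> k ki; rewrite mxE (negPf ki).
rewrite sumr_const.
rewrite (_ : #|_| = n.+1); last by rewrite (eq_card (B := predC1 i)) ?cardC1 ?card_ord.
by rewrite -(mulr_natr (n.+1%:R^-1)) mulVf.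
Qed.

Lemma inner_side_center T i : nondegenerate T -> inner_side T i side_depth (side_center T i).
Proof.
move=> nT; split; first by rewrite bary_side_center// eqxx.
move=> k ki; rewrite bary_side_center// (negPf ki) ler_piMl ?invr_ge0// invf_le1//.
by rewrite ler1n.
Qed.

Lemma inner_side_midpoint T i x : nondegenerate T -> chull (side T i) x ->
  inner_side T i side_depth (2^-1 *: (side_center T i + x)).
Proof.
move=> nT /(chull_side i _ nT)[x0 xk]; split => [|k ki].
  by have := affr_midpoint (side_center T i) x (affr_bary T i); rewrite bary_side_center// eqxx; lra.
have := affr_midpoint (side_center T i) x (affr_bary T k).
rewrite bary_side_center// (negPf ki) /side_depth; have := xk k; move: (n.+1%:R^-1 : R) => a; lra.
Qed.

Lemma derive_sum_partial (q : pt -> R) nu x : quadr q ->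
  'D_nu q x = \sum_k partial k q x * nu ord0 k.
Proof.
move=> [a [b [A hq]]]; rewrite (funext hq) derive_quadr.
under eq_bigr => k _ do rewrite /partial derive_quadr.
set w := b + _ + _; rewrite /sc mxE; apply: eq_bigr => k _.
by rewrite -rowE !mxE mulrC.
Qed.

(** What [jump_bound] yields at radius [t * side_depth / 4 * h] after division by an eighth of the
    mass: one summand for the functional, one for the residuals of the two elements. *)
Definition jump_cst (t : R) : R :=
  8 / bump_mass R n.+1 * (test_cst R n.+1 * (t * side_depth / 4) ^- (n.+1 + 2) +
    res_cst n t * bump_mass R n.+1).

Lemma jump_cst_ge0 t : 0 < t -> 0 <= jump_cst t.
Proof.
move=> t0; have [A1 _ _ _ _] := test_cst_bounds R n.+1.
have bm := ltW (bump_mass_gt0 R n.+1); have /andP[d0 _] := side_depth01.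
rewrite mulr_ge0 ?divr_ge0// addr_ge0// mulr_ge0 ?res_cst_ge0//; first lra.
by rewrite invr_ge0 exprn_ge0// divr_ge0// mulr_ge0// ltW.
Qed.

Section shared_side.
Variables (G S : set pt) (M : mesh R n) (u y uh yh : pt -> pt) (p ph : pt -> R) (Nu Ny Np : R).
Hypotheses (n0 : (0 < n)%N) (oG : open G) (lipG : lipschitz_boundary G) (cM : conforming_mesh G M).
Hypotheses (su : forall k, sqfun G (component u k)) (sy : forall k, sqfun G (component y k))
  (sp : sqfun G p) (suh : forall k, sqfun G (component uh k))
  (syh : forall k, sqfun G (component yh k)) (sph : sqfun G ph).
Hypothesis momentum0 : forall k phi, Cc_infty G phi ->
  momentum_fun G (component u k) (component y k) p k phi = 0.
Hypotheses (Nu0 : 0 <= Nu) (Ny0 : 0 <= Ny) (Np0 : 0 <= Np).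
Hypothesis hu : forall k c r, eball c r `<=` S ->
  (sqint (eball c r) (fun x => (component u k x - component uh k x)%R) <= (Nu ^+ 2)%:E)%E.
Hypothesis hy : forall k c r, eball c r `<=` S ->
  {ae leb n.+1, forall x, eball c r x -> `|component y k x - component yh k x| <= Ny}.
Hypothesis hp : forall c r, eball c r `<=` S ->
  (sqint (eball c r) (fun x => (p x - ph x)%R) <= (Np ^+ 2)%:E)%E.
Variables (T T' : simplex R n) (i j : 'I_n.+2) (x0 x0' : pt) (t h : R).
Hypotheses (TM : T \in M) (TM' : T' \in M) (TT' : T' != T)
  (hS : chull (side T i) = chull (side T' j)).
Hypotheses (t01 : 0 < t <= 1) (h0 : 0 < h)
  (sub : eball x0 (t * h) `<=` chull T) (dT : diam (chull T) <= h / t)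
  (sub' : eball x0' (t * h) `<=` chull T') (dT' : diam (chull T') <= h / t)
  (TS : chull T `<=` S) (TS' : chull T' `<=` S).

Let t0 : 0 < t. Proof. by case/andP: t01. Qed.
Let t1 : t <= 1. Proof. by case/andP: t01. Qed.
Let th0 : 0 < t * h. Proof. exact: mulr_gt0. Qed.
Let nT : nondegenerate T. Proof. by case: cM => + _ _; apply. Qed.
Let nT' : nondegenerate T'. Proof. by case: cM => + _ _; apply. Qed.
Let TG : chull T `<=` closure G.
Proof. by case: cM => _ -> _ x; exists T. Qed.
Let TG' : chull T' `<=` closure G.
Proof. by case: cM => _ -> _ x; exists T'. Qed.
Let g := bgrad T i.
Let g0 : 0 < enorm g. Proof. by rewrite enorm_gt0 bgrad_neq0. Qed.
Let nu := (enorm g)^-1 *: g.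

Let nu1 : nsq nu = 1.
Proof. by rewrite nsqZ -sqr_enorm -exprMn mulVf ?expr1n ?gt_eqF. Qed.

Let linE c x : bary T i c = 0 -> lin nu (x - c) = (enorm g)^-1 * bary T i x.
Proof. by move=> hc; rewrite linZl -baryB hc subr0. Qed.

Let opp : exists2 kappa, kappa < 0 & forall x, bary T' j x = kappa * bary T i x.
Proof.
exact: (shared_opposite nT nT' hS side_depth01 (inner_side_center i nT) cM TM TM' TT').
Qed.

(** The coordinates of the two simplices that vanish on the side are negative multiples of each
    other, hence so are their gradients. *)
Lemma side_normal_shared : side_normal (side T i) T = nu /\ side_normal (side T i) T' = - nu.
Proof.
split; first by rewrite (side_normalE nT (i := i))// bgrad_neq0.
have [kappa k0 kE] := opp.
have gE : bgrad T' j = kappa *: g.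
  have L v : lin (bgrad T' j) v = lin (kappa *: g) v.
    have := baryB T' j 0 v; rewrite !subr0 !kE -mulrBr => <-.
    by rewrite linZl -[in RHS](subr0 v) -baryB.
  by apply/rowP => m; have := L (delta_mx 0 m); rewrite /lin (bigD1 m)//= [in RHS](bigD1 m)//=
    !big1 ?addr0 ?mxE ?eqxx ?mulr1// => l lm; rewrite !mxE (negPf lm) andbF mulr0.
rewrite (side_normalE nT' (i := j))// ?bgrad_neq0// gE enormZ ltr0_norm//.
by rewrite /nu scalerA invfM mulrAC invrN mulNr mulVf ?lt_eqF// mulN1r scaleNr.
Qed.

Variables (k : 'I_n.+1) (u1 u2 q1 q2 p1 p2 : pt -> R).
Hypotheses (hu1 : quadr u1) (hu2 : quadr u2) (hq1 : quadr q1) (hq2 : quadr q2)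
  (hp1 : affr p1) (hp2 : affr p2).
Hypothesis hT : forall x, chull T x ->
  [/\ component uh k x = u1 x, component yh k x = q1 x & ph x = p1 x].
Hypothesis hT' : forall x, chull T' x ->
  [/\ component uh k x = u2 x, component yh k x = q2 x & ph x = p2 x].

Lemma jump_inner_bound c : inner_side T i side_depth c ->
  `|'D_nu q1 c - 'D_nu q2 c| <= h * (jump_cst t * err n.+1 Nu Ny Np h).
Proof.
move=> hc; have [A1 _ _ _ _] := test_cst_bounds R n.+1.
have bm0 := bump_mass_gt0 R n.+1.
have /andP[d0 d1] := side_depth01.
have hc' := inner_side_shared nT nT' hS side_depth01 hc.
(* The ball of radius [side_depth / 2 * (t h)] is covered by the two simplices, the depth being
   halved in passing to [T']. Half of this radius leaves the margin needed to lie in the open set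
   [G]. *)
pose r := t * side_depth / 4 * h.
have [kappa k0 kE] := opp.
have ts0 : 0 < t * side_depth by exact: mulr_gt0.
have r0 : 0 < r by rewrite mulr_gt0// divr_gt0.
have rr : r < side_depth / 2 * (t * h).
  rewrite /r (_ : side_depth / 2 * (t * h) = t * side_depth / 2 * h); last by ring.
  by rewrite ltr_pM2r//; lra.
have rh : r <= h.
  rewrite /r ler_piMl ?ltW// ltr_pdivrMr// mul1r.
  have : t * side_depth <= 1 by rewrite mulr_ile1// ltW.
  by move: (t * side_depth) => a; lra.
have inT x : eball c (side_depth / 2 * (t * h)) x -> 0 <= bary T i x -> chull T x.
  move=> hx; apply: (inner_ball nT th0 d0 _ hc).
    by move=> m; exact: (bgrad_bound m nT th0 sub).
  apply: le_trans hx _; apply: ler_wpM2r; first exact: ltW.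
  by rewrite ler_pdivrMr// ler_peMr ?(ltW d0)//; lra.
have inT' x : eball c (side_depth / 2 * (t * h)) x -> bary T i x <= 0 -> chull T' x.
  move=> hx bx; have d20 : 0 < side_depth / 2 by rewrite divr_gt0.
  apply: (inner_ball nT' th0 d20 _ hc') => //.
    by move=> m; exact: (bgrad_bound m nT' th0 sub').
  by rewrite kE; apply: mulr_le0 => //; exact: ltW.
have KG : eball c r `<=` G.
  apply: (eball_sub_open oG lipG rr) => x hx.
  by have [b|/ltW b] := leP 0 (bary T i x); [exact/TG/inT|exact/TG'/inT'].
have shrink x : eball c r x -> eball c (side_depth / 2 * (t * h)) x.
  by move=> hx; apply: le_trans hx _; exact: ltW.
have KS : eball c r `<=` S.
  move=> x /shrink hx.
  by have [b|/ltW b] := leP 0 (bary T i x); [exact/TS/inT|exact/TS'/inT'].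
have gi : 0 < (enorm g)^-1 by rewrite invr_gt0.
have E0 := err_ge0 n.+1 Nu0 Ny0 Np0 h0.
have M0 : 0 <= res_cst n t * err n.+1 Nu Ny Np h by rewrite mulr_ge0// res_cst_ge0.
have RB := residual_bound oG lipG su sy sp suh syh sph momentum0 Nu0 Ny0 Np0 hu hy hp
  nT t01 h0 sub dT TG TS hu1 hq1 hp1 hT.
have RB' := residual_bound oG lipG su sy sp suh syh sph momentum0 Nu0 Ny0 Np0 hu hy hp
  nT' t01 h0 sub' dT' TG' TS' hu2 hq2 hp2 hT'.
have JB := jump_bound oG r0 KG nu1 (k := k) (U := component uh k) (Y := component yh k) (P := ph)
  M0 (suh k) (syh k) sph hq1 hq2 hp1 hp2.
have {}JB : `|'D_nu q1 c - 'D_nu q2 c| * (r ^+ n.+1 * r^-1 * (bump_mass R n.+1 / 8)) <=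
  `|momentum_fun G (component uh k) (component yh k) ph k (rbump c r)| +
   res_cst n t * err n.+1 Nu Ny Np h * (r ^+ n.+1 * bump_mass R n.+1).
  apply: JB => x Kx; rewrite linE ?(proj1 hc)//.
    rewrite pmulr_rge0// => b; have Tx := inT x (shrink x Kx) b.
    by have := RB x Tx; have [-> -> ->] := hT Tx.
  rewrite pmulr_rle0// => b; have Tx := inT' x (shrink x Kx) b.
  by have := RB' x Tx; have [-> -> ->] := hT' Tx.
have MB := discrete_momentum_bound oG su sy sp suh syh sph momentum0 Nu0 Ny0 Np0 hu hy hp k r0 KG KS.
have ES : err n.+1 Nu Ny Np r <= (t * side_depth / 4) ^- (n.+1 + 2) * err n.+1 Nu Ny Np h.
  apply: err_scale => //; rewrite divr_gt0//= ler_pdivrMr// mul1r.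
  have : t * side_depth <= 1 by rewrite mulr_ile1// ltW.
  by move: (t * side_depth) => a; lra.
have rn : 0 < r ^+ n.+1 by rewrite exprn_gt0.
have {JB MB} := le_trans JB (lerD MB (lexx _)).
have -> : `|'D_nu q1 c - 'D_nu q2 c| * (r ^+ n.+1 / r * (bump_mass R n.+1 / 8)) =
  r ^+ n.+1 * (`|'D_nu q1 c - 'D_nu q2 c| * (r^-1 * (bump_mass R n.+1 / 8))) by ring.
rewrite [X in _ <= X + _]mulrCA [X in _ <= _ + X]mulrCA -mulrDr ler_pM2l//.
have -> : r^-1 * (bump_mass R n.+1 / 8) = (8 / bump_mass R n.+1 * r)^-1.
  by rewrite !(invfM, invrK); ring.
rewrite ler_pdivrMr; last by rewrite mulr_gt0// divr_gt0.
move/le_trans; apply.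
have J1 : test_cst R n.+1 * err n.+1 Nu Ny Np r + res_cst n t * err n.+1 Nu Ny Np h * bump_mass R n.+1
  <= (test_cst R n.+1 * (t * side_depth / 4) ^- (n.+1 + 2) + res_cst n t * bump_mass R n.+1) *
     err n.+1 Nu Ny Np h.
  rewrite [leRHS]mulrDl -[X in _ <= X + _]mulrA [X in _ + X <= _]mulrAC lerD2r.
  by apply: ler_wpM2l ES; lra.
apply: (le_trans (ler_wpM2r _ J1)).
  by rewrite mulr_ge0 ?divr_ge0// ltW.
rewrite (_ : _ * (8 / _ * r) = r * (jump_cst t * err n.+1 Nu Ny Np h)).
  by apply: ler_wpM2r rh; rewrite mulr_ge0// jump_cst_ge0.
rewrite /jump_cst; ring.
Qed.

(** The jump is affine: its value at [x] is twice the value at the midpoint towards the barycentre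
    minus the value at the barycentre, and both points are inner ones. This costs the factor
    [2 + 1]. *)
Lemma jump_on_side x : chull (side T i) x ->
  `|'D_nu q1 x - 'D_nu q2 x| <= 3 * (h * (jump_cst t * err n.+1 Nu Ny Np h)).
Proof.
move=> Sx; pose f z := 'D_nu q1 z - 'D_nu q2 z.
have af : affr f.
  rewrite (_ : f = fun z => \sum_k nu ord0 k * partial k q1 z + (-1) * \sum_k nu ord0 k * partial k q2 z).
    by apply: affrD; [|apply: affrZ]; apply: affr_sum => l _; apply: affrZ; exact: partial_quadr.
  apply/funext => z; rewrite /f !derive_sum_partial// mulN1r.
  by congr (_ - _); apply: eq_bigr => l _; rewrite mulrC.
have := affr_midpoint (side_center T i) x af; rewrite /f => ->.
have b1 := jump_inner_bound (inner_side_midpoint nT Sx).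
have b2 := jump_inner_bound (inner_side_center i nT).
apply: le_trans (ler_normB _ _) _; rewrite normrM (@ger0_norm _ 2)//.
move: b1 b2; move: (h * _) `|_| `|_| => B b1 b2; lra.
Qed.

End shared_side.
End sides.

(** For the inner sum of [jump_norm]: at most one element lies across a given side. *)
Lemma sum_unique_le (R : realType) (I : eqType) (s : seq I) (P : pred I) (F : I -> \bar R) (B : R) :
  uniq s -> 0 <= B -> {in s &, forall i j, P i -> P j -> i = j} ->
  {in s, forall i, P i -> (F i <= B%:E)%E} -> (\sum_(i <- s | P i) F i <= B%:E)%E.
Proof.
move=> us B0 hP hF; have [/hasP[i si Pi]|/hasPn nP] := boolP (has P s); last first.
  by rewrite big_seq_cond big1 ?lee_fin// => i /andP[/nP /negPf ->].
rewrite big_mkcond (bigD1_seq i)//= Pi big_seq_cond big1 ?adde0; first exact: hF.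
by move=> j /andP[sj]; case: ifP => // Pj; rewrite (hP j i)// eqxx.
Qed.

(** * Size and uniqueness of neighbours, surface integrals *)

Section side_geometry.
Variables (R : realType) (n : nat).
Local Notation pt := 'rV[R]_n.+1.
Implicit Types (T : simplex R n) (x c : pt) (i j k : 'I_n.+2).

Lemma local_polyP (k : nat) T (v : pt -> R) : (exists2 p, is_Pk k p & forall x, chull T x -> v x = p x) ->
  is_Pk k (local_poly k T v) /\ forall x, chull T x -> v x = local_poly k T v x.
Proof.
move=> [p hp pv]; have := @xgetPex _ (fun=> 0)
  [set p | is_Pk k p /\ forall x, chull T x -> p x = v x].
move=> [|h1 h2]; first by exists p; split => // x /pv.
by split => // x /h2.
Qed.

(** The common side contains an edge of [T], along which a barycentric coordinate drops from 1 to 0.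
    As its gradient is at most [2 s / h], this edge, contained in [T'], is at least [h / (2 s)]
    long. *)
Lemma neighbour_size T T' i j (s : R) : (0 < n)%N -> nondegenerate T -> nondegenerate T' ->
  chull (side T i) = chull (side T' j) -> 1 <= s ->
  diam (chull T) <= s * inball_diam (chull T) ->
  diam (chull T) <= 2 * s * diam (chull T').
Proof.
move=> n0 nT nT' hS s1 hd; have [x0 hx0] := inball_exists nT s1 hd.
have d0 := diam_gt0 nT; set h := diam (chull T) in d0 hx0 *.
have s0 : 0 < s by lra.
have [k [l [ki li kl]]] : exists k l, [/\ k != i, l != i & k != l].
  have h1 : (0 < n.+1)%N by []. have h2 : (1 < n.+1)%N by [].
  exists (lift i (Ordinal h1)), (lift i (Ordinal h2)).
  by split; rewrite ?[_ == i]eq_sym ?neq_lift// (inj_eq lift_inj).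
have r0 : 0 < h / (4 * s) by rewrite divr_gt0// mulr_gt0.
have gb := bgrad_bound k nT r0 hx0.
have := lin_norm_le (bgrad T k) (row k T - row l T).
rewrite -baryB !bary_row// eqxx (negPf kl) subr0 normr1 => g1.
have le' : enorm (row k T - row l T) <= diam (chull T').
  apply: enorm_le_diam => //.
    by have := side_vertex nT ki; rewrite hS => /(chull_side j _ nT')[_ /(chullP _ nT')].
  by have := side_vertex nT li; rewrite hS => /(chull_side j _ nT')[_ /(chullP _ nT')].
move: le' gb g1; move: (enorm (bgrad T k)) (enorm_ge0 (row k T - row l T)).
move: (enorm (_ - _)) (diam (chull T')) => b d a b0 bd gb g1.
have : h / (2 * s) <= d.
  apply: le_trans bd; rewrite -[leLHS]mulr1.
  have h20 : 0 < h / (2 * s) by rewrite divr_gt0// mulr_gt0.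
  have h2E : 2 * (h / (4 * s)) = h / (2 * s) by field; rewrite gt_eqF.
  rewrite h2E in gb.
  apply: le_trans (ler_wpM2l (ltW h20) g1) _.
  by rewrite mulrA ler_piMl.
by rewrite ler_pdivrMr ?mulr_gt0// mulrC.
Qed.

(** Both neighbours lie opposite to [T], so a point slightly beyond the barycentre of the side, seen
    from the apex of [T], is interior to both. *)
Lemma unique_neighbour (A : set pt) (M : mesh R n) T T1 T2 i :
  conforming_mesh A M -> T \in M -> shared_side M T i T1 -> shared_side M T i T2 -> T1 = T2.
Proof.
move=> cM TM [TM1 TT1 [j1 hS1]] [TM2 TT2 [j2 hS2]].
have nT : nondegenerate T by case: cM => + _ _; apply.
have nT1 : nondegenerate T1 by case: cM => + _ _; apply.
have nT2 : nondegenerate T2 by case: cM => + _ _; apply.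
have d01 := side_depth01 R n; have hc := inner_side_center i nT; set c := side_center T i in hc.
have [k1 k10 E1] := shared_opposite nT nT1 hS1 d01 hc cM TM TM1 TT1.
have [k2 k20 E2] := shared_opposite nT nT2 hS2 d01 hc cM TM TM2 TT2.
have [_ h1] := inner_side_shared nT nT1 hS1 d01 hc.
have [_ h2] := inner_side_shared nT nT2 hS2 d01 hc.
have [bc _] := hc.
have d20 : 0 < side_depth R n / 2 by case/andP: d01 => ? _; rewrite divr_gt0.
set dd := side_depth R n / 2 in h1 h2 d20.
pose z := c - row i T.
have bz : lin (bgrad T i) z = -1.
  by rewrite /z -baryB bc bary_row// eqxx sub0r.
(* Exceeds by at least 1 the rate of change of every coordinate along [z], so the step [dd / L]
   keeps those starting at [dd] or above positive. *)
pose L := 1 + \sum_k `|lin (bgrad T1 k) z| + \sum_k `|lin (bgrad T2 k) z|.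
have S1 : 0 <= \sum_k `|lin (bgrad T1 k) z| by apply: sumr_ge0.
have S2 : 0 <= \sum_k `|lin (bgrad T2 k) z| by apply: sumr_ge0.
have L0 : 0 < L by rewrite /L; lra.
have L1 k : `|lin (bgrad T1 k) z| <= L - 1.
  rewrite /L (bigD1 k)//= (_ : _ - 1 = `|lin (bgrad T1 k) z| + (\sum_(k0 < n.+2 | k0 != k) `|lin (bgrad T1 k0) z| + \sum_k `|lin (bgrad T2 k) z|)); last by ring.
  by rewrite lerDl addr_ge0// sumr_ge0.
have L2 k : `|lin (bgrad T2 k) z| <= L - 1.
  rewrite /L [X in _ + X - 1](bigD1 k)//= (_ : _ - 1 = `|lin (bgrad T2 k) z| + (\sum_(k0 < n.+2 | k0 != k) `|lin (bgrad T2 k0) z| + \sum_k `|lin (bgrad T1 k) z|)); last by ring.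
  by rewrite lerDl addr_ge0// sumr_ge0.
pose t := dd / L; have t0 : 0 < t by rewrite divr_gt0.
have tL : t * L = dd by rewrite divfK// gt_eqF.
clearbody L t dd.
have P (b l : R) : dd <= b -> `|l| <= L - 1 -> 0 < b + t * l.
  by rewrite ler_norml => db /andP[l1 _]; nra.
apply: (@conforming_interior _ _ A M T1 T2 (c + t *: z)) => // k.
- rewrite bary_line; have [->|kj] := eqVneq k j1; last by apply: P => //; exact: h1.
  by rewrite -bary_line E1 bary_line bc bz add0r mulrN1 mulrN oppr_gt0 pmulr_llt0.
- rewrite bary_line; have [->|kj] := eqVneq k j2; last by apply: P => //; exact: h2.
  by rewrite -bary_line E2 bary_line bc bz add0r mulrN1 mulrN oppr_gt0 pmulr_llt0.
Qed.

(** Leibniz expansion over the [m!] permutations; used for the Gram determinant of the edges of a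
    side. *)
Lemma det_le m (A : 'M[R]_m) (B : R) : (forall i j : 'I_m, `|A i j| <= B) ->
  `|\det A| <= m`!%:R * B ^+ m.
Proof.
move=> hA; rewrite /determinant; apply: le_trans (ler_norm_sum _ _ _) _.
apply: (@le_trans _ _ (\sum_(s : 'S_m) B ^+ m)); last by rewrite sumr_const card_Sn mulr_natl.
apply: ler_sum => s _; rewrite normrM normr_sign mul1r normr_prod.
rewrite [leRHS](_ : _ = \prod_(i < m) B); last by rewrite prodr_const card_ord.
by apply: ler_prod => l _; rewrite normr_ge0 hA.
Qed.

(** The first factor comes from the Gram determinant; the second bounds the volume of the reference
    simplex, which lies in the unit ball. *)
Definition side_cst : R := (Num.sqrt n`!%:R) * fine (leb n (@unit_ball R n)).

Lemma side_cst_ge0 : 0 <= side_cst.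
Proof. by rewrite mulr_ge0 ?sqrtr_ge0 ?fine_ge0. Qed.

Lemma side_integral_le T i (f : pt -> R) (B : R) : nondegenerate T -> 0 <= B ->
  (forall x, chull (side T i) x -> 0 <= f x <= B) ->
  (side_integral (side T i) f <= (side_cst * (diam (chull T) ^+ n * B))%:E)%E.
Proof.
move=> nT B0 hf; set S := side T i; set h := diam _.
have h0 : 0 < h by exact: diam_gt0.
have ST x : chull S x -> chull T x by move=> /(chull_side i _ nT)[_ /(chullP _ nT)].
have SR (k : 'I_n.+1) : chull S (row k S).
  exists (delta_mx 0 k); split; last by rewrite rowE.
    by move=> l; rewrite mxE; case: (_ && _).
  by rewrite (bigD1 k)//= big1 ?addr0 ?mxE ?eqxx// => l lk; rewrite mxE (negPf lk) andbF.
have dS : Num.sqrt (\det (edges S *m (edges S)^T)) <= Num.sqrt n`!%:R * h ^+ n.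
  have -> : Num.sqrt n`!%:R * h ^+ n = Num.sqrt (n`!%:R * (h ^+ 2) ^+ n).
    rewrite sqrtrM ?ler0n// -exprM mulnC exprM sqrtr_sqr ger0_norm// exprn_ge0// ltW//.
  apply: ler_wsqrtr; apply: le_trans (ler_norm _) _; apply: det_le => k l.
  have -> : (edges S *m (edges S)^T) k l = lin (row k (edges S)) (row l (edges S)).
    by rewrite mxE; apply: eq_bigr => m _; rewrite !mxE.
  apply: le_trans (lin_norm_le _ _) _; rewrite expr2.
  have E m : enorm (row m (edges S)) <= h.
    by rewrite rowK; apply: enorm_le_diam => //; exact/ST/SR.
  by apply: ler_pM; rewrite ?enorm_ge0.
have fin : leb n (@unit_ball R n) \is a fin_num.
  by rewrite ge0_fin_numE//; apply: leb_compact_lty; exact: compact_unit_ball.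
have Sref s : ref_simplex s -> chull S (row ord0 S + s *m edges S).
  move=> [s0 s1].
  pose e : 'rV[R]_n.+1 := \row_k if unlift ord0 k is Some l then s ord0 l else 1 - \sum_l s ord0 l.
  have e0 : e ord0 ord0 = 1 - \sum_l s ord0 l by rewrite mxE unlift_none.
  have eS l : e ord0 (lift ord0 l) = s ord0 l by rewrite mxE liftK.
  exists e; split.
  - by move=> k; case: (unliftP ord0 k) => [l ->|->]; rewrite ?eS ?e0// subr_ge0.
  - by rewrite big_ord_recl e0 (eq_bigr _ (fun l _ => eS l)) subrK.
  rewrite [e *m S]mulmx_sum_row big_ord_recl e0.
  rewrite [X in _ = _ + X](eq_bigr (fun l => s ord0 l *: row (lift ord0 l) S)); last first.
    by move=> l _; rewrite eS.
  rewrite mulmx_sum_row (eq_bigr (fun l => s ord0 l *: row (lift ord0 l) S - s ord0 l *: row ord0 S)); last first.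
    by move=> l _; rewrite rowK scalerBr.
  by rewrite sumrB -scaler_suml scalerBl scale1r addrCA [LHS]addrC.
have I : (\int[leb n]_(s in ref_simplex (R := R) (n := n)) (f (row ord0 S + s *m edges S))%:E <=
    B%:E * leb n (@unit_ball R n))%E.
  apply: integral_subset_le => //.
  - by apply: compact_measurable_rV; exact: compact_unit_ball.
  - move=> s [s0 s1]; rewrite /unit_ball /eball /= subr0 enormE -sqrtr1 ler_sqrt// .
    have sl (k : 'I_n) : s ord0 k <= 1.
      by apply: le_trans s1; rewrite (bigD1 k)//= lerDl sumr_ge0.
    by apply: le_trans s1; apply: ler_sum => k _; rewrite expr2 ler_piMl.
  - by move=> s /Sref; exact: hf.
rewrite /side_integral.
apply: (@le_trans _ _ ((Num.sqrt n`!%:R * h ^+ n)%:E * (B%:E * leb n (@unit_ball R n)))%E).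
  apply: lee_pmul => //.
  by apply: integral_ge0 => s hs; rewrite lee_fin; have /andP[] := hf _ (Sref _ hs).
rewrite -(fineK fin) -!EFinM lee_fin /side_cst.
rewrite le_eqVlt; apply/orP; left; apply/eqP; ring.
Qed.

End side_geometry.

(** * The local estimate *)

Section norms.
Variables (R : realType) (n : nat).
Local Notation pt := 'rV[R]_n.
Implicit Types (G K : set pt) (f : pt -> R).

Lemma LpN_ge0 p G f : (0 <= LpN p G f)%E. Proof. exact: Lnorm_ge0. Qed.

Lemma sqr_LpN2 G f : (LpN 2%:E G f ^+ 2 = sqint G f)%E.
Proof.
rewrite /LpN unlock poweR12_sqrt; last by apply: integral_ge0 => x _; exact: poweR_ge0.
rewrite sqr_sqrte; last by apply: integral_ge0 => x _; exact: poweR_ge0.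
rewrite /sqint [RHS]integral_mkcond; apply: eq_integral => x _.
rewrite /= (powR_mulrn 2)// real_normK ?num_real// !patchE.
by case: ifP; rewrite ?expr0n.
Qed.

Lemma sqr_vLpN2 k G (v : pt -> 'rV[R]_k) :
  (vLpN 2%:E G v ^+ 2 = \int[leb n]_(x in G) (nsq (v x))%:E)%E.
Proof. by rewrite /vLpN sqr_LpN2; apply: eq_integral => x _; rewrite sqr_enorm. Qed.

Lemma LpNoo_ae G f : {ae leb n, forall x, G x -> (`|f x|%:E <= LpN +oo G f)%E}.
Proof.
rewrite /LpN unlock leb_setT_gt0.
apply: filterS (ess_sup_ge (leb n) (abse \o (EFin \o (f \_ G)))) => x + Gx.
by rewrite /= patchE mem_set.
Qed.

End norms.

Section energy.
Variable R : realType.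

(** Here [m + 2] is the dimension: the power of [h] is the weight [h^2] times the volume. The 3 is
    from the square of a sum of three terms. *)
Lemma err_sqr m (Nu Ny Np h : R) : 0 < h ->
  h ^+ (m.+2 + 2) * err m.+2 Nu Ny Np h ^+ 2 <=
  3 * (h ^+ m * Ny ^+ 2 + Np ^+ 2 + h ^+ 2 * Nu ^+ 2).
Proof.
move=> h0; rewrite /err.
have s0 : 0 < Num.sqrt (h ^+ m.+2) by rewrite sqrtr_gt0 exprn_gt0.
have ss : Num.sqrt (h ^+ m.+2) ^+ 2 = h ^+ m.+2 by rewrite sqr_sqrtr// exprn_ge0// ltW.
set s := Num.sqrt _ in s0 ss *.
have -> : 3 * (h ^+ m * Ny ^+ 2 + Np ^+ 2 + h ^+ 2 * Nu ^+ 2) =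
  h ^+ (m.+2 + 2) * (3 * ((Nu / s) ^+ 2 + (Ny / h ^+ 2) ^+ 2 + (Np / (s * h)) ^+ 2)).
  have H0 : 0 < h ^+ m by rewrite exprn_gt0.
  have E : h ^+ m.+2 = h ^+ m * h ^+ 2 by rewrite -exprD addn2.
  rewrite !expr_div_n [(s * h) ^+ 2]exprMn ss exprD E; move: (h ^+ m) H0 => H H0; field.
  by rewrite !gt_eqF.
rewrite ler_wpM2l ?exprn_ge0 ?(ltW h0)//.
move: (Nu / s) (Ny / h ^+ 2) (Np / (s * h)) => a b c.
have := sqr_ge0 (a - b); have := sqr_ge0 (b - c); have := sqr_ge0 (a - c); lra.
Qed.

(** Allows the shape regularity constant to be enlarged. Without a supremum the value is 0 by
    default. *)
Lemma inball_diam_ge0 n (A : set 'rV[R]_n) : 0 <= inball_diam A.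
Proof.
rewrite /inball_diam; set E := [set s | _]; have [hE|/sup_out ->//] := pselect (has_sup E).
have [[s Es] ubE] := hE; apply: le_trans (sup_upper_bound hE Es).
by case: Es => x [r [r0 _ ->]]; rewrite mulr_ge0// ltW.
Qed.

End energy.

Section estimate.
Variables (R : realType) (n : nat).
Local Notation pt := 'rV[R]_n.+1.
Local Notation d := (n.+1%:R : R).

Definition bulk_cst (t : R) : R := d * res_cst n t ^+ 2 * ball_vol R n.
Definition side_jump_cst (t : R) : R := n.+2%:R / 2 * (side_cst R n * (d * (3 * jump_cst n t) ^+ 2)).
Definition div_cst (t : R) : R := res_cst n t ^+ 2 * ball_vol R n.
Definition est_cst (t : R) : R := 3 * (bulk_cst t + side_jump_cst t) + div_cst t.

Lemma est_cst_ge0 t :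
  [/\ 0 <= bulk_cst t, 0 <= side_jump_cst t, 0 <= div_cst t & 0 <= est_cst t].
Proof.
have b0 := ball_vol_ge0 R n; have s0 := side_cst_ge0 R n.
have B : 0 <= bulk_cst t by rewrite mulr_ge0// mulr_ge0 ?ler0n ?sqr_ge0.
have J : 0 <= side_jump_cst t.
  by rewrite mulr_ge0 ?divr_ge0 ?ler0n// mulr_ge0// mulr_ge0 ?ler0n ?sqr_ge0.
have V : 0 <= div_cst t by rewrite mulr_ge0// sqr_ge0.
by split => //; rewrite addr_ge0// mulr_ge0// addr_ge0.
Qed.

(** The bulk and jump terms go through [err_sqr], whence the 3; the divergence term already has the
    final power of [h]. With [n > 0] the subtraction [n.+1 - 2] is not truncated. *)
Lemma est_arith (h Nu Ny Np b j v : R) : (0 < n)%N -> 0 < h -> 0 <= b -> 0 <= j -> 0 <= v ->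
  b * (h ^+ (n.+1 + 2) * err n.+1 Nu Ny Np h ^+ 2) + j * (h ^+ (n.+1 + 2) * err n.+1 Nu Ny Np h ^+ 2)
  + v * (h ^+ n.+1 * (Ny / h) ^+ 2) <=
  (3 * (b + j) + v) * (h ^+ (n.+1 - 2) * Ny ^+ 2 + Np ^+ 2 + h ^+ 2 * Nu ^+ 2).
Proof.
case: n => // m _ h0 b0 j0 v0; have := err_sqr m Nu Ny Np h0.
have -> : h ^+ m.+2 * (Ny / h) ^+ 2 = h ^+ m * Ny ^+ 2.
  by rewrite !exprS; field; rewrite gt_eqF.
rewrite subSS subSS subn0; set X := _ * _ ^+ 2 => hX.
have Y0 : 0 <= h ^+ m * Ny ^+ 2 by rewrite mulr_ge0 ?sqr_ge0// exprn_ge0// ltW.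
have Z0 : 0 <= h ^+ 2 * Nu ^+ 2 by rewrite mulr_ge0 ?sqr_ge0.
have W0 := sqr_ge0 Np.
move: X (h ^+ m * _) (h ^+ 2 * _) (Np ^+ 2) hX Y0 Z0 W0 => X Y Z W hX Y0 Z0 W0.
rewrite -mulrDl [leRHS]mulrDl; apply: lerD.
  rewrite [3 * _]mulrC -mulrA; apply: ler_wpM2l => //; exact: addr_ge0.
by apply: ler_wpM2l => //; lra.
Qed.

Lemma nsq_le (v : pt) (B : R) : (forall k, `|v ord0 k| <= B) -> nsq v <= d * B ^+ 2.
Proof.
move=> hv; apply: (@le_trans _ _ (\sum_(k < n.+1) B ^+ 2)).
  apply: ler_sum => k _; rewrite -real_normK ?num_real//.
  by apply: lerXn2r; rewrite ?nnegrE// (le_trans _ (hv k)).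
by rewrite sumr_const card_ord mulr_natl.
Qed.

Variables (G S : set pt) (M : mesh R n) (u y uh yh : pt -> pt) (p ph : pt -> R) (Nu Ny Np s : R).
Hypotheses (n0 : (0 < n)%N) (oG : open G) (lipG : lipschitz_boundary G) (cM : conforming_mesh G M).
Hypotheses (su : forall k, sqfun G (component u k)) (sy : forall k, sqfun G (component y k))
  (sp : sqfun G p) (suh : forall k, sqfun G (component uh k))
  (syh : forall k, sqfun G (component yh k)) (sph : sqfun G ph).
Hypothesis momentum0 : forall k phi, Cc_infty G phi ->
  momentum_fun G (component u k) (component y k) p k phi = 0.
Hypothesis divergence0 : forall phi, Cc_infty G phi ->
  \sum_i \int[leb n.+1]_(x in G) (component y i x * partial i phi x) = 0.
Hypotheses (Nu0 : 0 <= Nu) (Ny0 : 0 <= Ny) (Np0 : 0 <= Np).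
Hypotheses (uhP : forall k, pw_Pk G M 2 (component uh k))
  (yhP : forall k, pw_Pk G M 2 (component yh k)) (phP : pw_Pk G M 1 ph).
Hypothesis s1 : 1 <= s.
Hypothesis regM : forall T, T \in M -> diam (chull T) <= s * inball_diam (chull T).
Variable T : simplex R n.
Hypothesis TM : T \in M.
Hypotheses (TS : chull T `<=` S)
  (TS' : forall i T', shared_side M T i T' -> chull T' `<=` S).
Hypothesis hu : forall k c r, eball c r `<=` S ->
  (sqint (eball c r) (fun x => (component u k x - component uh k x)%R) <= (Nu ^+ 2)%:E)%E.
Hypothesis hy : forall k c r, eball c r `<=` S ->
  {ae leb n.+1, forall x, eball c r x -> `|component y k x - component yh k x| <= Ny}.
Hypothesis hp : forall c r, eball c r `<=` S ->
  (sqint (eball c r) (fun x => (p x - ph x)%R) <= (Np ^+ 2)%:E)%E.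

Let h := diam (chull T).
(** A neighbour [T'] contains a ball of radius [diam T' / (4 s)], and [diam T' >= h / (2 s)] by
    [neighbour_size]; the product of the two factors is [t]. *)
Let t := (8 * s ^+ 2)^-1.
Let E := err n.+1 Nu Ny Np h.

Let nM T' : T' \in M -> nondegenerate T'. Proof. by case: cM => + _ _; apply. Qed.
Let nT : nondegenerate T. Proof. exact: nM. Qed.
Let h0 : 0 < h. Proof. exact: diam_gt0. Qed.
Let s0 : 0 < s. Proof. by apply: lt_le_trans s1. Qed.
Let t01 : 0 < t <= 1.
Proof.
have s2 : 1 <= s ^+ 2 by rewrite exprn_ege1.
rewrite invr_gt0 mulr_gt0 ?exprn_gt0//= invf_le1 ?mulr_gt0 ?exprn_gt0//.
by move: (s ^+ 2) s2 => a a1; lra.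
Qed.
Let E0 : 0 <= E. Proof. exact: err_ge0. Qed.

Let lpu k T' : T' \in M -> quadr (local_poly 2 T' (component uh k)).
Proof. by move=> TM'; apply: is_P2_quadr; case: (local_polyP ((uhP k).2 _ TM')). Qed.
Let lpy k T' : T' \in M -> quadr (local_poly 2 T' (component yh k)).
Proof. by move=> TM'; apply: is_P2_quadr; case: (local_polyP ((yhP k).2 _ TM')). Qed.
Let lpp T' : T' \in M -> affr (local_poly 1 T' ph).
Proof. by move=> TM'; apply: is_P1_affr; case: (local_polyP (phP.2 _ TM')). Qed.

Let agree T' k : T' \in M -> forall x, chull T' x ->
  [/\ component uh k x = local_poly 2 T' (component uh k) x,
      component yh k x = local_poly 2 T' (component yh k) x & ph x = local_poly 1 T' ph x].
Proof.
move=> TM' x Tx; split.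
- by have [_ ->] := local_polyP ((uhP k).2 _ TM').
- by have [_ ->] := local_polyP ((yhP k).2 _ TM').
- by have [_ ->] := local_polyP (phP.2 _ TM').
Qed.

Let incl T' : T' \in M -> h <= 2 * s * diam (chull T') -> diam (chull T') <= 2 * s * h ->
  diam (chull T') <= h / t /\ exists x0, eball x0 (t * h) `<=` chull T'.
Proof.
move=> TM' h1 h2; split.
  apply: le_trans h2 _; rewrite /t invrK mulrC ler_pM2l//.
  have : s <= s ^+ 2 by rewrite expr2 ler_peMl// ltW.
  have := s0; move: (s ^+ 2) => a; lra.
have [x0 hx0] := inball_exists (nM TM') s1 (regM TM').
exists x0 => x hx; apply: hx0; apply: le_trans hx _.
rewrite /t ler_pdivlMr ?mulr_gt0// [leLHS](_ : _ = h / (2 * s)); last by field; rewrite gt_eqF.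
by rewrite ler_pdivrMr ?mulr_gt0// mulrC.
Qed.

Let inclT : diam (chull T) <= h / t /\ exists x0, eball x0 (t * h) `<=` chull T.
Proof. by apply: incl => //; rewrite ler_peMl ?(ltW h0)//; have := s1; lra. Qed.

Let TG T' : T' \in M -> chull T' `<=` closure G.
Proof. by case: cM => _ -> _ TM' x Tx; exists T'. Qed.

Lemma bulk_estimate : ((h ^+ 2)%:E * vLpN 2%:E (chull T) (residual T yh ph uh) ^+ 2 <=
  (bulk_cst t * (h ^+ (n.+1 + 2) * E ^+ 2))%:E)%E.
Proof.
have [dT [x0 hx0]] := inclT.
rewrite sqr_vLpN2; apply: (@le_trans _ _ ((h ^+ 2)%:E *
    (d * (res_cst n t * E) ^+ 2 * (h ^+ n.+1 * ball_vol R n))%:E)%E).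
  apply: lee_wpmul2l; first by rewrite lee_fin sqr_ge0.
  apply: integral_simplex_le => //; last by rewrite mulr_ge0// sqr_ge0.
  move=> x Tx; rewrite nsq_ge0/=; apply: nsq_le => k.
  have [uE _ _] := agree k TM Tx.
  rewrite mxE -[uh x ord0 k]/(component uh k x) uE.
  exact: (residual_bound oG lipG su sy sp suh syh sph momentum0 Nu0 Ny0 Np0 hu hy hp
    nT t01 h0 hx0 dT (TG TM) TS (lpu k TM) (lpy k TM) (lpp TM) (agree k TM) Tx).
rewrite -EFinM lee_fin /bulk_cst le_eqVlt; apply/orP; left; apply/eqP.
by rewrite exprD; ring.
Qed.

Lemma div_estimate : (LpN 2%:E (chull T) (local_div T yh) ^+ 2 <=
  (div_cst t * (h ^+ n.+1 * (Ny / h) ^+ 2))%:E)%E.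
Proof.
have [dT [x0 hx0]] := inclT.
rewrite sqr_LpN2; apply: (@le_trans _ _
    ((res_cst n t * (Ny / h)) ^+ 2 * (h ^+ n.+1 * ball_vol R n))%:E).
  apply: integral_simplex_le => //; last by rewrite sqr_ge0.
  move=> x Tx; rewrite sqr_ge0/= -real_normK ?num_real//.
  apply: lerXn2r; rewrite ?nnegrE//.
    by rewrite mulr_ge0 ?res_cst_ge0 ?divr_ge0 ?(ltW h0)//; case/andP: t01.
  apply: (divergence_residual_bound oG lipG sy syh divergence0 Ny0 hy
    nT t01 h0 hx0 dT (TG TM) TS (fun k => lpy k TM)) => // k z Tz.
  by have [] := agree k TM Tz.
by rewrite lee_fin /div_cst le_eqVlt; apply/orP; left; apply/eqP; ring.
Qed.

Lemma jump_estimate : ((h / 2)%:E * jump_norm M T yh ^+ 2 <=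
  (side_jump_cst t * (h ^+ (n.+1 + 2) * E ^+ 2))%:E)%E.
Proof.
have B0 : 0 <= 3 * (h * (jump_cst n t * E)).
  by rewrite mulr_ge0// mulr_ge0 ?(ltW h0)// mulr_ge0// jump_cst_ge0//; case/andP: t01.
pose B := d * (3 * (h * (jump_cst n t * E))) ^+ 2.
have B0' : 0 <= B by rewrite mulr_ge0// sqr_ge0.
have sgn i T' : shared_side M T i T' -> (side_integral (side T i)
       (fun x => enorm (jump (side T i) T T' yh x) ^+ 2)%R <= (side_cst R n * (h ^+ n * B))%:E)%E.
  move=> sh; have [TM' TT' [j hS]] := sh; apply: side_integral_le => // x Sx.
  rewrite sqr_ge0/= sqr_enorm; apply: nsq_le => k.
  (* The sizes are compared in both directions: the neighbour must be large enough to contain the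
     ball and small enough for the extrapolation. *)
  have h1 := neighbour_size n0 nT (nM TM') hS s1 (regM TM).
  have h2 := neighbour_size n0 (nM TM') nT (esym hS) s1 (regM TM').
  have [dT [x0 hx0]] := inclT; have [dT' [x0' hx0']] := incl TM' h1 h2.
  have [nu1 nu2] := side_normal_shared n0 cM TM TM' TT' hS.
  have := jump_on_side n0 oG lipG cM su sy sp suh syh sph momentum0 Nu0 Ny0 Np0 hu hy hp
    TM TM' TT' hS t01 h0 hx0 dT hx0' dT' TS (TS' sh) (lpu k TM) (lpu k TM') (lpy k TM) (lpy k TM')
    (lpp TM) (lpp TM') (agree k TM) (agree k TM') Sx.
  rewrite -nu1 !derive_sum_partial; [|exact: lpy|exact: lpy].
  congr (`|_| <= _); rewrite /jump nu2 -nu1 !mxE; congr (_ + _).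
  by rewrite -sumrN; apply: eq_bigr => j' _; rewrite mxE mulrN.
have sum0 : (0 <= \sum_(i < n.+2) \sum_(T' <- M | `[< shared_side M T i T' >])
     side_integral (side T i) (fun x => enorm (jump (side T i) T T' yh x) ^+ 2)%R)%E.
  apply: sume_ge0 => i _; apply: sume_ge0 => T' _; rewrite /side_integral mule_ge0//.
  by apply: integral_ge0 => x _; rewrite lee_fin sqr_ge0.
rewrite /jump_norm poweR12_sqrt// sqr_sqrte//.
apply: (@le_trans _ _ ((h / 2)%:E * (\sum_(i < n.+2) (side_cst R n * (h ^+ n * B))%:E))%E).
  apply: lee_wpmul2l; first by rewrite lee_fin divr_ge0// ltW.
  apply: lee_sum => i _; apply: sum_unique_le.
  - exact: fset_uniq.
  - by rewrite mulr_ge0 ?side_cst_ge0// mulr_ge0// exprn_ge0// ltW.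
  - by move=> T1 T2 _ _ /asboolP h1 /asboolP h2; exact: (unique_neighbour cM TM h1 h2).
  - by move=> T' _ /asboolP; exact: sgn.
rewrite sumEFin -EFinM lee_fin sumr_const card_ord -mulr_natl /side_jump_cst /B le_eqVlt.
by apply/orP; left; apply/eqP; rewrite addn2 !exprS; field.
Qed.

Lemma local_estimate : (E_st M T yh ph uh ^+ 2 <=
  (est_cst t * (h ^+ (n.+1 - 2) * Ny ^+ 2 + Np ^+ 2 + h ^+ 2 * Nu ^+ 2))%:E)%E.
Proof.
have nn0 : (0 <= (h ^+ 2)%:E * vLpN 2%:E (chull T) (residual T yh ph uh) ^+ 2
    + (h / 2)%:E * jump_norm M T yh ^+ 2 + LpN 2%:E (chull T) (local_div T yh) ^+ 2)%E.
  have H (a : R) (x : \bar R) : 0 <= a -> (0 <= a%:E * x ^+ 2)%E.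
    by move=> a0; rewrite mule_ge0// sqre_ge0.
  by rewrite !adde_ge0 ?sqre_ge0// H ?sqr_ge0// divr_ge0// ltW.
rewrite /E_st poweR12_sqrt// sqr_sqrte//.
apply: le_trans (leeD (leeD bulk_estimate jump_estimate) div_estimate) _.
rewrite -!EFinD lee_fin.
have [b0 j0 v0 _] := est_cst_ge0 t.
exact: est_arith.
Qed.

End estimate.

(** The error norms are extended reals. If one is infinite, so is the right-hand side, all
    coefficients being positive; real norms may then be assumed. *)
Lemma finite_error_bound (R : realType) (L X Y Z : \bar R) (C c1 c3 : R) :
  0 < C -> 0 < c1 -> 0 < c3 -> (0 <= X)%E -> (0 <= Y)%E -> (0 <= Z)%E ->
  (forall x y z, X = x%:E -> Y = y%:E -> Z = z%:E -> 0 <= x -> 0 <= y -> 0 <= z ->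
    (L <= (C * (c1 * x ^+ 2 + y ^+ 2 + c3 * z ^+ 2))%:E)%E) ->
  (L <= C%:E * (c1%:E * X ^+ 2 + Y ^+ 2 + c3%:E * Z ^+ 2))%E.
Proof.
move=> C0 p1 p3; have yy (a : R) : 0 < a -> (a%:E * +oo = +oo :> \bar R)%E by move=> ?; rewrite gt0_muley ?lte_fin.
have S2 (x : R) : (x%:E ^+ 2 = (x ^+ 2)%:E)%E by rewrite EFin_expe.
have Sy : (+oo ^+ 2 = +oo :> \bar R)%E by rewrite expe2 mulyy.
case: X => [x| |]// X0; case: Y => [y| |]// Y0; case: Z => [z| |]// Z0 H.
  by rewrite !S2 -!EFinM; apply: H; rewrite -?lee_fin.
all: by rewrite ?Sy ?S2 -?EFinM ?yy// ?addye ?addey ?yy ?leey.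
Qed.

Theorem theorem6p3 (R : realType) (n : nat) (hd : n.+1 = 2%N \/ n.+1 = 3%N)
  (Omega : set 'rV[R]_n.+1)
  (Omega_open : open Omega) (Omega_connected : connected Omega)
  (Omega_neq0 : Omega !=set0) (Omega_bounded : bounded_set Omega)
  (Omega_polytopal : polytopal Omega)
  (Omega_lipschitz : lipschitz_boundary Omega)
  (M0 : mesh R n) (MM : set (mesh R n))
  (M0_conforming : conforming_mesh Omega M0)
  (MM_conforming : forall M, MM M -> conforming_mesh Omega M)
  (MM_refines : forall M, MM M -> refines M M0)
  (MM_shape_regular : shape_regular MM) :
  exists2 C : R, 0 < C &
  forall (D : {fset 'rV[R]_n.+1}) (yt : 'rV[R]_n.+1 -> 'rV[R]_n.+1)
         (lambda : R) (a b : 'rV[R]_n.+1) (alpha : R),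
    (0 < #|` D|)%N -> (forall t, t \in D -> Omega t) ->
    0 < lambda -> (forall i, a ord0 i < b ord0 i) ->
    n.+1%:R - 2 < alpha -> alpha < 2 ->
  forall (y : 'rV[R]_n.+1 -> 'rV[R]_n.+1) (p : 'rV[R]_n.+1 -> R)
         (z : 'rV[R]_n.+1 -> 'rV[R]_n.+1) (r : 'rV[R]_n.+1 -> R)
         (u : 'rV[R]_n.+1 -> 'rV[R]_n.+1),
    OS Omega D yt lambda a b alpha y p z r u ->
  forall (M : mesh R n), MM M ->
  forall (yh : 'rV[R]_n.+1 -> 'rV[R]_n.+1) (ph : 'rV[R]_n.+1 -> R)
         (zh : 'rV[R]_n.+1 -> 'rV[R]_n.+1) (rh : 'rV[R]_n.+1 -> R)
         (uh : 'rV[R]_n.+1 -> 'rV[R]_n.+1),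
    DOS Omega M D yt lambda a b yh ph zh rh uh ->
  forall T : simplex R n, T \in M ->
    (E_st M T yh ph uh ^+ 2 <=
     C%:E * ((diam (chull T) ^+ (n.+1 - 2))%:E
               * vLpN +oo (side_patch M T) (fun x => (y x - yh x)%R) ^+ 2
             + LpN 2%:E (side_patch M T) (fun x => (p x - ph x)%R) ^+ 2
             + ((diam (chull T)) ^+ 2)%:E
               * vLpN 2%:E (side_patch M T) (fun x => (u x - uh x)%R) ^+ 2))%E.
Proof.
have n0 : (0 < n)%N by case: hd => [[->]|[->]].
have finG := leb_bounded_lty (open_measurable_rV Omega_open) Omega_bounded.
have [sigma regMM] := MM_shape_regular.
(* The geometric lemmas ask for a regularity constant of at least 1. *)
pose s := Num.max sigma 1.
have s1 : 1 <= s by rewrite le_max lexx orbT.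
have [_ _ _ C0] := est_cst_ge0 n (8 * s ^+ 2)^-1.
(* [est_cst] is shown to be nonnegative; adding 1 makes the constant positive. *)
exists (est_cst n (8 * s ^+ 2)^-1 + 1); first by rewrite ltr_wpDl.
move=> D yt lambda a b alpha _ _ _ _ _ _ y p z r u [[Hy [Hp _] _ _ [Hu _]] [mom div] _ _].
move=> M MM_M yh ph zh rh uh [[[yhP Hyh] [phP [Hph _]] _ _ [uhP [Huh _]]] _ _ _] T TM.
have cM := MM_conforming _ MM_M.
have nT : Defs.nondegenerate T by case: cM => + _ _; apply.
have h0 := diam_gt0 nT.
have sqv v : vH10 (fun=> 1) Omega v -> forall k, sqfun Omega (component v k).
  by move=> Hv k; apply: L2_sqint; have [[]] := Hv k.
have TS : chull T `<=` side_patch M T by move=> x Tx; exists T => //; left.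
have TS' i T' : shared_side M T i T' -> chull T' `<=` side_patch M T.
  by move=> sh x Tx; exists T' => //; right; exists i.
apply: finite_error_bound; rewrite ?exprn_gt0 ?ltr_wpDl ?LpN_ge0//.
move=> Ny Np Nu yE pE uE Ny0 Np0 Nu0.
apply: (@le_trans _ _ (est_cst n (8 * s ^+ 2)^-1 *
  (diam (chull T) ^+ (n.+1 - 2) * Ny ^+ 2 + Np ^+ 2 + diam (chull T) ^+ 2 * Nu ^+ 2))%:E); last first.
  rewrite lee_fin; apply: ler_wpM2r; last by rewrite lerDl.
  have h1 : 0 <= diam (chull T) ^+ (n.+1 - 2) by rewrite exprn_ge0// ltW.
  apply: addr_ge0; last exact: mulr_ge0 (sqr_ge0 _) (sqr_ge0 _).
  by apply: addr_ge0; [exact: mulr_ge0 h1 (sqr_ge0 _)|exact: sqr_ge0].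
apply: (local_estimate (G := Omega) (S := side_patch M T) (u := u) (y := y) (p := p)) => //.
- by move=> k; exact/L2_sqint.
- exact: sqv.
- exact: L2_sqint.
- by move=> k; exact/L2_sqint.
- exact: sqv.
- exact: L2_sqint.
- by move=> k phi; exact: (state_momentum Omega_open Hy Hp Hu mom).
- exact: (state_div Omega_open finG Hy div).
- move=> T' TM'; apply: le_trans (regMM _ _ MM_M TM') _.
  by apply: ler_wpM2r; rewrite ?inball_diam_ge0// le_max lexx.
(* A single component is bounded pointwise by the Euclidean length of the error, and the ball is
   contained in the patch. *)
- move=> k c rr sub; have := sqr_vLpN2 (side_patch M T) (fun x => u x - uh x).
  rewrite uE EFin_expe => ->; apply: nneg_integral_le => // x _; rewrite ?nsq_ge0//.
  rewrite sqr_ge0 /nsq (bigD1 k)//= !mxE lerDl; apply: sumr_ge0 => j _; exact: sqr_ge0.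
- move=> k c rr sub; apply: filterS (LpNoo_ae (side_patch M T) (fun x => enorm (y x - yh x))) => x hx cx.
  have := hx (sub _ cx); rewrite -/(vLpN +oo _ _) yE lee_fin ger0_norm ?enorm_ge0//.
  apply: le_trans; have := enorm_coord (y x - yh x) k; by rewrite !mxE.
- move=> c rr sub; have := sqr_LpN2 (side_patch M T) (fun x => p x - ph x).
  by rewrite pE EFin_expe => ->; apply: nneg_integral_le => // x _; rewrite sqr_ge0 ?lexx.
Qed.
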